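(* Let $\Omega\subset\mathbb{R}^N$ be a bounded open set with $C^3$-smooth boundary, and assume that $p\in(1,2]$, $a\in\mathbb{R}\setminus\{0\}$ and $u_0\in C_0(\overline{\Omega})$. Let $u$ be the corresponding classical solution in $Q_\infty$ to $$u_t-\Delta u=a|\nabla u|^p \ \text{ in } (0,\infty)\times\Omega,\qquad u=0\ \text{ on } (0,\infty)\times\partial\Omega,\qquad u(0,\cdot)=u_0\ \text{ in }\Omega.$$ Then there is a constant $K>0$ depending only on $u_0$, $\Omega$, $a$ and $p$ such that, for all $t>0$, $$\|u(t)\|_\infty\le K e^{-t\lambda_1},\qquad \|\nabla u(t)\|_\infty\le K(1+t^{-1/2})e^{-t\lambda_1},$$ where $\lambda_1>0$ denotes the first eigenvalue of the Laplace operator (i.e. of $-\Delta$) with homogeneous Dirichlet boundary conditions in $\Omega$.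
   Context: $C_0(\overline{\Omega})$ is the space of continuous functions on $\overline{\Omega}$ vanishing on $\partial\Omega$; $\|\cdot\|_\infty$ is the norm of $L^\infty(\Omega)$. For $T\in(0,\infty]$, $Q_T=(0,T)\times\Omega$, and $C^{1,2}(Q_T)$ is the space of functions in $C(Q_T)$ that are differentiable in $t$ and twice differentiable in $x$ with $u_t,u_{x_i},u_{x_ix_j}\in C(Q_T)$. A classical solution in $Q_T$ with initial datum $u_0\in C_0(\overline\Omega)$ is a function $u\in C([0,T)\times\overline{\Omega})\cap C^{1,2}(Q_T)$ with $u(0)=u_0$, satisfying the equation pointwise in $Q_T$ and vanishing on $(0,T)\times\partial\Omega$. It also satisfies $u(t)=e^{t\Delta}u_0+a\int_0^t e^{(t-s)\Delta}|\nabla u(s)|^p\,ds$ for $t\in[0,T)$, where $(e^{t\Delta})_{t\ge0}$ is the linear heat semigroup in $\Omega$ with homogeneous Dirichlet boundary conditions. It is known that for $p\in(0,2]$, $a\in\mathbb{R}\setminus\{0\}$ and $u_0\in C_0(\overline{\Omega})$ there is a unique classical solution in $Q_\infty$. *)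

(* Defs.v *)
(* Points of R^N are row vectors 'rV[R]_N; the library norm
   on 'rV[R]_N is the sup norm, which gives the usual topology. *)
From mathcomp Require Import all_boot all_order all_algebra.
From mathcomp Require Import all_classical all_reals all_analysis.

Set Implicit Arguments.
Unset Strict Implicit.
Unset Printing Implicit Defensive.

Import Order.TTheory GRing.Theory Num.Theory.
Import numFieldNormedType.Exports.
Local Open Scope classical_set_scope.
Local Open Scope ring_scope.

Section Calculus.
Context {R : realType} {N : nat}.
Implicit Types (A Omega : set 'rV[R]_N) (f : 'rV[R]_N -> R).

Definition ebase (i : 'I_N) : 'rV[R]_N := delta_mx 0 i.

Definition partial (i : 'I_N) f : 'rV[R]_N -> R := 'D_(ebase i) f.

Definition grad f (x : 'rV[R]_N) : 'rV[R]_N := \row_i partial i f x.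

Definition laplacian f (x : 'rV[R]_N) : R := \sum_i partial i (partial i f) x.

Definition euclid_norm (v : 'rV[R]_N) : R := Num.sqrt (\sum_i v 0 i ^+ 2).

(* C^k on A; meant for A open, so that the partial derivatives at points of A
   depend only on the restriction of f to A. *)
Fixpoint Ck (k : nat) A f : Prop :=
  {within A, continuous f} /\
  match k with
  | 0%N => True
  | k'.+1 => forall i : 'I_N,
      (forall x, A x -> derivable f x (ebase i)) /\ Ck k' A (partial i f)
  end.

Definition bdry A : set 'rV[R]_N := closure A `\` interior A.

Definition C0_closure Omega f : Prop :=
  {within closure Omega, continuous f} /\ (forall x, bdry Omega x -> f x = 0).

(* Lebesgue-null sets: the library has no Lebesgue measure on 'rV[R]_N. *)
Definition lebesgue_null A : Prop :=
  forall e : R, 0 < e ->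
  exists a b : nat -> 'rV[R]_N,
    [/\ forall k i, a k 0 i <= b k 0 i,
        A `<=` \bigcup_k [set x | forall i, a k 0 i <= x 0 i <= b k 0 i]
      & (\sum_(0 <= k <oo) (\prod_i (b k 0 i - a k 0 i))%:E <= e%:E)%E].

Definition Linfty_norm Omega f : \bar R :=
  ereal_inf [set M%:E | M in
    [set M : R | 0 <= M /\ lebesgue_null (Omega `&` [set x | M < `|f x|])]].

(* Classical eigenfunctions; on bounded domains with C^3 boundary these are, by
   elliptic regularity, exactly the weak (H^1_0) ones. *)
Definition dirichlet_eigenvalue Omega (l : R) : Prop :=
  exists phi : 'rV[R]_N -> R,
    [/\ Ck 2 Omega phi, C0_closure Omega phi,
        exists2 x, Omega x & phi x != 0
      & forall x, Omega x -> - laplacian phi x = l * phi x].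

Definition first_dirichlet_eigenvalue Omega (l : R) : Prop :=
  dirichlet_eigenvalue Omega l /\
  (forall m, dirichlet_eigenvalue Omega m -> l <= m).

End Calculus.

(* Near each boundary point, after choosing one coordinate axis i and an
   orientation b of it, Omega is the strict epigraph of a C^3 function of the
   other N - 1 coordinates (col' i x is x with its i-th entry removed). *)
Definition C3_boundary {R : realType} {N : nat} (Omega : set 'rV[R]_N) : Prop :=
  forall x0, bdry Omega x0 ->
  exists (i : 'I_N) (b : bool) (gamma : 'rV[R]_N.-1 -> R),
    Ck 3 setT gamma /\
    \forall x \near x0,
      Omega x <-> 0 < (-1) ^+ b * (x 0 i - gamma (col' i x)).

Section Parabolic.
Context {R : realType} {N : nat}.
Implicit Types (Omega : set 'rV[R]_N) (T : \bar R) (u : R -> 'rV[R]_N -> R).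

Definition Qcyl T Omega : set (R * 'rV[R]_N) :=
  [set z | [/\ 0 < z.1, (z.1%:E < T)%E & Omega z.2]].

Definition Qcyl_closure T Omega : set (R * 'rV[R]_N) :=
  [set z | [/\ 0 <= z.1, (z.1%:E < T)%E & closure Omega z.2]].

Definition dt u (t : R) (x : 'rV[R]_N) : R := 'D_1 (u ^~ x) t.

Definition C12 (Q : set (R * 'rV[R]_N)) u : Prop :=
  [/\ {within Q, continuous (fun z => u z.1 z.2)},
      (forall z, Q z -> derivable (u ^~ z.2) z.1 1) /\
      {within Q, continuous (fun z => dt u z.1 z.2)},
      forall i : 'I_N,
        (forall z, Q z -> derivable (u z.1) z.2 (ebase i)) /\
        {within Q, continuous (fun z => partial i (u z.1) z.2)}
    & forall i j : 'I_N,
        (forall z, Q z -> derivable (partial i (u z.1)) z.2 (ebase j)) /\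
        {within Q, continuous (fun z => partial j (partial i (u z.1)) z.2)}].

Definition classical_solution T Omega (a p : R) (u0 : 'rV[R]_N -> R) u : Prop :=
  [/\ {within Qcyl_closure T Omega, continuous (fun z => u z.1 z.2)},
      C12 (Qcyl T Omega) u,
      forall x, closure Omega x -> u 0 x = u0 x,
      forall t x, Qcyl T Omega (t, x) ->
        dt u t x - laplacian (u t) x = a * euclid_norm (grad (u t) x) `^ p
    & forall t x, 0 < t -> (t%:E < T)%E -> bdry Omega x -> u t x = 0].

End Parabolic.

(* Main.v *)
Require Import Defs.
From mathcomp Require Import all_boot all_order all_algebra.
From mathcomp Require Import all_classical all_reals all_analysis.
From mathcomp Require Import ring lra.
Set Implicit Arguments.
Unset Strict Implicit.
Unset Printing Implicit Defensive.
Import Order.TTheory GRing.Theory Num.Theory.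
Import numFieldNormedType.Exports.
Local Open Scope classical_set_scope.
Local Open Scope ring_scope.

(* Everything follows from the maximum principle.  Comparison with an explicit
   supersolution gives a first exponential decay.  Comparing u(t,x) - u(t,y)
   with a concave function of |x - y|, with the help of a boundary barrier,
   gives |grad u(t + T)| <= C sup|u| / sqrt T for T <= 1.  Hence, if u decays
   at rate d then |grad u|^p decays at rate p d, and comparison with
   e^(-d' t) psi, where psi > 0 is bounded and -Lap psi >= lambda1 psi, upgrades
   the rate to every d' <= lambda1 with d' < p d.  As p > 1, finitely many
   steps reach lambda1.  The constant depends on u0 only because u0 determines u.

   The supersolution psi is found by finite differences.  On a grid of mesh h,
   either the minimal supersolution of -Lap_h w = l w + 1 exists for l = lambda1,
   or the minimal supersolutions become unbounded at some l <= lambda1.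
   After normalisation they are compact (interior estimates for difference
   quotients, barrier at the boundary), and the limit solves
   -Lap v = mu v + c.  When c = 0 it is an eigenfunction, so mu = lambda1 by
   minimality; when c > 0, mu = lambda1 by construction.  The strong maximum
   principle makes v positive on each connected component of Omega, and the
   components are treated separately. *)

(** * Limits along an ultrafilter, pointwise expansions *)

(** About [lambda1] it is only known that no classical Dirichlet eigenvalue is smaller, so the
    hypothesis can be exploited only by exhibiting eigenfunctions. The given eigenfunction cannot
    serve as [psi]: it may change sign or vanish on whole components. On a grid, minimal
    supersolutions are plain infima, which makes the construction of a positive one elementary.

    A positive [psi] is still not enough. It may tend to 0 at the boundary, and the margin that it
    provides against the source [a |grad u|^p] degenerates with it; the function [h] in [decay_half]
    supplies the missing margin in a boundary layer, at the price of a term of rate [p d], faster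
    than the target rate.

    The nonlinearity is never linearised. Each comparison is settled at a touching point, where the
    two gradients coincide, so [|grad u|^p] may be evaluated on whichever gradient is under
    control. *)

Section Ultra.

(* Limits along a fixed nonprincipal ultrafilter replace all extractions of
   convergent subsequences. *)
Definition Uf : set_system nat :=
  projT1 (cid (ultraFilterLemma (@eventually_filter))).

#[global] Instance Uf_ultra : UltraFilter Uf.
Proof. exact: (projT2 (cid (ultraFilterLemma (@eventually_filter)))).1. Qed.

Lemma Uf_ge (P : nat -> Prop) n0 :
  (forall n, (n0 <= n)%N -> P n) -> \forall n \near Uf, P n.
Proof.
move=> h; apply: (projT2 (cid (ultraFilterLemma (@eventually_filter)))).2.
by exists n0.
Qed.

Lemma Uf_em (P : nat -> Prop) :
  (\forall n \near Uf, P n) \/ (\forall n \near Uf, ~ P n).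
Proof. exact: in_ultra_setVsetC. Qed.

Lemma Uf_ex (P : nat -> Prop) : (\forall n \near Uf, P n) -> exists n, P n.
Proof. exact: filter_ex. Qed.

(** An ultrafilter converges to each of its cluster points, so compactness yields a limit
    directly. *)
Lemma Uf_compact (T : topologicalType) (K : set T) (a : nat -> T) :
  compact K -> (\forall n \near Uf, K (a n)) -> exists2 p, K p & a @ Uf --> p.
Proof.
move=> cK Ka; have [p [Kp clp]] := cK (a @ Uf) _ Ka.
exists p => // V Vp; have [//|h] := Uf_em (a @^-1` V).
by have [x []] := clp (~` V) V h Vp.
Qed.

End Ultra.

Section UltraReal.
Context {R : realType}.

Lemma Uf_bounded (a : nat -> R) (M : R) :
  (\forall n \near Uf, `|a n| <= M) -> exists l : R, a @ Uf --> l.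
Proof.
move=> h; have [||p _ ?] := @Uf_compact R `[- M, M] a; last by exists p.
- exact: segment_compact.
- by apply: filterS h => n; rewrite ler_norml /= in_itv.
Qed.

Lemma Uf_bounded_rV N (x : nat -> 'rV[R]_N) (M : R) :
  (\forall n \near Uf, `|x n| <= M) -> exists l : 'rV[R]_N, x @ Uf --> l.
Proof.
move=> h; have [||p _ ?] := @Uf_compact _ [set z : 'rV[R]_N | `|z| <= M] x.
- apply: bounded_closed_compact.
  + exists M; split; first exact: num_real.
    by move=> y My z /= zM; apply: le_trans zM (ltW My).
  + exact: (@closed_comp _ _ (fun z : 'rV[R]_N => `|z|) [set y | y <= M])
      (in1W (@norm_continuous _ _)) (@closed_le _ M).
- exact: h.
- by exists p.
Qed.

Lemma Uf_inv : (fun n => n.+1%:R^-1 : R) @ Uf --> (0 : R).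
Proof.
have := @cvg_harmonic R; apply: cvg_trans => P /= [n0 _ h].
by apply: (@Uf_ge _ n0) => n; apply: h.
Qed.

Lemma cvg_sumf T (F : set_system T) {FF : Filter F} n (f : 'I_n -> T -> R) (l : 'I_n -> R) :
  (forall i, f i @ F --> l i) -> (fun t => \sum_i f i t) @ F --> \sum_i l i.
Proof.
move=> h; elim: (index_enum _) => [|i r IH].
  by rewrite big_nil; under eq_fun do rewrite big_nil; apply: cvg_cst.
by rewrite big_cons; under eq_fun do rewrite big_cons; apply: cvgD.
Qed.

Lemma cvg_sqr T (F : set_system T) {FF : Filter F} (f : T -> R) (l : R) :
  f @ F --> l -> (fun t => f t ^+ 2) @ F --> l ^+ 2.
Proof. by move=> h; under eq_fun do rewrite expr2; rewrite expr2; apply: cvgM. Qed.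

Lemma cont_sumf (T : topologicalType) n (f : 'I_n -> T -> R) :
  (forall i, continuous (f i)) -> continuous (fun x => \sum_i f i x).
Proof. by move=> h x; apply: (@cvg_sumf _ (nbhs x) _ n f) => i; apply: h. Qed.

Lemma cont_sqr (T : topologicalType) (f : T -> R) :
  continuous f -> continuous (fun x => f x ^+ 2).
Proof. by move=> h x; apply: (@cvg_sqr _ (nbhs x) _ f); apply: h. Qed.

Lemma contD (T : topologicalType) (f g : T -> R) :
  continuous f -> continuous g -> continuous (fun x => f x + g x).
Proof. by move=> hf hg x; apply: (@cvgD _ _ _ (nbhs x)); [apply: hf | apply: hg]. Qed.

Lemma contB (T : topologicalType) (f g : T -> R) :
  continuous f -> continuous g -> continuous (fun x => f x - g x).
Proof. by move=> hf hg x; apply: (@cvgB _ _ _ (nbhs x)); [apply: hf | apply: hg]. Qed.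

Lemma contM (T : topologicalType) (f g : T -> R) :
  continuous f -> continuous g -> continuous (fun x => f x * g x).
Proof. by move=> hf hg x; apply: (@cvgM _ _ (nbhs x)); [apply: hf | apply: hg]. Qed.

Lemma contC (T : topologicalType) (c : R) : continuous (fun _ : T => c).
Proof. by move=> x; apply: cvg_cst. Qed.

Lemma contZ (T : topologicalType) (c : R) (f : T -> R) :
  continuous f -> continuous (fun x => c * f x).
Proof. by apply: contM; apply: contC. Qed.

End UltraReal.

Section Jets.
Context {R : realType}.
Implicit Types F G : R -> R.

(* Pointwise (Peano) expansions at 0: second-order information at one point is
   all that the maximum principle uses, so neither C^1 nor C^2 regularity is
   needed along the way. *)
Definition jet1 F d := forall e, 0 < e -> exists2 dl, 0 < dl &
  forall s, `|s| < dl -> `|F s - F 0 - d * s| <= e * `|s|.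

Definition jet2 F d1 d2 := forall e, 0 < e -> exists2 dl, 0 < dl &
  forall s, `|s| < dl -> `|F s - F 0 - d1 * s - d2 / 2 * s ^+ 2| <= e * s ^+ 2.

Lemma is_derive_jet1 (V : normedModType R) (f : V -> R) x v c :
  is_derive x v f c <-> jet1 (fun s => f (x + s *: v)) c.
Proof.
split=> [[df <-]|h].
  move=> e e0; move/cvgrPdist_le: df => /(_ e e0) /nbhs_ballP[d /= d0 h].
  exists d => // s sd; have [->|s0] := eqVneq s 0.
    by rewrite mulr0 subrr subrr normr0 mulr0.
  have := h s; rewrite /ball/= sub0r normrN => /(_ sd s0) {h}.
  rewrite -/(derive f x v) => h.
  rewrite -ler_pdivrMr ?normr_gt0 // -normfV -normrM mulrC.
  apply: le_trans h; rewrite distrC scale0r addr0 !mulrBr.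
  by rewrite [_ + x]addrC mulrCA mulVf // mulr1 -mulrBr.
have hc : (fun s => s^-1 *: ((f \o shift x) (s *: v) - f x)) @ 0^' --> c.
  apply/cvgrPdist_le => e e0; have [d d0 hd] := h e e0.
  apply/nbhs_ballP; exists d => //= s; rewrite /ball/= sub0r normrN => sd s0.
  have := hd s sd; rewrite scale0r addr0 -ler_pdivrMr ?normr_gt0 //.
  rewrite -normfV -normrM mulrC; apply: le_trans.
  by rewrite distrC [s *: v + x]addrC !mulrBr mulrCA mulVf // mulr1 -mulrBr.
by split; [apply/cvg_ex; exists c | apply: cvg_lim].
Qed.

Lemma jet1_cst c : jet1 (fun=> c) 0.
Proof. by move=> e e0; exists 1 => // s _; rewrite mul0r subrr subrr normr0 mulr_ge0 // ltW. Qed.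

Lemma jet2_cst c : jet2 (fun=> c) 0 0.
Proof. by move=> e e0; exists 1 => // s _; rewrite !mul0r !subrr normr0 mulr_ge0 ?sqr_ge0 // ltW. Qed.

Lemma jet1_lin F G a b c d : jet1 F c -> jet1 G d ->
  jet1 (fun s => a * F s + b * G s) (a * c + b * d).
Proof.
move=> hF hG e e0.
have p0 : 0 < `|a| + `|b| + 1 by have := normr_ge0 a; have := normr_ge0 b; lra.
have [d1 d10 h1] := hF (e / (`|a| + `|b| + 1)) (divr_gt0 e0 p0).
have [d2 d20 h2] := hG (e / (`|a| + `|b| + 1)) (divr_gt0 e0 p0).
exists (Num.min d1 d2); first by rewrite lt_min d10.
move=> s; rewrite lt_min => /andP[/h1 {}h1 /h2 {}h2].
rewrite (_ : _ - _ = a * (F s - F 0 - c * s) + b * (G s - G 0 - d * s)); last by ring.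
apply: le_trans (ler_normD _ _) _; rewrite !normrM.
apply: le_trans (lerD (ler_wpM2l (normr_ge0 a) h1) (ler_wpM2l (normr_ge0 b) h2)) _.
rewrite -mulrDl mulrA ler_wpM2r // mulrCA -[leRHS]mulr1 ler_wpM2l ?(ltW e0) //.
by rewrite ler_pdivrMr // mul1r; lra.
Qed.

Lemma jet2_lin F G a b c1 c2 d1 d2 : jet2 F c1 c2 -> jet2 G d1 d2 ->
  jet2 (fun s => a * F s + b * G s) (a * c1 + b * d1) (a * c2 + b * d2).
Proof.
move=> hF hG e e0.
have p0 : 0 < `|a| + `|b| + 1 by have := normr_ge0 a; have := normr_ge0 b; lra.
have [e1 e10 h1] := hF (e / (`|a| + `|b| + 1)) (divr_gt0 e0 p0).
have [e2 e20 h2] := hG (e / (`|a| + `|b| + 1)) (divr_gt0 e0 p0).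
exists (Num.min e1 e2); first by rewrite lt_min e10.
move=> s; rewrite lt_min => /andP[/h1 {}h1 /h2 {}h2].
rewrite (_ : _ - _ = a * (F s - F 0 - c1 * s - c2 / 2 * s ^+ 2) +
   b * (G s - G 0 - d1 * s - d2 / 2 * s ^+ 2)); last by ring.
apply: le_trans (ler_normD _ _) _; rewrite !normrM.
apply: le_trans (lerD (ler_wpM2l (normr_ge0 a) h1) (ler_wpM2l (normr_ge0 b) h2)) _.
rewrite -mulrDl mulrA ler_wpM2r ?sqr_ge0 // mulrCA -[leRHS]mulr1 ler_wpM2l ?(ltW e0) //.
by rewrite ler_pdivrMr // mul1r; lra.
Qed.

Lemma jet1_sum n (F : 'I_n -> R -> R) (d : 'I_n -> R) :
  (forall i, jet1 (F i) (d i)) -> jet1 (fun s => \sum_i F i s) (\sum_i d i).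
Proof.
move=> h; elim: (index_enum _) => [|i r IH].
  by rewrite big_nil; under eq_fun do rewrite big_nil; apply: jet1_cst.
rewrite big_cons; under eq_fun do rewrite big_cons.
by have := jet1_lin 1 1 (h i) IH; under eq_fun do rewrite !mul1r; rewrite !mul1r.
Qed.

Lemma jet1Z F c d : jet1 F d -> jet1 (fun s => c * F s) (c * d).
Proof.
move=> h; have := jet1_lin c 0 h (jet1_cst 0).
by under eq_fun do rewrite mul0r addr0; rewrite mul0r addr0.
Qed.

Lemma jet2Z F c d1 d2 : jet2 F d1 d2 -> jet2 (fun s => c * F s) (c * d1) (c * d2).
Proof.
move=> h; have := jet2_lin c 0 h (jet2_cst 0).
by under eq_fun do rewrite mul0r addr0; rewrite !mul0r !addr0.
Qed.

Lemma jet2D F G c1 c2 d1 d2 : jet2 F c1 c2 -> jet2 G d1 d2 ->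
  jet2 (fun s => F s + G s) (c1 + d1) (c2 + d2).
Proof.
move=> hF hG; have := jet2_lin 1 1 hF hG.
by under eq_fun do rewrite !mul1r; rewrite !mul1r.
Qed.

Lemma jet2B F G c1 c2 d1 d2 : jet2 F c1 c2 -> jet2 G d1 d2 ->
  jet2 (fun s => F s - G s) (c1 - d1) (c2 - d2).
Proof.
move=> hF hG; have := jet2_lin 1 (-1) hF hG.
by under eq_fun do rewrite mul1r mulN1r; rewrite !mul1r !mulN1r.
Qed.

Lemma jet2_jet1 F d1 d2 : jet2 F d1 d2 -> jet1 F d1.
Proof.
move=> hF e e0; have [dl dl0 h] := hF 1 ltr01.
have q0 : 0 < `|d2 / 2| + 1 by have := normr_ge0 (d2 / 2); lra.
exists (Num.min dl (e / (`|d2 / 2| + 1))); first by rewrite lt_min dl0 divr_gt0.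
move=> s; rewrite lt_min => /andP[/h {}h]; rewrite ltr_pdivlMr // => hs.
rewrite (_ : _ - _ = (F s - F 0 - d1 * s - d2 / 2 * s ^+ 2) + d2 / 2 * s ^+ 2); last by ring.
apply: le_trans (ler_normD _ _) _; rewrite normrM.
apply: le_trans (lerD h (lexx _)) _.
have s2 : s ^+ 2 = `|s| * `|s| by rewrite -expr2 real_normK ?num_real.
by rewrite (ger0_norm (sqr_ge0 s)) s2 -mulrDl mulrA ler_wpM2r //; lra.
Qed.

Lemma jet1_max F d dl : 0 < dl -> jet1 F d -> (forall s, `|s| < dl -> F s <= F 0) ->
  d = 0.
Proof.
move=> dl0 hF hm; apply/eqP; apply: contraT => d0.
have e0 : 0 < `|d| / 2 by rewrite divr_gt0 ?normr_gt0.
have [r r0 h] := hF _ e0.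
pose m := Num.min dl r / 2.
have m0 : 0 < m by rewrite divr_gt0 // lt_min dl0.
have [mdl mr] : m < dl /\ m < r.
  have : m < Num.min dl r by rewrite ltr_pdivrMr // ltr_pMr ?lt_min ?dl0 // ltr1n.
  by rewrite lt_min => /andP[].
pose s := Num.sg d * m.
have sn : `|s| = m by rewrite normrM normr_sg d0 mul1r gtr0_norm.
have h1 := h s; have h2 := hm s; rewrite sn in h1 h2.
have := h1 mr; have := h2 mdl; rewrite ler_norml => {}h2 /andP[{}h1 _].
have ds : d * s = `|d| * m by rewrite /s mulrCA mulrA -normrEsg.
rewrite ds in h1; have : 0 < `|d| * m by rewrite mulr_gt0 ?normr_gt0.
lra.
Qed.

(** Only the past is tested: a maximum in space-time may occur at the final time, where later values
    are out of reach. *)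
Lemma jet1_left F d dl : 0 < dl -> jet1 F d ->
  (forall s, - dl < s <= 0 -> F s <= F 0) -> 0 <= d.
Proof.
move=> dl0 hF hm; rewrite leNgt; apply/negP => d0.
have e0 : 0 < - d / 2 by lra.
have [r r0 h] := hF _ e0.
pose m := Num.min dl r / 2.
have m0 : 0 < m by rewrite divr_gt0 // lt_min dl0.
have [mdl mr] : m < dl /\ m < r.
  have : m < Num.min dl r by rewrite ltr_pdivrMr // ltr_pMr ?lt_min ?dl0 // ltr1n.
  by rewrite lt_min => /andP[].
have h1 := h (- m); rewrite normrN gtr0_norm // in h1.
have /hm h2 : - dl < - m <= 0 by apply/andP; lra.
have := h1 mr; rewrite ler_norml => /andP[{}h1 _].
have : 0 < - d * m by rewrite mulr_gt0 //; lra.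
lra.
Qed.

Lemma jet2_max F d1 d2 dl : 0 < dl -> jet2 F d1 d2 ->
  (forall s, `|s| < dl -> F s <= F 0) -> d1 = 0 /\ d2 <= 0.
Proof.
move=> dl0 hF hm; have d10 := jet1_max dl0 (jet2_jet1 hF) hm; split => //.
rewrite leNgt; apply/negP => d20.
have e0 : 0 < d2 / 4 by lra.
have [r r0 h] := hF _ e0.
pose m := Num.min dl r / 2.
have m0 : 0 < m by rewrite divr_gt0 // lt_min dl0.
have [mdl mr] : m < dl /\ m < r.
  have : m < Num.min dl r by rewrite ltr_pdivrMr // ltr_pMr ?lt_min ?dl0 // ltr1n.
  by rewrite lt_min => /andP[].
have h1 := h m; have h2 := hm m; rewrite gtr0_norm // in h1 h2.
have := h1 mr; have := h2 mdl; rewrite d10 mul0r ler_norml => {}h2 /andP[{}h1 _].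
have : 0 < d2 * m ^+ 2 by rewrite mulr_gt0 // exprn_gt0.
lra.
Qed.

Lemma jet2_ext F G d1 d2 : (forall s, F s = G s) -> jet2 F d1 d2 -> jet2 G d1 d2.
Proof. by move=> /funext ->. Qed.

Lemma jet2_near F G d1 d2 dl : 0 < dl -> (forall s, `|s| < dl -> F s = G s) ->
  jet2 F d1 d2 -> jet2 G d1 d2.
Proof.
move=> dl0 FG hF e e0; have [r r0 h] := hF e e0.
exists (Num.min dl r); first by rewrite lt_min dl0.
have FG0 : F 0 = G 0 by rewrite FG ?normr0.
by move=> s; rewrite lt_min -FG0 => /andP[/FG <- /h].
Qed.

Lemma jet2_quad c0 c1 c2 : jet2 (fun s => c0 + c1 * s + c2 * s ^+ 2) c1 (2 * c2).
Proof.
move=> e e0; exists 1 => // s _.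
have -> : c0 + c1 * s + c2 * s ^+ 2 - (c0 + c1 * 0 + c2 * 0 ^+ 2) - c1 * s -
  2 * c2 / 2 * s ^+ 2 = 0 by field.
by rewrite normr0 mulr_ge0 ?sqr_ge0 // ltW.
Qed.

End Jets.

Section Vec.
Context {R : realType} {N : nat}.
Implicit Types (x y v : 'rV[R]_N) (i j : 'I_N).

Lemma coord_le x i : `|x 0 i| <= `|x|.
Proof.
rewrite [leRHS](mx_normrE x).
exact: (@le_bigmax _ _ _ _ (fun ij : 'I_1 * 'I_N => `|x ij.1 ij.2|) (0, i)).
Qed.

Lemma norm_rV_le x (M : R) : 0 <= M -> (forall i, `|x 0 i| <= M) -> `|x| <= M.
Proof.
move=> M0 h; rewrite [leLHS](mx_normrE x); apply: bigmax_le => // -[k i] _ /=.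
by rewrite (ord1 k).
Qed.

Lemma norm_rV_lt x (M : R) : 0 < M -> (forall i, `|x 0 i| < M) -> `|x| < M.
Proof.
move=> M0 h; rewrite [ltLHS](mx_normrE x); apply/bigmax_ltP; split => // -[k i] _ /=.
by rewrite (ord1 k).
Qed.

Lemma ebaseE i j : @ebase R N i 0 j = (i == j)%:R.
Proof. by rewrite mxE eqxx eq_sym. Qed.

Lemma norm_ebase i (s : R) : `|s *: ebase i| = `|s|.
Proof.
apply/le_anti/andP; split.
  apply: norm_rV_le => // j; rewrite mxE ebaseE normrM.
  by case: eqP => _; rewrite ?normr1 ?mulr1 ?normr0 ?mulr0.
by have := coord_le (s *: ebase i) i; rewrite mxE ebaseE eqxx mulr1.
Qed.

Lemma sum_ebase v : \sum_i v 0 i *: ebase i = v.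
Proof. exact: esym (row_sum_delta v). Qed.

(* Estimates along coordinate segments of a cube add up. *)
Lemma coord_total_err (f : 'rV[R]_N -> R) (c : 'I_N -> R) x (dl : R) (E : R -> R) :
  (forall y i s, `|y - x| < dl -> `|y + s *: ebase i - x| < dl ->
    `|f (y + s *: ebase i) - f y - s * c i| <= E s) ->
  forall v, `|v| < dl ->
    `|f (x + v) - f x - \sum_i v 0 i * c i| <= \sum_i E (v 0 i).
Proof.
move=> h v vd.
have dl0 : 0 < dl by apply: le_lt_trans vd.
(* Partial sums of the coordinates of [v] have sup norm at most that of [v], so the path never
   leaves the cube. *)
pose w (s : seq 'I_N) : 'rV[R]_N := \sum_(i <- s) v 0 i *: ebase i.
have wE s j : uniq s -> w s 0 j = if j \in s then v 0 j else 0.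
  elim: s => [|i s IH] /=; first by rewrite /w big_nil mxE.
  rewrite /w big_cons -/(w s) => /andP[nis /IH {}IH].
  rewrite mxE IH mxE ebaseE inE [j == i]eq_sym; case: eqP => [<-|_] /=.
    by rewrite (negbTE nis) mulr1 addr0.
  by rewrite mulr0 add0r.
have wn s : uniq s -> `|w s| < dl.
  move=> us; apply: norm_rV_lt => // j; rewrite wE //; case: ifP => _.
    by apply: le_lt_trans vd; apply: coord_le.
  by rewrite normr0.
suff H s : uniq s -> `|f (x + w s) - f x - \sum_(i <- s) v 0 i * c i| <=
    \sum_(i <- s) E (v 0 i).
  have := H (index_enum 'I_N) (index_enum_uniq _).
  by rewrite /w sum_ebase.
elim: s => [|i s IH] /=.
  by rewrite /w !big_nil addr0 !subrr normr0.
move=> /[dup] uis /andP[nis us].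
have xE : x + w s + v 0 i *: ebase i = x + w (i :: s).
  by rewrite /w [in RHS]big_cons [in RHS]addrA [in RHS]addrAC.
have := h (x + w s) i (v 0 i); rewrite xE.
rewrite ![x + _]addrC !addrK => /(_ (wn _ us) (wn (i :: s) uis)) h1.
have h2 := IH us; rewrite [x + _]addrC in h2.
rewrite !big_cons.
apply: le_trans (lerD h1 h2); apply: le_trans (ler_normD _ _).
by rewrite le_eqVlt; apply/orP; left; apply/eqP; congr (`|_|); ring.
Qed.

Lemma coord_total (f : 'rV[R]_N -> R) (c : 'I_N -> R) x (dl e : R) :
  (forall y i s, `|y - x| < dl -> `|y + s *: ebase i - x| < dl ->
    `|f (y + s *: ebase i) - f y - s * c i| <= e * `|s|) ->
  forall v, `|v| < dl ->
    `|f (x + v) - f x - \sum_i v 0 i * c i| <= e * \sum_i `|v 0 i|.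
Proof. by move=> h v vd; rewrite mulr_sumr; exact: (@coord_total_err f c x dl (fun s => e * `|s|) h v vd). Qed.

Lemma sum_norm_le v : \sum_i `|v 0 i| <= N%:R * `|v|.
Proof.
apply: le_trans (ler_sum _ (fun i _ => coord_le v i)) _.
by rewrite sumr_const card_ord mulr_natl.
Qed.

Lemma line_derive (f : 'rV[R]_N -> R) x v s c :
  is_derive (x + s *: v) v f c -> is_derive s 1 (fun s => f (x + s *: v)) c.
Proof.
move/is_derive_jet1 => h; apply/is_derive_jet1 => e e0.
have [d d0 hd] := h e e0; exists d => // r /hd.
have r1 : r *: 1 = r :> R by rewrite /GRing.scale /= mulr1.
by rewrite r1 [(s + r) *: v]scalerDl addrA !scale0r !addr0.
Qed.

End Vec.

Section Taylor.
Context {R : realType}.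

(** The two conditions on [s] say that it lies between 0 and [t], for either sign of [t]. *)
Lemma mvt_bound (F F' : R -> R) (t K : R) :
  (forall s, 0 <= s * t -> `|s| <= `|t| -> is_derive s 1 F (F' s)) ->
  (forall s, 0 <= s * t -> `|s| <= `|t| -> `|F' s| <= K) -> `|F t - F 0| <= K * `|t|.
Proof.
move=> hd hK.
have cont (a b : R) : (forall z, a <= z <= b -> 0 <= z * t /\ `|z| <= `|t|) ->
    {within `[a, b], continuous F}.
  move=> hz; apply: derivable_within_continuous => z; rewrite in_itv /=.
  by move=> /hz[z0 /(hd _ z0)] [].
have [t0|t0|t0] := ltrgt0P t; last by rewrite t0 subrr normr0 mulr0.
- have H z : 0 <= z <= t -> 0 <= z * t /\ `|z| <= `|t|.
    move=> /andP[z0 zt]; split; first by rewrite mulr_ge0 // ltW.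
    by rewrite !ger0_norm // (le_trans z0 zt).
  have [||c + ->] := @MVT _ F F' 0 t t0.
  + move=> z; rewrite in_itv /= => /andP[z0 zt].
    by have [|? ?] := H z; [rewrite !ltW | apply: hd].
  + exact: cont.
  rewrite in_itv /= => /andP[z0 zt].
  rewrite subr0 normrM (gtr0_norm t0) ler_wpM2r ?(ltW t0) //.
  by have [|? ?] := H c; [rewrite !ltW | apply: hK].
- have H z : t <= z <= 0 -> 0 <= z * t /\ `|z| <= `|t|.
    move=> /andP[z0 zt]; split; first by rewrite mulr_le0 // ltW.
    by rewrite !ler0_norm ?lerN2 // (le_trans z0 zt).
  have [||c + hc] := @MVT _ F F' t 0 t0.
  + move=> z; rewrite in_itv /= => /andP[z0 zt].
    by have [|? ?] := H z; [rewrite !ltW | apply: hd].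
  + exact: cont.
  rewrite in_itv /= => /andP[z0 zt].
  rewrite distrC hc sub0r normrM (normrN t) (ltr0_norm t0) ler_wpM2r ?oppr_ge0 ?(ltW t0) //.
  by have [|? ?] := H c; [rewrite !ltW | apply: hK].
Qed.

Lemma segment_norm (V : normedModType R) (y v x : V) (s t D : R) :
  0 <= s * t -> `|s| <= `|t| -> `|y - x| < D -> `|y + t *: v - x| < D ->
  `|y + s *: v - x| < D.
Proof.
move=> st0 st yD ytD; have [t0|t0] := eqVneq t 0.
  by move: st; rewrite t0 normr0 normr_le0 => /eqP ->; rewrite scale0r addr0.
pose q := s / t.
have q0 : 0 <= q.
  by rewrite /q (_ : s / t = s * t / t ^+ 2) ?divr_ge0 ?sqr_ge0 //; field.
have q1 : q <= 1 by rewrite -(ger0_norm q0) normrM normfV ler_pdivrMr ?normr_gt0 // mul1r.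
have sq : s = q * t by rewrite /q divfK.
clearbody q; have -> : y + s *: v - x = (1 - q) *: (y - x) + q *: (y + t *: v - x).
  rewrite [_ + t *: v - x]addrAC [q *: (_ + _)]scalerDr addrA -scalerDl subrK scale1r.
  by rewrite scalerA sq // addrAC.
apply: le_lt_trans (ler_normD _ _) _; rewrite !normrZ.
rewrite (ger0_norm q0) ger0_norm ?subr_ge0 //.
have [->|q0'] := eqVneq q 0; first by rewrite mul0r addr0 subr0 mul1r.
have qp : 0 < q by rewrite lt_neqAle eq_sym q0'.
have -> : D = (1 - q) * D + q * D by rewrite -mulrDl subrK mul1r.
by apply: ler_ltD; [rewrite ler_wpM2l ?subr_ge0 // ltW | rewrite ltr_pM2l].
Qed.

Lemma is_derive_quad (c1 c2 s : R) :
  is_derive s 1 (fun z => c1 * z + c2 * z ^+ 2) (c1 + 2 * c2 * s).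
Proof.
apply/is_derive_jet1/(@jet2_jet1 _ _ _ (2 * c2)).
apply: jet2_ext (jet2_quad (c1 * s + c2 * s ^+ 2) (c1 + 2 * c2 * s) c2) => r.
by rewrite /GRing.scale /=; ring.
Qed.

(** Mean value bound for [F] minus its quadratic polynomial, whose derivative is [o(s)] by the
    expansion of [F'] at 0. *)
Lemma taylor2 (F F' : R -> R) (r d2 : R) : 0 < r ->
  (forall s : R, `|s| < r -> is_derive s 1 F (F' s)) -> jet1 F' d2 -> jet2 F (F' 0) d2.
Proof.
move=> r0 hF hF' e e0; have [d d0 hd] := hF' e e0.
exists (Num.min d r); first by rewrite lt_min d0.
move=> t; rewrite lt_min => /andP[td tr].
pose G := F - (fun z => F' 0 * z + d2 / 2 * z ^+ 2).
pose G' z := F' z - F' 0 - d2 * z.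
have := @mvt_bound G G' t (e * `|t|).
have -> : e * `|t| * `|t| = e * t ^+ 2 by rewrite -mulrA -expr2 real_normK ?num_real.
have -> : G t - G 0 = F t - F 0 - F' 0 * t - d2 / 2 * t ^+ 2.
  by rewrite /G !fctE; ring.
apply.
- move=> s _ st; have hs := hF s (le_lt_trans st tr).
  have -> : G' s = F' s - (F' 0 + 2 * (d2 / 2) * s) by rewrite /G'; field.
  by apply: is_deriveB; apply: is_derive_quad.
- move=> s _ st; apply: le_trans (hd s (le_lt_trans st td)) _.
  by rewrite ler_wpM2l // ltW.
Qed.

Context {N : nat}.
Implicit Types (x y v : 'rV[R]_N) (i j : 'I_N).

(** The increment along [v] is split into coordinate steps; on each of them the mean value bound
    compares [g i] with its value at [x], and continuity at [x] makes the error [o(s)]. *)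
Lemma C1_dir (f : 'rV[R]_N -> R) (g : 'I_N -> 'rV[R]_N -> R) x (dl : R) v : 0 < dl ->
  (forall y i, `|y - x| < dl -> is_derive y (ebase i) f (g i y)) ->
  (forall i, {for x, continuous (g i)}) ->
  is_derive x v f (\sum_i v 0 i * g i x).
Proof.
move=> dl0 hf hg; apply/is_derive_jet1 => e e0.
pose S := \sum_i `|v 0 i| + 1.
have S0 : 0 < S by rewrite ltr_wpDl // sumr_ge0.
have e1 : 0 < e / S by rewrite divr_gt0.
have [d d0 hd] : exists2 d, 0 < d & forall y i, `|y - x| < d -> `|g i y - g i x| <= e / S.
  have : \forall y \near x, forall i, `|g i y - g i x| <= e / S.
    apply: (@filter_forall 'rV[R]_N 'I_N (fun i y => `|g i y - g i x| <= e / S) (nbhs x) _) => i.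
    have := hg i; move/cvgrPdist_le => /(_ _ e1).
    by apply: filterS => y; rewrite distrC.
  move=> /nbhs_ballP[d d0 h]; exists d => // y i yx; apply: h.
  by rewrite -ball_normE /= distrC.
pose D := Num.min d dl; have D0 : 0 < D by rewrite lt_min d0.
exists (D / (`|v| + 1)); first by rewrite divr_gt0 // ltr_wpDl.
move=> s; rewrite ltr_pdivlMr ?ltr_wpDl // => hs.
have svD : `|s *: v| < D.
  by rewrite normrZ; apply: le_lt_trans hs; rewrite ler_wpM2l // ler_wpDr.
have H y i t : `|y - x| < D -> `|y + t *: ebase i - x| < D ->
    `|f (y + t *: ebase i) - f y - t * g i x| <= e / S * `|t|.
  move=> yx ytx.
  pose F r := f (y + r *: ebase i) - r * g i x.
  have -> : f (y + t *: ebase i) - f y - t * g i x = F t - F 0.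
    by rewrite /F mul0r subr0 scale0r addr0 addrAC.
  apply: (@mvt_bound F (fun r => g i (y + r *: ebase i) - g i x)).
    move=> r rt0 rt; have rD := segment_norm rt0 rt yx ytx.
    apply: is_deriveB; last first.
      have := is_derive_quad (g i x) 0 r; rewrite mulr0 mul0r addr0.
      by under eq_fun do rewrite mul0r addr0 mulrC.
    apply: line_derive; apply: hf; apply: lt_le_trans rD _.
    by rewrite ge_min lexx orbT.
  move=> r rt0 rt; apply: hd; apply: lt_le_trans (segment_norm rt0 rt yx ytx) _.
  by rewrite ge_min lexx.
have {H} := coord_total H svD.
rewrite (eq_bigr (fun i => s * (v 0 i * g i x))); last first.
  by move=> i _; rewrite mxE mulrA.
rewrite -mulr_sumr scale0r addr0 mulrC => H; rewrite [_ * s]mulrC.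
have {}H : `|f (x + s *: v) - f x - s * \sum_i v 0 i * g i x| <=
  e / S * (`|s| * \sum_i `|v 0 i|).
  rewrite mulrC in H; apply: le_trans H _; rewrite le_eqVlt; apply/orP; left; apply/eqP.
  by congr *%R; rewrite mulr_sumr; apply: eq_bigr => i _; rewrite mxE normrM.
apply: le_trans H _.
rewrite mulrCA [leRHS]mulrC ler_wpM2l // mulrAC ler_pdivrMr //.
by rewrite ler_wpM2l ?(ltW e0) // lerDl.
Qed.

Lemma C2_jet2 (f : 'rV[R]_N -> R) (g : 'I_N -> 'rV[R]_N -> R)
    (h : 'I_N -> 'I_N -> 'rV[R]_N -> R) x (dl : R) v : 0 < dl ->
  (forall y i, `|y - x| < dl -> is_derive y (ebase i) f (g i y)) ->
  (forall y i, `|y - x| < dl -> {for y, continuous (g i)}) ->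
  (forall y i j, `|y - x| < dl -> is_derive y (ebase j) (g i) (h i j y)) ->
  (forall i j, {for x, continuous (h i j)}) ->
  jet2 (fun s => f (x + s *: v)) (\sum_i v 0 i * g i x)
     (\sum_i \sum_j v 0 i * v 0 j * h i j x).
Proof.
move=> dl0 hf cg hg ch.
pose F' s := \sum_i v 0 i * g i (x + s *: v).
have -> : \sum_i v 0 i * g i x = F' 0 by rewrite /F' scale0r addr0.
apply: (@taylor2 _ _ (dl / (`|v| + 1))).
- by rewrite divr_gt0 // ltr_wpDl.
- move=> s; rewrite ltr_pdivlMr ?ltr_wpDl // => hs.
  have sv : `|x + s *: v - x| < dl.
    rewrite addrAC subrr add0r normrZ; apply: le_lt_trans hs.
    by rewrite ler_wpM2l // ler_wpDr.
  have p1 : 0 < dl - `|x + s *: v - x| by rewrite subr_gt0.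
  have p2 y i : `|y - (x + s *: v)| < dl - `|x + s *: v - x| ->
      is_derive y (ebase i) f (g i y).
    move=> yd; apply: hf; rewrite -(subrK (x + s *: v) y) -addrA.
    by apply: le_lt_trans (ler_normD _ _) _; rewrite -ltrBrDr.
  have p3 i : {for (x + s *: v), continuous (g i)} by apply: cg.
  exact: line_derive (C1_dir v p1 p2 p3).
- have hP i : is_derive x v (g i) (\sum_j v 0 j * h i j x).
    exact: C1_dir v dl0 (fun y j => hg y i j) (ch i).
  have -> : \sum_i \sum_j v 0 i * v 0 j * h i j x =
      \sum_i v 0 i * (\sum_j v 0 j * h i j x).
    by apply: eq_bigr => i _; rewrite mulr_sumr; apply: eq_bigr => j _; rewrite mulrA.
  by apply: jet1_sum => i; apply: jet1Z; apply/is_derive_jet1.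
Qed.

End Taylor.

(** * Comparison for the viscous Hamilton-Jacobi equation *)

Section Sequences.
Context {R : realType} {N : nat}.
Implicit Types (x y v : 'rV[R]_N) (D Omega : set 'rV[R]_N).

Lemma closure_Uf D (xn : nat -> 'rV[R]_N) x :
  xn @ Uf --> x -> (\forall n \near Uf, D (xn n)) -> closure D x.
Proof.
move=> xnx h B Bx; have [n [Dn Bn]] := Uf_ex (filterI h (xnx _ Bx)).
by exists (xn n).
Qed.

Lemma bdry_open D : open D -> bdry D = closure D `\` D.
Proof. by rewrite /bdry => /interior_id ->. Qed.

Lemma bounded_setP D : bounded_set D -> exists M : R, forall x, D x -> `|x| <= M.
Proof.
by move=> [M [_ hM]]; exists (M + 1) => x Dx; apply: (hM (M + 1)) => //; rewrite ltrDl.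
Qed.

Lemma closure_bounded D (M : R) :
  (forall x, D x -> `|x| <= M) -> forall x, closure D x -> `|x| <= M.
Proof.
move=> h x Dx; have : closed [set y : 'rV[R]_N | `|y| <= M].
  exact: (@closed_comp _ _ (fun z : 'rV[R]_N => `|z|) [set y | y <= M])
      (in1W (@norm_continuous _ _)) (@closed_le _ M).
rewrite closure_id => E; have : closure [set y : 'rV[R]_N | `|y| <= M] x.
  by apply: (closure_subset _ Dx) => y /h.
by rewrite -E.
Qed.

Lemma open_cvg_near D (xn : nat -> 'rV[R]_N) x :
  open D -> D x -> xn @ Uf --> x -> \forall n \near Uf, D (xn n).
Proof. by move=> oD Dx; apply; apply: open_nbhs_nbhs. Qed.

Lemma open_ball D x : open D -> D x ->
  exists2 r : R, 0 < r & forall y, `|y - x| < r -> D y.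
Proof.
move=> oD Dx; have /nbhs_ballP[r /= r0 h] := open_nbhs_nbhs (conj oD Dx).
by exists r => // y yx; apply: h; rewrite -ball_normE /= distrC.
Qed.

Lemma line_in D x v : open D -> D x ->
  exists2 r : R, 0 < r & forall s, `|s| < r -> D (x + s *: v).
Proof.
move=> oD Dx; have [r r0 h] := open_ball oD Dx.
exists (r / (`|v| + 1)); first by rewrite divr_gt0 // ltr_wpDl.
move=> s; rewrite ltr_pdivlMr ?ltr_wpDl // => hs; apply: h.
rewrite addrAC subrr add0r normrZ; apply: le_lt_trans hs.
by rewrite ler_wpM2l // ler_wpDr.
Qed.

(* Extreme value theorem, with upper semicontinuity and compactness both
   expressed along the ultrafilter. *)
Lemma usc_max (T : Type) (A : T -> Prop) (f : T -> R) : (exists z, A z) ->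
  (forall z : nat -> T, (forall n, A (z n)) ->
     exists2 z0, A z0 & forall e, 0 < e -> \forall n \near Uf, f (z n) <= f z0 + e) ->
  exists2 z0, A z0 & forall z, A z -> f z <= f z0.
Proof.
move=> [a0 Aa0] h; pose S := [set f z | z in A].
have S0 : S !=set0 by exists (f a0), a0.
have ubS : has_ubound S.
  apply: contrapT => nub.
  have /choice[z hz] : forall n : nat, exists z, A z /\ n%:R < f z.
    move=> n.
    apply: contrapT => hn; apply: nub; exists n%:R => _ [z Az <-].
    by rewrite leNgt; apply/negP => nz; apply: hn; exists z.
  have [z0 Az0 /(_ 1 ltr01) hz0] := h z (fun n => (hz n).1).
  have [n [h1 h2]] := Uf_ex (filterI hz0 (@Uf_ge (fun n => (Num.truncn (f z0 + 1)).+1 <= n)%N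
    (Num.truncn (f z0 + 1)).+1 (fun n hn => hn))).
  have := (hz n).2; rewrite ltNge => /negP; apply.
  apply: le_trans h1 _; have := truncnS_gt (f z0 + 1) => /ltW /le_trans; apply.
  by rewrite ler_nat.
have /choice[z hz] : forall n : nat, exists z, A z /\ sup S - n.+1%:R^-1 < f z.
  move=> n.
  have n0 : 0 < n.+1%:R^-1 :> R by rewrite invr_gt0.
  have [_ [z Az <-] h1] := sup_adherent n0 (conj S0 ubS).
  by exists z.
have [z0 Az0 hz0] := h z (fun n => (hz n).1).
exists z0 => // z1 Az1; have : f z1 <= sup S by apply: ub_le_sup => //; exists z1.
move=> /le_trans; apply; apply/ler_addgt0Pr => e e0.
have e20 : 0 < e / 2 by rewrite divr_gt0.
have /cvgrPdist_lt/(_ _ e20) inv0 := @Uf_inv R.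
have [n [h1 h2]] := Uf_ex (filterI (hz0 _ e20) inv0).
rewrite sub0r normrN ger0_norm ?invr_ge0 // in h2.
by move: (hz n).2 h1 h2; set q := _^-1; lra.
Qed.

End Sequences.

Section Solutions.
Context {R : realType} {N : nat}.
Implicit Types (x y v : 'rV[R]_N) (D Omega : set 'rV[R]_N) (u w : R -> 'rV[R]_N -> R).

(** Continuity is stated along [Uf] and for sequences staying in the cylinder: this is the form in
    which compactness arguments consume it. *)
Definition cyl_cont T D u := forall t x (tn : nat -> R) (xn : nat -> 'rV[R]_N),
  0 <= t <= T -> D x -> (forall n, 0 <= tn n <= T) -> (forall n, D (xn n)) ->
  tn @ Uf --> t -> xn @ Uf --> x -> (fun n => u (tn n) (xn n)) @ Uf --> u t x.

Definition pjet u t x (d : R) (G H : 'I_N -> R) :=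
  jet1 (fun s => u (t + s) x) d /\
  forall i, jet2 (fun s => u t (x + s *: ebase i)) (G i) (H i).

Definition enorm (G : 'I_N -> R) := Num.sqrt (\sum_i G i ^+ 2).

(** The only view of a solution used by the maximum principle. Second-order expansions are kept
    along every direction because the doubling argument reflects coordinate vectors; the boundary
    condition includes [t = 0]. *)
Record sol Omega (a p : R) u : Prop := Sol {
  sol_cont : forall T, cyl_cont T (closure Omega) u;
  sol_bd : forall t x, 0 <= t -> bdry Omega x -> u t x = 0;
  sol_jet : forall t x, 0 < t -> Omega x -> exists d G H,
    [/\ jet1 (fun s => u (t + s) x) d,
        forall v, jet2 (fun s => u t (x + s *: v)) (\sum_i v 0 i * G i)
                     (\sum_i \sum_j v 0 i * v 0 j * H i j)
      & d - \sum_i H i i = a * enorm G `^ p] }.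

Lemma sum_ebase_l i (G : 'I_N -> R) : \sum_j (@ebase R N i) 0 j * G j = G i.
Proof.
rewrite (bigD1 i) //= ebaseE eqxx mul1r big1 ?addr0 // => j ji.
by rewrite ebaseE eq_sym (negbTE ji) mul0r.
Qed.

Lemma sol_pjet Omega a p u t x : sol Omega a p u -> 0 < t -> Omega x ->
  exists d G H, pjet u t x d G H /\ d - \sum_i H i = a * enorm G `^ p.
Proof.
move=> su t0 Ox; have [d [G [H [h1 h2 h3]]]] := sol_jet su t0 Ox.
exists d, G, (fun i => H i i); split=> //; split=> // i.
have := h2 (ebase i); rewrite sum_ebase_l.
under eq_bigr => j _ do (under eq_bigr do rewrite -mulrA; rewrite -mulr_sumr).
by rewrite sum_ebase_l sum_ebase_l.
Qed.

(** Changing the sign of both [u] and [a] turns every upper bound into a two-sided one. *)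
Lemma sol_opp Omega a p u : sol Omega a p u -> sol Omega (- a) p (fun t x => - u t x).
Proof.
move=> [h1 h2 h3]; split.
- by move=> T t x tn xn *; apply: cvgN; apply: (h1 T).
- by move=> t x t0 bx; rewrite h2 // oppr0.
- move=> t x t0 Ox; have [d [G [H [j1 j2 j3]]]] := h3 t x t0 Ox.
  exists (- d), (fun i => - G i), (fun i j => - H i j); split.
  + by have := jet1Z (-1) j1; under eq_fun do rewrite mulN1r; rewrite mulN1r.
  + move=> v; have := jet2Z (-1) (j2 v); under eq_fun do rewrite mulN1r.
    rewrite !mulN1r -!sumrN; under eq_bigr do rewrite -mulrN.
    under [X in jet2 _ _ X]eq_bigr do rewrite -sumrN.
    by under [X in jet2 _ _ X]eq_bigr do under eq_bigr do rewrite -mulrN.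
  + rewrite sumrN -opprD j3 mulNr; congr (- (_ * _ `^ _)).
    by congr Num.sqrt; apply: eq_bigr => i _; rewrite sqrrN.
Qed.

Lemma sol_shift Omega a p u s : 0 <= s -> sol Omega a p u ->
  sol Omega a p (fun t x => u (s + t) x).
Proof.
move=> s0 [h1 h2 h3]; split.
- move=> T t x tn xn /andP[t0 tT] cx tnT cxn ht hx.
  apply: (h1 (s + T)) => //.
  + by rewrite addr_ge0 //= lerD2l.
  + by move=> n; have /andP[? ?] := tnT n; rewrite addr_ge0 //= lerD2l.
  + by apply: cvgD ht; apply: cvg_cst.
- by move=> t x t0; apply: h2; rewrite addr_ge0.
- move=> t x t0 Ox; have [|d [G [H [j1 j2 j3]]]] := h3 (s + t) x _ Ox.
    by rewrite ltr_wpDl.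
  by exists d, G, H; split=> //; under eq_fun do rewrite addrA.
Qed.

(** At a touching point the first derivatives agree, so the nonlinear term of [u] is computed from
    [gU], while the second derivatives and the time derivative are ordered. *)
Lemma touch_from_above Omega a p u w t x dU (gU hU : 'I_N -> R) : open Omega ->
  sol Omega a p u -> 0 < t -> Omega x -> pjet w t x dU gU hU ->
  (forall s, - t < s <= 0 -> u (t + s) x - w (t + s) x <= u t x - w t x) ->
  (exists2 r : R, 0 < r & forall y, `|y - x| < r -> u t y - w t y <= u t x - w t x) ->
  (forall i, jet1 (fun s => u t (x + s *: ebase i)) (gU i)) /\
  dU - \sum_i hU i <= a * enorm gU `^ p.
Proof.
move=> oO su t0 Ox [w1 w2] mt [r r0 mx].
have [d [G [H [[u1 u2] ueq]]]] := sol_pjet su t0 Ox.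
have hd : 0 <= d - dU.
  have h : jet1 (fun s => u (t + s) x - w (t + s) x) (d - dU).
    have := jet1_lin 1 (-1) u1 w1; rewrite mul1r mulN1r.
    by under eq_fun do rewrite mul1r mulN1r.
  by apply: (jet1_left t0 h) => s /mt; rewrite addr0.
have hx i : G i = gU i /\ H i - hU i <= 0.
  have h := jet2B (u2 i) (w2 i).
  have [|h1 h2] := jet2_max r0 h.
    move=> s sr /=; rewrite scale0r addr0; apply: mx.
    by rewrite addrAC subrr add0r norm_ebase.
  by split=> //; apply/eqP; rewrite -subr_eq0 h1.
have GE : G = gU by apply/funext => i; have [] := hx i.
split; first by move=> i; rewrite -GE; apply: jet2_jet1 (u2 i).
rewrite -GE -ueq; have : \sum_i H i <= \sum_i hU i.
  by apply: ler_sum => i _; have [_] := hx i; rewrite subr_le0.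
lra.
Qed.

(** Upper limit at most 0 on the lateral boundary. This weak form tolerates a comparison function
    without boundary values, such as one built from [psi]. *)
Definition bdry_usc T D (f : R -> 'rV[R]_N -> R) :=
  forall t x (tn : nat -> R) (xn : nat -> 'rV[R]_N),
  0 <= t <= T -> closure D x -> ~ D x ->
  (forall n, 0 <= tn n <= T) -> (forall n, D (xn n)) ->
  tn @ Uf --> t -> xn @ Uf --> x ->
  forall e, 0 < e -> \forall n \near Uf, f (tn n) (xn n) <= e.

Lemma parab_max T D (f : R -> 'rV[R]_N -> R) : bounded_set D ->
  cyl_cont T D f -> bdry_usc T D f ->
  (exists t x, [/\ 0 <= t <= T, D x & 0 < f t x]) ->
  exists t x, [/\ 0 <= t <= T, D x, 0 < f t x &
    forall s y, 0 <= s <= T -> D y -> f s y <= f t x].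
Proof.
move=> /bounded_setP[M hM] cf bf [t1 [x1 [t1T Dx1 f1]]].
have [|z zn|[t x] [/= tT Dx f0] mx] := @usc_max R (R * 'rV[R]_N)
    (* The maximum is sought among points where [f] is at least the given positive value; [bdry_usc]
       keeps limits of such points off the boundary. *)
    (fun z => [/\ 0 <= z.1 <= T, D z.2 & f t1 x1 <= f z.1 z.2]) (fun z => f z.1 z.2).
- by exists (t1, x1).
- have [t ht] : exists l : R, (fun n => (z n).1) @ Uf --> l.
    apply: (@Uf_bounded _ _ T); apply: nearW => n; have [/andP[t0 tT] _ _] := zn n.
    by rewrite ger0_norm.
  have [x hx] : exists l : 'rV[R]_N, (fun n => (z n).2) @ Uf --> l.
    by apply: (@Uf_bounded_rV _ _ _ M); apply: nearW => n; have [_ /hM] := zn n.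
  have znT n : 0 <= (z n).1 <= T by have [] := zn n.
  have znD n : D (z n).2 by have [] := zn n.
  have tT : 0 <= t <= T.
    apply/andP; split.
      by apply: cvgr_to_ge ht _; apply: nearW => n; have /andP[] := znT n.
    by apply: cvgr_to_le ht _; apply: nearW => n; have /andP[] := znT n.
  have cx : closure D x by apply: closure_Uf hx _; apply: nearW.
  have Dx : D x.
    apply: contrapT => nDx; have e0 : 0 < f t1 x1 / 2 by lra.
    have [n hn] := Uf_ex (bf t x _ _ tT cx nDx znT znD ht hx _ e0).
    by have [_ _] := zn n; lra.
  have cfz := cf t x _ _ tT Dx znT znD ht hx.
  exists (t, x) => /=.
    split=> //; apply: cvgr_to_ge cfz _; apply: nearW => n; by have [] := zn n.
  move=> e e0; move/cvgrPdist_lt: cfz => /(_ e e0); apply: filterS => n.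
  rewrite ltr_norml => /andP[]; lra.
- exists t, x; split=> //; first exact: lt_le_trans f1 f0.
  move=> s y sT Dy; have [h|h] := leP (f t1 x1) (f s y).
    exact: (mx (s, y)).
  exact: le_trans (ltW h) f0.
Qed.

Lemma cyl_contB T D u w : cyl_cont T D u -> cyl_cont T D w ->
  cyl_cont T D (fun t x => u t x - w t x).
Proof. by move=> h1 h2 t x tn xn *; apply: cvgB; [apply: h1 | apply: h2]. Qed.

Lemma cyl_cont_sub T D D' u : D `<=` D' -> cyl_cont T D' u -> cyl_cont T D u.
Proof.
move=> DD h t x tn xn h1 h2 h3 h4; apply: h => //; first exact: DD.
by move=> n; apply: DD.
Qed.

(** Strictness settles the matter at the first touching point. The strict inequality may be proved
    knowing that [gU] is the gradient of [u]: this is the entry point for gradient bounds already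
    obtained for [u]. *)
Lemma comparison Omega D a p u w T : open Omega -> open D -> D `<=` Omega ->
  bounded_set D -> sol Omega a p u -> cyl_cont T D w ->
  bdry_usc T D (fun t x => u t x - w t x) ->
  (forall x, D x -> u 0 x <= w 0 x) ->
  (forall t x, 0 < t <= T -> D x -> exists dU gU hU, pjet w t x dU gU hU /\
    ((forall i, jet1 (fun s => u t (x + s *: ebase i)) (gU i)) ->
       a * enorm gU `^ p < dU - \sum_i hU i)) ->
  forall t x, 0 <= t <= T -> D x -> u t x <= w t x.
Proof.
move=> oO oD DO bD su cw bw h0 hs t1 x1 tT1 Dx1; rewrite leNgt; apply/negP => neg.
have cu : cyl_cont T D u.
  apply: (@cyl_cont_sub T D (closure Omega)); last exact: (sol_cont su).
  by move=> x /DO; apply: subset_closure.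
have [|t [x [tT Dx f0 mx]]] := parab_max bD (cyl_contB cu cw) bw.
- by exists t1, x1; split=> //; rewrite subr_gt0.
have /andP[t0' tT'] := tT.
have t0 : 0 < t.
  rewrite lt_neqAle t0' andbT; apply/eqP => t0; move: f0; rewrite -t0.
  by have := h0 x Dx; lra.
have [dU [gU [hU [jw str]]]] := hs t x (introT andP (conj t0 tT')) Dx.
have [||g1 g2] := touch_from_above oO su t0 (DO _ Dx) jw.
- by move=> s /andP[s1 s2]; apply: mx => //; apply/andP; split; lra.
- have [r r0 hr] := open_ball oD Dx; exists r => // y /hr Dy; exact: mx.
by have := str g1; lra.
Qed.

End Solutions.

(** * Functions with cubic Taylor bounds *)

Section PowerFacts.
Context {R : realType}.

Lemma small_power (q c eta b : R) : 0 < q -> 0 < eta -> 0 < b ->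
  exists2 e : R, 0 < e <= b & forall z, 0 <= z <= e -> c * z `^ q <= eta.
Proof.
move=> q0 eta0 b0; pose z0 := (eta / (`|c| + 1)) `^ q^-1.
have c1 : 0 < `|c| + 1 by rewrite ltr_wpDl.
have z00 : 0 < z0 by rewrite powR_gt0 // divr_gt0.
exists (Num.min b z0); first by rewrite lt_min b0 z00 ge_min lexx.
move=> z /andP[z0' zz]; apply: le_trans (ler_wpM2r (powR_ge0 _ _) (ler_norm c)) _.
have h : z `^ q <= z0 `^ q.
  rewrite ge0_ler_powR ?nnegrE ?(ltW q0) ?(ltW z00) //.
  by apply: le_trans zz _; rewrite ge_min lexx orbT.
apply: le_trans (ler_wpM2l (normr_ge0 c) h) _.
rewrite /z0 -powRrM mulVf ?gt_eqF // powRr1 ?divr_ge0 ?(ltW eta0) ?(ltW c1) //.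
by rewrite mulrCA -[leRHS]mulr1 ler_wpM2l ?(ltW eta0) // ler_pdivrMr // mul1r lerDl.
Qed.

Lemma jet1_exp (c t : R) : jet1 (fun s => expR (c * (t + s))) (c * expR (c * t)).
Proof.
have h : is_derive t 1 (fun z => expR (c * z)) (c * expR (c * t)).
  have h : is_derive t 1 (fun z => c * z) c.
    have := is_derive_quad c 0 t; rewrite mulr0 mul0r addr0.
    by under eq_fun do rewrite mul0r addr0.
  by rewrite mulrC; apply: (is_derive1_comp (is_derive_expR (c * t)) h).
move/is_derive_jet1: h; under eq_fun do rewrite /GRing.scale /= mulr1.
by [].
Qed.

End PowerFacts.

Section SmoothFunctions.
Context {R : realType} {N : nat}.
Implicit Types (x y v : 'rV[R]_N) (D Omega : set 'rV[R]_N).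

(* Surrogate for C^3: [g] and [H] are the first and the pure second partial
   derivatives. *)
Definition C3T (f : 'rV[R]_N -> R) (g H : 'I_N -> 'rV[R]_N -> R) : Prop :=
  [/\ continuous f, forall i, continuous (g i), forall i, continuous (H i) &
   forall M : R, exists2 C : R, 0 <= C & forall x i s, `|x| <= M -> `|s| <= 1 ->
     `|f (x + s *: ebase i) - f x - g i x * s - H i x / 2 * s ^+ 2| <= C * `|s| ^+ 3].

Lemma cont_bounded (f : 'rV[R]_N -> R) (M : R) : continuous f ->
  exists2 C : R, 0 < C & forall x, `|x| <= M -> `|f x| <= C.
Proof.
move=> cf; apply: contrapT => h.
have /choice[z hz] : forall n : nat, exists z, `|z| <= M /\ n.+1%:R < `|f z|.
  move=> n; apply: contrapT => hn; apply: h; exists n.+1%:R => // z zM.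
  by rewrite leNgt; apply/negP => nz; apply: hn; exists z.
have [x hx] : exists l : 'rV[R]_N, z @ Uf --> l.
  by apply: (@Uf_bounded_rV _ _ _ M); apply: nearW => n; have [] := hz n.
have /cvgrPdist_lt/(_ 1 ltr01) h1 : (fun n => f (z n)) @ Uf --> f x.
  exact: (cvg_comp _ _ hx (cf x)).
have [n [h2 h3]] := Uf_ex (filterI h1 (@Uf_ge (fun n => (Num.truncn (`|f x| + 1)).+1 <= n)%N
    (Num.truncn (`|f x| + 1)).+1 (fun n hn => hn))).
have [_ h4] := hz n.
have h5 := truncnS_gt (`|f x| + 1).
have h6 : (Num.truncn (`|f x| + 1)).+1%:R <= n.+1%:R :> R by rewrite ler_nat leqW.
have h7 := ler_normB (f x) (f x - f (z n)); rewrite subKr in h7.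
lra.
Qed.

Lemma C3T_jet2 f g H x i : C3T f g H ->
  jet2 (fun s => f (x + s *: ebase i)) (g i x) (H i x).
Proof.
move=> [_ _ _ /(_ `|x|)[C C0 hC]] e e0; exists (Num.min 1 (e / (C + 1))).
  by rewrite lt_min ltr01 divr_gt0 // ltr_wpDl.
move=> s; rewrite lt_min ltr_pdivlMr ?ltr_wpDl // => /andP[s1 se].
rewrite scale0r addr0; apply: le_trans (hC x i s _ (ltW s1)) _ => //.
have -> : `|s| ^+ 3 = `|s| * s ^+ 2.
  by rewrite -[s ^+ 2]real_normK ?num_real // -exprS.
rewrite mulrA ler_wpM2r ?sqr_ge0 //; have := normr_ge0 s; lra.
Qed.

Lemma C3T_derive f g H x i : C3T f g H -> is_derive x (ebase i) f (g i x).
Proof. by move=> h; apply/is_derive_jet1; apply: jet2_jet1 (C3T_jet2 x i h). Qed.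

Lemma C3T_lip f g H (M : R) : C3T f g H -> exists2 L : R, 0 < L &
  forall x y, `|x| <= M -> `|y| <= M -> `|f x - f y| <= L * `|x - y|.
Proof.
move=> h; have [_ cg _ _] := h.
have /choice[C hC] : forall i, exists C : R, 0 < C /\ forall x, `|x| <= M -> `|g i x| <= C.
  by move=> i; have [C C0 hC] := cont_bounded M (cg i); exists C.
pose L := \sum_i C i.
have L0 : 0 <= L by apply: sumr_ge0 => j _; have [/ltW] := hC j.
exists (L + 1); first by rewrite ltr_wpDl.
move=> x y xM yM; pose v := x - y.
have := @mvt_bound R (fun s => f (y + s *: v)) (fun s => \sum_i v 0 i * g i (y + s *: v))
  1 ((L + 1) * `|v|).
rewrite normr1 mulr1 scale1r scale0r addr0 (_ : y + v = x); last by rewrite addrC subrK.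
apply.
  move=> s _ _; apply: line_derive.
  exact: (C1_dir v ltr01 (fun z i _ => C3T_derive z i h) (fun i => cg i _)).
move=> s; rewrite mulr1 => s0; rewrite ger0_norm // => s1.
have zM : `|y + s *: v| <= M.
  have -> : y + s *: v = (1 - s) *: y + s *: x.
    by rewrite scalerBr scalerBl scale1r addrA addrAC.
  apply: le_trans (ler_normD _ _) _; rewrite !normrZ (ger0_norm s0) ger0_norm ?subr_ge0 //.
  have -> : M = (1 - s) * M + s * M by ring.
  by apply: lerD; rewrite ler_wpM2l // subr_ge0.
apply: le_trans (ler_norm_sum _ _ _) _; rewrite mulrDl mulr_suml.
rewrite ler_wpDr ?mul1r //; apply: ler_sum => i _.
rewrite normrM mulrC ler_pM // ?coord_le //.
by have [_] := hC i; apply.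
Qed.

(* A defining function, used in place of the distance to the boundary. *)
Definition dfun Omega rho g H : Prop :=
  [/\ C3T rho g H, forall x, Omega x -> 0 < rho x, forall x, bdry Omega x -> rho x = 0 &
    exists2 c : R, 0 < c & exists2 dl : R, 0 < dl &
      forall x, Omega x -> rho x < dl -> c <= \sum_i g i x ^+ 2].

Lemma enorm_ge0 (G : 'I_N -> R) : 0 <= enorm G.
Proof. exact: sqrtr_ge0. Qed.

Lemma enorm_sqr (G : 'I_N -> R) : enorm G ^+ 2 = \sum_i G i ^+ 2.
Proof. by rewrite sqr_sqrtr // sumr_ge0 // => i _; rewrite sqr_ge0. Qed.

Lemma enormZ c (G : 'I_N -> R) : enorm (fun i => c * G i) = `|c| * enorm G.
Proof.
rewrite /enorm -sqrtr_sqr -sqrtrM ?sqr_ge0 // mulr_sumr.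
by congr Num.sqrt; apply: eq_bigr => i _; rewrite exprMn.
Qed.

Lemma coord_enorm (G : 'I_N -> R) i : `|G i| <= enorm G.
Proof.
rewrite -sqrtr_sqr ler_sqrt ?sumr_ge0 // => [|j _]; last by rewrite sqr_ge0.
by rewrite (bigD1 i) //= lerDl sumr_ge0 // => j _; rewrite sqr_ge0.
Qed.

Lemma norm_le_enorm x : `|x| <= enorm (fun i => x 0 i).
Proof. by apply: norm_rV_le => [|i]; [exact: enorm_ge0 | exact: (coord_enorm (fun i => x 0 i))]. Qed.

Lemma dfun_bounds Omega rho g H : bounded_set Omega -> dfun Omega rho g H ->
  exists c C dl, [/\ 0 < c, 0 < C, 0 < dl,
    forall x, Omega x -> [/\ `|rho x| <= C, enorm (fun i => g i x) <= C & `|\sum_i H i x| <= C]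
    & (forall x, Omega x -> rho x < dl -> c <= \sum_i g i x ^+ 2) /\
      (forall x y, Omega x -> bdry Omega y -> rho x <= C * enorm (fun i => (x - y) 0 i))].
Proof.
move=> /bounded_setP[M hM] [h0 h1 h2 [c c0 [dl dl0 h3]]].
have [cr cg cH _] := h0.
have [C1 C10 hC1] := cont_bounded M cr.
have [C2 C20 hC2] : exists2 C : R, 0 < C & forall x, `|x| <= M -> enorm (fun i => g i x) <= C.
  have [|C C0 hC] := @cont_bounded (fun x => \sum_i g i x ^+ 2) M.
    by apply: cont_sumf => i; apply: cont_sqr.
  exists (Num.sqrt C); first by rewrite sqrtr_gt0.
  move=> x /hC; rewrite ger0_norm ?sumr_ge0 // => [|i _]; last by rewrite sqr_ge0.
  by move=> hx; rewrite ler_sqrt // ltW.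
have [C3 C30 hC3] : exists2 C : R, 0 < C & forall x, `|x| <= M -> `|\sum_i H i x| <= C.
  by apply: cont_bounded; apply: cont_sumf.
have [L L0 hL] := C3T_lip M h0.
exists c, (C1 + C2 + C3 + L), dl; split=> //.
- by lra.
- move=> x Ox; split.
  + by have := hC1 x (hM _ Ox); lra.
  + by have := hC2 x (hM _ Ox); lra.
  + by have := hC3 x (hM _ Ox); lra.
- split=> // x y Ox By; have := hL x y (hM _ Ox) (closure_bounded hM By.1).
  rewrite (h2 y By) subr0 gtr0_norm ?h1 // => /le_trans; apply.
  apply: ler_pM => //; first exact: ltW.
    by lra.
  exact: norm_le_enorm.
Qed.

End SmoothFunctions.

(** * First decay, boundary barrier and gradient estimate *)

Section Decay.
Context {R : realType} {N : nat}.
Implicit Types (x y v : 'rV[R]_N) (D Omega : set 'rV[R]_N) (u w : R -> 'rV[R]_N -> R).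

Lemma powR_mono (p y z : R) : 0 <= p -> 0 <= y -> y <= z -> y `^ p <= z `^ p.
Proof.
by move=> p0 y0 yz; rewrite ge0_ler_powR ?nnegrE // (le_trans y0).
Qed.

Lemma nonlin_le (a p E F : R) : 0 <= p -> 0 <= E -> E <= F -> a * E `^ p <= `|a| * F `^ p.
Proof.
move=> p0 E0 EF; apply: le_trans (ler_wpM2r (powR_ge0 _ _) (ler_norm a)) _.
by rewrite ler_wpM2l // powR_mono.
Qed.

Lemma sol_bounded Omega a p u T : bounded_set Omega -> sol Omega a p u ->
  exists2 C : R, 0 < C & forall t x, 0 <= t <= T -> closure Omega x -> `|u t x| <= C.
Proof.
move=> /bounded_setP[M hM] su; apply: contrapT => h.
have /choice[z hz] : forall n : nat, exists z : R * 'rV[R]_N,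
    [/\ 0 <= z.1 <= T, closure Omega z.2 & n.+1%:R < `|u z.1 z.2|].
  move=> n; apply: contrapT => hn; apply: h; exists n.+1%:R => // t x tT cx.
  by rewrite leNgt; apply/negP => nz; apply: hn; exists (t, x).
have zT n : 0 <= (z n).1 <= T by have [] := hz n.
have zc n : closure Omega (z n).2 by have [] := hz n.
have [t ht] : exists l : R, (fun n => (z n).1) @ Uf --> l.
  apply: (@Uf_bounded _ _ T); apply: nearW => n; have /andP[t0 tT] := zT n.
  by rewrite ger0_norm.
have [x hx] : exists l : 'rV[R]_N, (fun n => (z n).2) @ Uf --> l.
  by apply: (@Uf_bounded_rV _ _ _ M); apply: nearW => n; apply: closure_bounded hM _ (zc n).
have tT : 0 <= t <= T.
  apply/andP; split.
    by apply: cvgr_to_ge ht _; apply: nearW => n; have /andP[] := zT n.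
  by apply: cvgr_to_le ht _; apply: nearW => n; have /andP[] := zT n.
have cx : closure Omega x.
  have /closure_id -> := @closed_closure _ Omega.
  by apply: closure_Uf hx _; apply: nearW.
have /cvgrPdist_lt/(_ 1 ltr01) h1 := sol_cont su tT cx zT zc ht hx.
have [n [h2 h3]] := Uf_ex (filterI h1 (@Uf_ge (fun n => (Num.truncn (`|u t x| + 1)).+1 <= n)%N
    (Num.truncn (`|u t x| + 1)).+1 (fun n hn => hn))).
have [_ _ h4] := hz n.
have h5 := truncnS_gt (`|u t x| + 1).
have h6 : (Num.truncn (`|u t x| + 1)).+1%:R <= n.+1%:R :> R by rewrite ler_nat leqW.
have h7 := ler_normB (u t x) (u t x - u (z n).1 (z n).2); rewrite subKr in h7.
lra.
Qed.

Lemma usc_of_cont Omega D T (f : R -> 'rV[R]_N -> R) : D `<=` Omega ->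
  cyl_cont T (closure Omega) f ->
  (forall t x, 0 <= t <= T -> closure D x -> ~ D x -> f t x <= 0) ->
  bdry_usc T D f.
Proof.
move=> DO cf h t x tn xn tT cx nDx htn hxn tnt xnx e e0.
have cl y : closure D y -> closure Omega y by apply: closure_subset.
have := cf t x tn xn tT (cl _ cx) htn (fun n => subset_closure (DO _ (hxn n))) tnt xnx.
move/cvgrPdist_lt => /(_ e e0); apply: filterS => n.
have := h t x tT cx nDx; rewrite ltr_norml => + /andP[]; lra.
Qed.

Lemma cont_cyl T D (b : R -> R) (f : 'rV[R]_N -> R) :
  continuous b -> continuous f -> cyl_cont T D (fun t x => b t * f x).
Proof.
move=> cb cf t x tn xn _ _ _ _ ht hx; apply: cvgM.
  exact: (cvg_comp _ _ ht (cb t)).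
exact: (cvg_comp _ _ hx (cf x)).
Qed.

Lemma cyl_contD T D u w : cyl_cont T D u -> cyl_cont T D w ->
  cyl_cont T D (fun t x => u t x + w t x).
Proof. by move=> h1 h2 t x tn xn *; apply: cvgD; [apply: h1 | apply: h2]. Qed.

Lemma cont_exp (c : R) : continuous (fun t : R => expR (c * t)).
Proof.
move=> t; apply: (@continuous_comp _ _ _ (fun z => c * z) expR).
  exact: mulrl_continuous.
exact: continuous_expR.
Qed.

Lemma cont_coord i : continuous (fun x : 'rV[R]_N => x 0 i).
Proof. exact: coord_continuous. Qed.

Definition sqn x := \sum_i x 0 i ^+ 2.

Lemma cont_sqn : continuous sqn.
Proof. by apply: cont_sumf => i; apply: cont_sqr; apply: cont_coord. Qed.

Lemma sqn_ge0 x : 0 <= sqn x.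
Proof. by apply: sumr_ge0 => i _; apply: sqr_ge0. Qed.

Lemma sqn_line x v s : sqn (x + s *: v) = sqn x + 2 * s * (\sum_i x 0 i * v 0 i) + s ^+ 2 * sqn v.
Proof.
rewrite /sqn !mulr_sumr -!big_split /=; apply: eq_bigr => i _; rewrite !mxE; ring.
Qed.

Lemma sqn_ebase x i s : sqn (x + s *: ebase i) = sqn x + 2 * x 0 i * s + s ^+ 2.
Proof.
rewrite sqn_line (_ : \sum_j _ = x 0 i); last first.
  by under eq_bigr do rewrite mulrC; rewrite sum_ebase_l.
rewrite (_ : sqn (ebase i) = 1); first by ring.
rewrite /sqn (eq_bigr (fun j => (@ebase R N i) 0 j * (ebase i) 0 j)) ?sum_ebase_l.
  by rewrite ebaseE eqxx.
by move=> j _; rewrite expr2.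
Qed.

Lemma sqn_jet2 x i : jet2 (fun s => sqn (x + s *: ebase i)) (2 * x 0 i) 2.
Proof.
have := jet2_quad (sqn x) (2 * x 0 i) 1; rewrite mulr1.
by apply: jet2_ext => s; rewrite sqn_ebase; ring.
Qed.

Lemma sqn_le x (M : R) : `|x| <= M -> sqn x <= N%:R * M ^+ 2.
Proof.
move=> xM; apply: (@le_trans _ _ (\sum_(i < N) M ^+ 2)).
  apply: ler_sum => i _; rewrite -[x 0 i ^+ 2]real_normK ?num_real //.
  rewrite lerXn2r ?nnegrE //; first by apply: le_trans xM.
  by apply: le_trans xM; apply: coord_le.
by rewrite sumr_const card_ord mulr_natl.
Qed.

(* Supersolution [S e^(-dl t) (1 + eps (B - |x|^2))]; since p > 1 its nonlinear
   term is absorbed when [eps] is small. *)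
Lemma initial_decay Omega a p u : (0 < N)%N -> open Omega -> bounded_set Omega -> 1 < p ->
  sol Omega a p u ->
  exists S dl, [/\ 0 < S, 0 < dl & forall t x, 0 <= t -> Omega x -> u t x <= S * expR (- dl * t)].
Proof.
move=> N0 oO bO p1 su; have [M' hM'] := bounded_setP bO.
pose M := `|M'| + 1.
have M0 : 0 < M by rewrite ltr_wpDl.
have hM x : Omega x -> `|x| <= M.
  by move=> /hM' /le_trans; apply; rewrite /M; have := ler_norm M'; lra.
have [S S0 hS] := sol_bounded 0 bO su.
have n1 : 1 <= N%:R :> R by rewrite ler1n.
pose Bd := N%:R * M ^+ 2.
have Bd0 : 0 < Bd by rewrite mulr_gt0 ?exprn_gt0 //; lra.
pose Q := Bd + 1.
have hQ x : Omega x -> enorm (fun i => x 0 i) <= Q.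
  move=> /hM /sqn_le hx; rewrite -(@ler_pXn2r _ 2) ?nnegrE ?enorm_ge0 //; last by rewrite /Q; lra.
  rewrite enorm_sqr; apply: le_trans hx _; rewrite -/Bd /Q; nra.
have p10 : 0 < p - 1 by lra.
have SN0 : 0 < S * N%:R by rewrite mulr_gt0 //; lra.
have Bi0 : 0 < Bd^-1 by rewrite invr_gt0.
have [eps] := small_power (`|a| * (2 * S * Q) `^ p) p10 SN0 Bi0.
move=> /andP[e0 eB] /(_ eps); rewrite lexx (ltW e0) => /(_ isT) he.
have eB1 : eps * Bd <= 1 by rewrite -(mulVf (lt0r_neq0 Bd0)) ler_wpM2r // ltW.
(* For the supersolution [w] below, [- Lap w = 2 N S eps e^(-dl t)]: half of it absorbs the
   nonlinear term, a quarter the time derivative. The condition [eps Bd <= 1] keeps [h] between 1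
   and 2. *)
pose dl := N%:R * eps / 4.
have dl0 : 0 < dl by rewrite divr_gt0 // mulr_gt0 //; lra.
pose h x := 1 + eps * (Bd - sqn x).
pose w t x := (S * expR (- dl * t)) * h x.
exists (S * 2), dl; split=> //; first by lra.
have ch : continuous h.
  by apply: contD; [exact: contC | apply: contZ; apply: contB; [exact: contC | exact: cont_sqn]].
have cb : continuous (fun t : R => S * expR (- dl * t)).
  by apply: contZ; apply: cont_exp.
have hb x : Omega x -> 1 <= h x <= 2.
  move=> /hM /sqn_le; rewrite -/Bd /h => h1; have := sqn_ge0 x => h2.
  apply/andP; split.
    by rewrite lerDl mulr_ge0 ?subr_ge0 // ltW.
  have : eps * sqn x >= 0 by rewrite mulr_ge0 // ltW.
  lra.
suff H T t x : 0 <= t <= T -> Omega x -> u t x <= w t x.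
  move=> t x t0 Ox; apply: le_trans (H t t x _ Ox) _; first by rewrite t0 lexx.
  have /andP[_ h2] := hb x Ox; have := expR_gt0 (- dl * t) => e1.
  rewrite /w [leRHS]mulrAC ler_wpM2l // mulr_ge0 ?ltW //.
apply: (comparison oO oO (fun x h => h) bO su) => //.
- exact: cont_cyl.
- apply: (@usc_of_cont Omega) => //.
    apply: (@cyl_contB _ _ T (closure Omega) u w); [exact: (sol_cont su) | exact: cont_cyl].
  move=> s y /andP[s0 _] cy nOy; rewrite (sol_bd su) //; last by rewrite bdry_open.
  rewrite sub0r oppr_le0 /w mulr_ge0 ?mulr_ge0 ?expR_ge0 ?(ltW S0) //.
  have := closure_bounded hM cy => /sqn_le; rewrite -/Bd /h => h1.
  by rewrite addr_ge0 // mulr_ge0 ?subr_ge0 // ltW.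
- move=> y Oy; rewrite /w mulr0 expR0 mulr1.
  have /andP[h1 _] := hb y Oy.
  have := hS 0 y _ (subset_closure Oy); rewrite lexx => /(_ isT) h2.
  apply: le_trans (ler_norm _) _; apply: le_trans h2 _.
  by rewrite -[leLHS]mulr1 ler_wpM2l // ltW.
- move=> s y /andP[s0 _] Oy; set e := expR (- dl * s).
  have e1 : 0 < e <= 1.
    by rewrite expR_gt0 /= /e -expR0 ler_expR mulNr oppr_le0 mulr_ge0 // ltW.
  have /andP[ep e1'] := e1.
  exists (- dl * (S * e) * h y), (fun i => (S * e) * (- eps * (2 * y 0 i))), (fun i => (S * e) * (- eps * 2)).
  split.
    split.
      have := jet1Z (S * h y) (jet1_exp (- dl) s).
      rewrite (_ : S * h y * _ = - dl * (S * e) * h y); last by rewrite /e; ring.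
      by under eq_fun do rewrite mulrAC.
    move=> i; rewrite /w; apply: jet2Z.
    have := jet2D (jet2_cst (1 + eps * Bd)) (jet2Z (- eps) (sqn_jet2 y i)).
    by rewrite !add0r; apply: jet2_ext => r; rewrite /h; ring.
  move=> _; rewrite sumr_const card_ord -mulr_natl.
  rewrite (_ : enorm _ = (2 * S * enorm (fun i => y 0 i)) * (eps * e)); last first.
    transitivity (enorm (fun i => (- (2 * S * (eps * e))) * y 0 i)).
      by congr enorm; apply/funext => i; ring.
    rewrite enormZ normrN ger0_norm ?mulr_ge0 ?(ltW S0) ?(ltW e0) ?(ltW ep) //; ring.
  have h1 : a * (2 * S * enorm (fun i : 'I_N => y 0 i) * (eps * e)) `^ p <= S * N%:R * (eps * e).
    apply: le_trans (@nonlin_le a p _ ((2 * S * Q) * (eps * e)) _ _ _) _.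
    - by lra.
    - by rewrite mulr_ge0 ?mulr_ge0 ?enorm_ge0 ?(ltW S0) ?(ltW e0) ?(ltW ep).
    - rewrite ler_wpM2r ?mulr_ge0 ?(ltW e0) ?(ltW ep) // ler_wpM2l ?hQ // mulr_ge0 // ltW //.
    have QS0 : 0 <= 2 * S * Q by rewrite mulr_ge0 ?mulr_ge0 ?(ltW S0) // /Q; lra.
    rewrite powRM //; last by rewrite mulr_ge0 // ltW.
    rewrite (@powRM _ eps e) ?(ltW e0) ?(ltW ep) // -(@mulr_powRB1 _ eps) ?(ltW e0) //; last by lra.
    have hep : e `^ p <= e by apply: ge1r_powR => //; lra.
    rewrite (_ : `|a| * _ = (`|a| * (2 * S * Q) `^ p * eps `^ (p - 1)) * (eps * e `^ p)); last by ring.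
    apply: ler_pM => //.
    - by rewrite mulr_ge0 ?powR_ge0 // mulr_ge0 ?powR_ge0.
    - by rewrite mulr_ge0 ?powR_ge0 // ltW.
    - by rewrite ler_wpM2l // ltW.
  apply: le_lt_trans h1 _; have /andP[_ h2] := hb y Oy.
  have pos : 0 < S * N%:R * (eps * e) by rewrite mulr_gt0 // mulr_gt0.
  have : dl * (S * e) * h y <= dl * (S * e) * 2 by rewrite ler_wpM2l // mulr_ge0 ?mulr_ge0 // ltW.
  rewrite /dl; lra.
Qed.

End Decay.

Section Product.
Context {R : realType}.
Implicit Types F G : R -> R.

Lemma jet2M F G c1 c2 d1 d2 : jet2 F c1 c2 -> jet2 G d1 d2 ->
  jet2 (fun s => F s * G s) (c1 * G 0 + F 0 * d1) (c2 * G 0 + 2 * c1 * d1 + F 0 * d2).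
Proof.
move=> hF hG e e0.
pose A := `|F 0| + `|c1| + `|c2|; pose B := `|G 0| + `|d1| + `|d2|.
pose K := `|c1 * d2| + `|c2 * d1| + `|c2 * d2|.
have A0 : 0 <= A by rewrite !addr_ge0.
have B0 : 0 <= B by rewrite !addr_ge0.
have K0 : 0 <= K by rewrite !addr_ge0.
pose e1 := Num.min 1 (e / (2 * (A + B + 1))).
have e10 : 0 < e1 by rewrite lt_min ltr01 divr_gt0 //; lra.
have e1e : e1 * (A + B + 1) <= e / 2.
  have : e1 <= e / (2 * (A + B + 1)) by rewrite ge_min lexx orbT.
  by rewrite ler_pdivlMr; lra.
have e11 : e1 <= 1 by rewrite ge_min lexx.
have [a a0 ha] := hF e1 e10; have [b b0 hb] := hG e1 e10.
exists (Num.min (Num.min a b) (Num.min 1 (e / (2 * (K + 1))))).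
  by rewrite !lt_min a0 b0 ltr01 divr_gt0 //; lra.
move=> s; rewrite !lt_min => /andP[/andP[/ha {}ha /hb {}hb] /andP[s1 sK]].
pose q := F 0 + c1 * s + c2 / 2 * s ^+ 2; pose q' := G 0 + d1 * s + d2 / 2 * s ^+ 2.
pose r := F s - F 0 - c1 * s - c2 / 2 * s ^+ 2.
pose r' := G s - G 0 - d1 * s - d2 / 2 * s ^+ 2.
have -> : F s * G s - F 0 * G 0 - (c1 * G 0 + F 0 * d1) * s -
   (c2 * G 0 + 2 * c1 * d1 + F 0 * d2) / 2 * s ^+ 2 =
   s ^+ 2 * (s * (c1 * d2 / 2 + c2 * d1 / 2 + s * (c2 * d2 / 4))) + (q * r' + r * q' + r * r').
  by rewrite /q /q' /r /r'; field.
have hs2 : `|s ^+ 2| = s ^+ 2 by rewrite ger0_norm ?sqr_ge0.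
have s20 := sqr_ge0 s.
have s21 : s ^+ 2 <= 1 by rewrite -real_normK ?num_real // expr_le1 // ltW.
have half z : `|z / 2 * s ^+ 2| <= `|z|.
  rewrite normrM hs2 normrM (ger0_norm (_ : 0 <= 2^-1)) ?invr_ge0 //.
  by have := normr_ge0 z; nra.
have hq : `|q| <= A.
  apply: le_trans (ler_normD _ _) _; apply: lerD.
    apply: le_trans (ler_normD _ _) _; rewrite lerD // normrM ler_piMr // ltW //.
  exact: half.
have hq' : `|q'| <= B.
  apply: le_trans (ler_normD _ _) _; apply: lerD.
    apply: le_trans (ler_normD _ _) _; rewrite lerD // normrM ler_piMr // ltW //.
  exact: half.
have h1 : `|q * r' + r * q' + r * r'| <= e1 * (A + B + 1) * s ^+ 2.
  have hr : `|r| <= e1 * s ^+ 2 by [].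
  have hr' : `|r'| <= e1 * s ^+ 2 by [].
  have es : e1 * s ^+ 2 <= 1.
    by nra.
  apply: le_trans (ler_normD _ _) _; apply: le_trans (lerD (ler_normD _ _) (lexx _)) _.
  rewrite !normrM.
  have g1 : `|q| * `|r'| <= A * (e1 * s ^+ 2) by apply: ler_pM.
  have g2 : `|r| * `|q'| <= (e1 * s ^+ 2) * B by apply: ler_pM.
  have g3 : `|r| * `|r'| <= (e1 * s ^+ 2) * 1 by apply: ler_pM => //; apply: le_trans es.
  lra.
have h2 : `|s * (c1 * d2 / 2 + c2 * d1 / 2 + s * (c2 * d2 / 4))| <= e / 2.
  rewrite normrM; apply: (@le_trans _ _ (`|s| * K)).
    rewrite ler_wpM2l //; apply: le_trans (ler_normD _ _) _.
    apply: le_trans (lerD (ler_normD _ _) (lexx _)) _; rewrite /K.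
    rewrite (normrM s) !(normrM _ (_^-1)) !normfV !(ger0_norm (_ : 0 <= _%:R)) //.
    have := normr_ge0 (c1 * d2); have := normr_ge0 (c2 * d1); have := normr_ge0 (c2 * d2).
    have := normr_ge0 s; nra.
  move: sK; rewrite ltr_pdivlMr; last lra.
  have := normr_ge0 s; nra.
apply: le_trans (ler_normD _ _) _; rewrite normrM hs2.
have : s ^+ 2 * `|s * (c1 * d2 / 2 + c2 * d1 / 2 + s * (c2 * d2 / 4))| <= s ^+ 2 * (e / 2).
  by rewrite ler_wpM2l.
have : e1 * (A + B + 1) * s ^+ 2 <= e / 2 * s ^+ 2 by rewrite ler_wpM2r.
lra.
Qed.

End Product.

Section Barrier.
Context {R : realType} {N : nat}.
Implicit Types (x y v : 'rV[R]_N) (D Omega : set 'rV[R]_N) (u w : R -> 'rV[R]_N -> R).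

(* Near the boundary the nonlinear term is dominated by the concavity of
   [2s - s^2] in [s = th * rho] as soon as u is small there; this is where p <= 2 enters. *)
Lemma barrier Omega rho g H (A p : R) : open Omega -> bounded_set Omega ->
  @dfun R N Omega rho g H -> 1 < p <= 2 -> 0 <= A ->
  exists eps0 k0, [/\ 0 < eps0, 0 < k0 & forall a u m T th,
    `|a| <= A -> sol Omega a p u -> 0 < m <= eps0 -> 0 < T -> k0 <= th ->
    k0 ^+ 2 <= th ^+ 2 * T ->
    (forall t x, 0 <= t <= T -> Omega x -> th * rho x <= 1 -> u t x <= m) ->
    forall t x, 0 <= t <= T -> Omega x -> th * rho x < 1 ->
      u t x <= m * (2 * (th * rho x) - (th * rho x) ^+ 2 + (1 - t / T))].
Proof.
move=> oO bO dO /andP[p1 p2] A0.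
have [h0 rpos rbd _] := dO; have [cr cg cH _] := h0.
have [c [C [dl [c0 C0 dl0 hC [hc _]]]]] := dfun_bounds bO dO.
have p10 : 0 < p - 1 by lra.
have c20 : 0 < c / 2 by lra.
have [eps0 /andP[eps00 _] heps] := small_power (A * (2 * C) `^ p) p10 c20 ltr01.
(* [4 / c] pays for the time derivative [m / T], [4 C / c] for the second derivatives of [rho], and
   [dl^-1] keeps the layer [th rho < 1] inside the region where the gradient of [rho] is bounded
   below. *)
pose k0 := 1 + 4 / c + 4 * C / c + dl^-1.
have q1 : 0 < 4 / c by rewrite divr_gt0.
have q2 : 0 < 4 * C / c by rewrite divr_gt0 // mulr_gt0.
have q3 : 0 < dl^-1 by rewrite invr_gt0.
have k00 : 0 < k0 by rewrite /k0; lra.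
exists eps0, k0; split=> // a u m T th aA su /andP[m0 me] T0 kth kT hm t0 x0 tT0 Ox0 tr0.
have th1 : 1 <= th by apply: le_trans kth; rewrite /k0; lra.
have th0 : 0 < th by lra.
pose D := [set x | Omega x /\ th * rho x < 1].
pose h x := 2 * (th * rho x) - (th * rho x) ^+ 2.
(* The term [1 - t / T] covers the initial values, of which only [u <= m] is known, and has
   disappeared at time [T]. *)
pose w t x := m * (h x + (1 - t / T)).
have ctr : continuous (fun x => th * rho x) by apply: contZ.
have ch : continuous h by apply: contB; [apply: contZ | apply: cont_sqr].
have oD : open D.
  apply: openI => //.
  exact: (@open_comp _ _ (fun x => th * rho x) [set z : R | z < 1] (in1W ctr) (@open_lt _ 1)).
have DO : D `<=` Omega by move=> x [].
have cw E : cyl_cont T E w.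
  move=> t x tn xn _ _ _ _ ht hx; apply: cvgM; first exact: cvg_cst.
  apply: cvgD; first exact: (cvg_comp _ _ hx (ch x)).
  apply: cvgB; first exact: cvg_cst.
  by apply: cvgM => //; exact: cvg_cst.
have tTf t : 0 <= t <= T -> 0 <= 1 - t / T.
  by move=> /andP[t0' tT]; rewrite subr_ge0 ler_pdivrMr // mul1r.
suff : u t0 x0 <= w t0 x0 by [].
apply: (@comparison _ _ Omega D a p u w T) => //.
- by case: bO => M [Mr hM]; exists M; split=> // z Mz y /DO; apply: hM.
- apply: (@usc_of_cont _ _ Omega) => //.
    by apply: (@cyl_contB _ _ T (closure Omega) u w) => //; exact: (sol_cont su).
  move=> t x tT cx nDx; have /andP[t0' _] := tT.
  have cO : closure Omega x by apply: closure_subset cx.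
  rewrite subr_le0; have [Ox|nOx] := pselect (Omega x).
    have trx : th * rho x <= 1.
      have : closed [set y | th * rho y <= 1].
        exact: (@closed_comp _ _ (fun x => th * rho x) [set z : R | z <= 1] (in1W ctr) (@closed_le _ 1)).
      rewrite closure_id => E; have : closure [set y | th * rho y <= 1] x.
        by apply: closure_subset cx => y [_ /ltW].
      by rewrite -E.
    have trx1 : th * rho x = 1.
      by apply/le_anti; rewrite trx /= leNgt; apply/negP => tl; apply: nDx.
    apply: le_trans (hm t x tT Ox trx) _; rewrite /w /h trx1.
    by rewrite -[leLHS]mulr1 ler_pM2l //; have := tTf t tT; lra.
  rewrite (sol_bd su) ?bdry_open // /w /h rbd ?bdry_open //.
  by rewrite mulr_ge0 ?(ltW m0) //; have := tTf t tT; lra.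
- move=> x [Ox tx]; apply: le_trans (hm 0 x _ Ox (ltW tx)) _; first by rewrite lexx ltW.
  rewrite /w /h mul0r subr0 -[leLHS]mulr1 ler_pM2l //.
  by have := mulr_gt0 th0 (rpos x Ox); nra.
- move=> t x /andP[t0' _] [Ox tx]; set s := th * rho x in tx *.
  have s0 : 0 < s by rewrite mulr_gt0 // rpos.
  exists (- (m / T)), (fun i => 2 * m * th * (1 - s) * g i x),
    (fun i => m * (2 * th * (1 - s) * H i x - 2 * th ^+ 2 * g i x ^+ 2)); split.
    split.
      apply: (@jet2_jet1 _ _ _ 0).
      have := jet2_quad (w t x) (- (m / T)) 0; rewrite mulr0.
      by apply: jet2_ext => r; rewrite /w; ring.
    move=> i; have hr := jet2Z th (C3T_jet2 x i h0).
    have := jet2M hr hr; rewrite /= scale0r addr0 -/s => hr2.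
    have hr3 := jet2B (jet2Z 2 hr) hr2; have := jet2Z m (jet2D hr3 (jet2_cst (1 - t / T))); rewrite !addr0.
    rewrite [X in jet2 _ X _ -> _](_ : _ = 2 * m * th * (1 - s) * g i x); last by ring.
    rewrite [X in jet2 _ _ X -> _](_ : _ = m * (2 * th * (1 - s) * H i x - 2 * th ^+ 2 * g i x ^+ 2)); last by ring.
    by apply: jet2_ext => r; rewrite /w /h expr2.
  move=> _; have [_ hg hH] := hC x Ox.
  have gc : c <= \sum_i g i x ^+ 2.
    apply: hc => //; rewrite -(ltr_pM2l th0); apply: lt_le_trans tx _.
    rewrite -ler_pdivrMr // mul1r; apply: le_trans kth; rewrite /k0; lra.
  rewrite enormZ -mulr_sumr sumrB -!mulr_sumr.
  have mth : 0 < m * th by rewrite mulr_gt0.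
  have L1 : a * (`|2 * m * th * (1 - s)| * enorm (fun i => g i x)) `^ p <= c / 2 * (m * th ^+ 2).
    apply: le_trans (@nonlin_le R a p _ ((2 * C) * (m * th)) _ _ _) _.
    - by lra.
    - by rewrite mulr_ge0 ?enorm_ge0.
    - rewrite (_ : 2 * C * (m * th) = (2 * m * th) * C); last by ring.
      apply: ler_pM => //; first exact: enorm_ge0.
      rewrite ger0_norm; last by rewrite mulr_ge0 //; nra.
      by rewrite -[leRHS]mulr1 ler_wpM2l //; [nra | lra].
    rewrite powRM; [|lra|exact: ltW].
    rewrite (@powRM _ m th) ?(ltW m0) ?(ltW th0) // -(@mulr_powRB1 _ m) ?(ltW m0) //; last lra.
    have hth : th `^ p <= th ^+ 2 by rewrite -powR_mulrn ?(ltW th0) // ler_powR.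
    have hmm := heps m; rewrite (ltW m0) me in hmm; have {}hmm := hmm isT.
    apply: (@le_trans _ _ ((A * (2 * C) `^ p * m `^ (p - 1)) * (m * th `^ p))).
      rewrite (_ : `|a| * _ = `|a| * ((2 * C) `^ p * m `^ (p - 1) * (m * th `^ p))); last by ring.
      rewrite (_ : A * _ * _ * _ = A * ((2 * C) `^ p * m `^ (p - 1) * (m * th `^ p))); last by ring.
      by rewrite ler_wpM2r // !mulr_ge0 ?powR_ge0 // ltW.
    apply: ler_pM => //.
    - by rewrite !mulr_ge0 ?powR_ge0.
    - by rewrite mulr_ge0 ?powR_ge0 // ltW.
    - by rewrite ler_wpM2l // ltW.
  apply: le_lt_trans L1 _.
  have mt2 : 0 < m * th ^+ 2 by rewrite mulr_gt0 // exprn_gt0.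
  have L2 : m / T <= c / 4 * (m * th ^+ 2).
    have k2 : 4 / c <= k0 ^+ 2.
      have : 4 / c <= k0 by rewrite /k0; lra.
      have : 1 <= k0 by rewrite /k0; lra.
      by nra.
    have : 4 / c <= th ^+ 2 * T by apply: le_trans kT.
    rewrite ler_pdivrMr // => h4; rewrite ler_pdivrMr //.
    by have : 0 < m by []; move: h4; set z := th ^+ 2 * T; rewrite (_ : _ * T = m / 4 * (z * c)); [nra | rewrite /z; field].
  have L3 : `|2 * th * (1 - s) * \sum_i H i x| <= c / 2 * th ^+ 2.
    rewrite normrM ger0_norm; last by nra.
    have h1 : 2 * th * (1 - s) * `|\sum_i H i x| <= 2 * th * C by apply: ler_pM => //; nra.
    apply: le_trans h1 _.
    have : 4 * C / c <= th by apply: le_trans kth; rewrite /k0; lra.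
    by rewrite ler_pdivrMr //; nra.
  have L4 : 2 * th ^+ 2 * c <= 2 * th ^+ 2 * \sum_i g i x ^+ 2.
    by rewrite ler_wpM2l // mulr_ge0 ?sqr_ge0.
  move: L3; rewrite ler_norml => /andP[_ L3].
  have : m * (2 * th * (1 - s) * (\sum_i H i x) - 2 * th ^+ 2 * \sum_i g i x ^+ 2) <=
    m * (c / 2 * th ^+ 2 - 2 * th ^+ 2 * c) by rewrite ler_pM2l //; lra.
  have : 0 < c * (m * th ^+ 2) by rewrite mulr_gt0.
  lra.
Qed.

End Barrier.

(** * Doubling of variables *)

Section TwoPoint.
Context {R : realType} {N : nat}.
Implicit Types (x y v : 'rV[R]_N) (D Omega : set 'rV[R]_N) (u w : R -> 'rV[R]_N -> R).

Definition en x := enorm (fun i => x 0 i).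

Lemma en_ge0 x : 0 <= en x. Proof. exact: sqrtr_ge0. Qed.

Lemma en_sqr x : en x ^+ 2 = sqn x. Proof. exact: enorm_sqr. Qed.

Lemma enZ (c : R) x : en (c *: x) = `|c| * en x.
Proof. by rewrite -enormZ; congr enorm; apply/funext => i; rewrite mxE. Qed.

Lemma enN x : en (- x) = en x.
Proof. by rewrite -scaleN1r enZ normrN normr1 mul1r. Qed.

Lemma en0_eq x : en x = 0 -> x = 0.
Proof.
move=> h; have := norm_le_enorm x; rewrite -/(en x) h normr_le0; by move/eqP.
Qed.

Lemma cont_en : continuous en.
Proof.
move=> x; apply: (@continuous_comp _ _ _ sqn Num.sqrt); first exact: cont_sqn.
exact: sqrt_continuous.
Qed.

Lemma jet1_unique (F : R -> R) d d' : jet1 F d -> jet1 F d' -> d = d'.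
Proof.
move=> h h'; have := jet1_lin 1 (-1) h h'; rewrite mul1r mulN1r => h0.
apply/eqP; rewrite -subr_eq0; apply/eqP; apply: (jet1_max ltr01 h0) => s _.
by rewrite !mul1r !mulN1r !subrr.
Qed.

(** The vectors [ebase i - (2 * e 0 i) *: e] are the images of the basis under the reflection across
    the hyperplane orthogonal to [e]; they are orthonormal, and the trace is the same in every
    orthonormal basis. *)
Lemma refl_trace (e : 'rV[R]_N) (M : 'I_N -> 'I_N -> R) : \sum_j e 0 j ^+ 2 = 1 ->
  \sum_i \sum_j \sum_l (ebase i - (2 * e 0 i) *: e) 0 j * (ebase i - (2 * e 0 i) *: e) 0 l * M j l
  = \sum_i M i i.
Proof.
move=> e1; pose B := \sum_j \sum_l e 0 j * (e 0 l * M j l).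
have E i : \sum_j \sum_l (ebase i - (2 * e 0 i) *: e) 0 j * (ebase i - (2 * e 0 i) *: e) 0 l * M j l
   = M i i + - 2 * (e 0 i * (\sum_l e 0 l * M i l)) + - 2 * (e 0 i * \sum_j e 0 j * M j i) + 4 * B * e 0 i ^+ 2.
  transitivity (\sum_j ((@ebase R N i) 0 j * (\sum_l (@ebase R N i) 0 l * M j l)
      + (- 2 * e 0 i) * ((@ebase R N i) 0 j * (\sum_l e 0 l * M j l))
      + (- 2 * e 0 i) * (e 0 j * (\sum_l (@ebase R N i) 0 l * M j l))
      + 4 * e 0 i ^+ 2 * (\sum_l e 0 j * (e 0 l * M j l)))).
    apply: eq_bigr => j _; rewrite !mulr_sumr -!big_split /=; apply: eq_bigr => l _.
    have hR q : (ebase i - (2 * e 0 i) *: e) 0 q = (@ebase R N i) 0 q - (2 * e 0 i) * e 0 q.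
      by rewrite !mxE.
    by rewrite !hR; ring.
  rewrite !big_split /= -!mulr_sumr !sum_ebase_l.
  have E3 : \sum_j e 0 j * (\sum_l (@ebase R N i) 0 l * M j l) = \sum_j e 0 j * M j i.
    by apply: eq_bigr => j _; rewrite sum_ebase_l.
  by rewrite E3 -/B; ring.
rewrite (eq_bigr _ (fun i _ => E i)) !big_split /= -!mulr_sumr e1 mulr1.
have h1 : \sum_i e 0 i * (\sum_l e 0 l * M i l) = B.
  by apply: eq_bigr => i _; rewrite mulr_sumr.
have h2 : \sum_i e 0 i * (\sum_j e 0 j * M j i) = B.
  rewrite /B exchange_big /=; apply: eq_bigr => i _; rewrite mulr_sumr.
  by apply: eq_bigr => j _; rewrite mulrCA.
by rewrite h1 h2; ring.
Qed.

(* Doubling of variables: at a maximum the two gradients agree, so the nonlinear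
   terms cancel; second derivatives are tested along the coupling by reflection
   in the direction of [x - y], which sees the concavity of the modulus. *)
Lemma two_point Omega (a p : R) u (T m k : R) : open Omega -> bounded_set Omega ->
  sol Omega a p u -> 0 < T -> 0 < m -> 0 < k -> 1 <= k ^+ 2 * T ->
  (forall t x, 0 <= t <= T -> Omega x -> `|u t x| <= m) ->
  (forall t x y, 0 <= t <= T -> Omega x -> bdry Omega y ->
     `|u t x| <= m * (2 * (k * en (x - y)) + (1 - t / T))) ->
  forall t x y, 0 <= t <= T -> Omega x -> Omega y -> k * en (x - y) <= 1 ->
   u t x - u t y <= 2 * m * (2 * (k * en (x - y)) - (k * en (x - y)) ^+ 2 + (1 - t / T)).
Proof.
move=> oO bO su T0 m0 k0 kT hm hb t1 x1 y1 tT1 Ox1 Oy1 kr1.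
pose phi t r := 2 * m * (2 * (k * r) - (k * r) ^+ 2 + (1 - t / T)).
pose f (z : R * ('rV[R]_N * 'rV[R]_N)) := u z.1 z.2.1 - u z.1 z.2.2 - phi z.1 (en (z.2.1 - z.2.2)).
rewrite leNgt; apply/negP => neg.
have f1 : 0 < f (t1, (x1, y1)) by rewrite subr_gt0.
(* Pairs are restricted to [k |x - y| <= 1], where [2 s - s^2] is increasing; at the end of this
   range [phi] is at least [2 m], which excludes a positive [f]. *)
pose A z := [/\ 0 <= z.1 <= T, closure Omega z.2.1 /\ closure Omega z.2.2,
   k * en (z.2.1 - z.2.2) <= 1 & f (t1, (x1, y1)) <= f z].
have [M hM] := bounded_setP bO.
have [|z hz|[t [x y]] /= [/= tT [cx cy] kr ff] mx] := @usc_max R _ A f.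
- exists (t1, (x1, y1)); split=> //=.
  by split; apply: subset_closure.
- have zT n : 0 <= (z n).1 <= T by have [] := hz n.
  have zx n : closure Omega (z n).2.1 by have [_ []] := hz n.
  have zy n : closure Omega (z n).2.2 by have [_ []] := hz n.
  have [t ht] : exists l : R, (fun n => (z n).1) @ Uf --> l.
    apply: (@Uf_bounded _ _ T); apply: nearW => n; have /andP[t0 tT] := zT n.
    by rewrite ger0_norm.
  have [x hx] : exists l : 'rV[R]_N, (fun n => (z n).2.1) @ Uf --> l.
    by apply: (@Uf_bounded_rV _ _ _ M); apply: nearW => n; apply: closure_bounded hM _ (zx n).
  have [y hy] : exists l : 'rV[R]_N, (fun n => (z n).2.2) @ Uf --> l.
    by apply: (@Uf_bounded_rV _ _ _ M); apply: nearW => n; apply: closure_bounded hM _ (zy n).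
  have tT : 0 <= t <= T.
    apply/andP; split.
      by apply: cvgr_to_ge ht _; apply: nearW => n; have /andP[] := zT n.
    by apply: cvgr_to_le ht _; apply: nearW => n; have /andP[] := zT n.
  have cx : closure Omega x.
    have /closure_id -> := @closed_closure _ Omega.
    by apply: closure_Uf hx _; apply: nearW.
  have cy : closure Omega y.
    have /closure_id -> := @closed_closure _ Omega.
    by apply: closure_Uf hy _; apply: nearW.
  have hr : (fun n => k * en ((z n).2.1 - (z n).2.2)) @ Uf --> k * en (x - y).
    apply: cvgM; first exact: cvg_cst.
    have hxy : (fun n => (z n).2.1 - (z n).2.2) @ Uf --> x - y by apply: cvgB.
    exact: (cvg_comp _ _ hxy (@cont_en (x - y))).
  have hf : (fun n => f (z n)) @ Uf --> f (t, (x, y)).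
    apply: cvgB; first by apply: cvgB; [exact: (sol_cont su tT cx zT zx ht hx) | exact: (sol_cont su tT cy zT zy ht hy)].
    apply: cvgM; first exact: cvg_cst.
    apply: cvgD.
      by apply: cvgB; [apply: cvgM => //; exact: cvg_cst | exact: cvg_sqr].
    by apply: cvgB; [exact: cvg_cst | apply: cvgM => //; exact: cvg_cst].
  exists (t, (x, y)).
    split=> //=; first by apply: cvgr_to_le hr _; apply: nearW => n; have [] := hz n.
    by apply: cvgr_to_ge hf _; apply: nearW => n; have [] := hz n.
  move=> e e0; move/cvgrPdist_lt: hf => /(_ e e0); apply: filterS => n.
  rewrite ltr_norml => /andP[]; lra.
have f0 : 0 < f (t, (x, y)) by apply: lt_le_trans f1 ff.
have {}mx z : 0 <= z.1 <= T -> closure Omega z.2.1 -> closure Omega z.2.2 ->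
    k * en (z.2.1 - z.2.2) <= 1 -> f z <= f (t, (x, y)).
  move=> h1 h2 h3 h4; have [h|h] := leP (f (t1, (x1, y1))) (f z).
    by apply: mx.
  exact: le_trans (ltW h) ff.
have /andP[t0' tT'] := tT.
pose r := en (x - y).
have r0 : 0 <= r by exact: en_ge0.
have tT0 : 0 <= 1 - t / T by rewrite subr_ge0 ler_pdivrMr // mul1r.
have dich z : closure Omega z -> Omega z \/ bdry Omega z.
  by move=> cz; rewrite bdry_open //; have [|] := pselect (Omega z); [left|right].
have kr0 : 0 <= k * r by rewrite mulr_ge0 // ltW.
(* If one of the two points is on the boundary, [hb] bounds the value at the other one, and
   [2 (2 s - s^2) >= 2 s] on [[0, 1]] makes [phi] dominate it. *)
have phi1 : m * (2 * (k * r) + (1 - t / T)) <= phi t r.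
  rewrite (_ : phi t r = m * (2 * (2 * (k * r) - (k * r) ^+ 2 + (1 - t / T)))); last first.
    by rewrite /phi; ring.
  rewrite ler_pM2l //.
  have : (k * r) ^+ 2 <= k * r by rewrite expr2 ler_piMl.
  by lra.
have phi0 : 0 <= phi t r.
  apply: le_trans phi1; rewrite mulr_ge0 ?(ltW m0) //; lra.
have f0' : phi t r < u t x - u t y by move: f0; rewrite /f /= -/r subr_gt0.
have Ox : Omega x.
  have [//|bx] := dich x cx; have ux := sol_bd su t0' bx.
  have [Oy|by_] := dich y cy; last by have uy := sol_bd su t0' by_; lra.
  have := hb t y x tT Oy bx; rewrite -opprB enN -/r ler_norml => /andP[]; lra.
have Oy : Omega y.
  have [//|by_] := dich y cy; have uy := sol_bd su t0' by_.
  have := hb t x y tT Ox by_; rewrite -/r ler_norml => /andP[]; lra.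
have krlt : k * r < 1.
  rewrite lt_neqAle kr andbT; apply/eqP => kre.
  move: f0'; rewrite /phi kre.
  have := hm t x tT Ox; have := hm t y tT Oy; rewrite !ler_norml => /andP[? ?] /andP[? ?].
  have : 0 <= m * (1 - t / T) by rewrite mulr_ge0 // ltW.
  lra.
have tp : 0 < t.
  rewrite lt_neqAle t0' andbT; apply/eqP => tz; move: f0'; rewrite -tz /phi mul0r.
  have h1 := hm t x tT Ox; have h2 := hm t y tT Oy; rewrite -tz in h1 h2.
  move: h1 h2; rewrite !ler_norml => /andP[? ?] /andP[? ?].
  have : 0 <= m * (2 * (k * r) - (k * r) ^+ 2) by rewrite mulr_ge0 ?(ltW m0) //; nra.
  lra.
have rp : 0 < r.
  rewrite lt_neqAle r0 andbT; apply/eqP => rz.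
  have /subr0_eq xy : x - y = 0 by apply: en0_eq; rewrite -/r -rz.
  by move: f0'; rewrite xy subrr; lra.
have [dx [Gx [Hx [jx1 jx2 jx3]]]] := sol_jet su tp Ox.
have [dy [Gy [Hy [jy1 jy2 jy3]]]] := sol_jet su tp Oy.
pose e : 'rV[R]_N := r^-1 *: (x - y).
have en_e : en e = 1 by rewrite enZ ger0_norm ?invr_ge0 // mulVf // gt_eqF.
have xye : x - y = r *: e by rewrite scalerA mulfV ?scale1r // gt_eqF.
clearbody e.
have en_re (s : R) : - r < s -> en ((r + s) *: e) = r + s.
  by move=> rs; rewrite enZ en_e mulr1 ger0_norm //; lra.
have sum_e2 : \sum_j e 0 j ^+ 2 = 1 by rewrite -/(sqn e) -en_sqr en_e expr1n.
have [rx rx0 hrx] := open_ball oO Ox; have [ry ry0 hry] := open_ball oO Oy.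
(* test along (x + s xi, y + s zeta) whenever xi - zeta = c e *)
have test xi zeta c : xi - zeta = c *: e ->
    exists2 q : R, 0 < q & forall s, `|s| < q ->
      u t (x + s *: xi) - u t (y + s *: zeta) - phi t (r + s * c) <= f (t, (x, y)).
  move=> hxz; have [qx qx0 hqx] := line_in xi oO Ox; have [qy qy0 hqy] := line_in zeta oO Oy.
  have c1 : 0 < `|c| + 1 by rewrite ltr_wpDl.
  have g0 : 0 < k^-1 - r by rewrite subr_gt0 -[k^-1]mul1r ltr_pdivlMr // mulrC.
  pose q := Num.min (Num.min qx qy) (Num.min r (k^-1 - r) / (`|c| + 1)).
  exists q; first by rewrite !lt_min qx0 qy0 divr_gt0 // lt_min rp.
  move=> s; rewrite !lt_min => /andP[/andP[/hqx sx /hqy sy]].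
  rewrite ltr_pdivlMr // lt_min => /andP[sr sk].
  have scn : `|s * c| <= `|s| * (`|c| + 1) by rewrite normrM ler_wpM2l // lerDl.
  have sc1 : - r < s * c.
    by have := ler_norm (- (s * c)); rewrite normrN; move: scn sr; clear; lra.
  have ens : en (x + s *: xi - (y + s *: zeta)) = r + s * c.
    rewrite -(en_re (s * c)) //; congr en.
    by rewrite opprD addrACA xye -scalerBr hxz scalerA scalerDl.
  have := mx (t, (x + s *: xi, y + s *: zeta)) tT (subset_closure sx) (subset_closure sy).
  rewrite /= ens => h; rewrite /f /= ens in h *.
  apply: h; have := ler_norm (s * c) => h1.
  have : k * (r + s * c) <= k * k^-1 by rewrite ler_wpM2l ?(ltW k0) //; move: h1 scn sk; clear; lra.
  by rewrite mulfV ?gt_eqF.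
have phiP2 c : jet2 (fun s => phi t (r + s * c)) (4 * m * k * (1 - k * r) * c) (- (4 * m * k ^+ 2) * c ^+ 2).
  have := jet2_quad (phi t r) (4 * m * k * (1 - k * r) * c) (- (2 * m * k ^+ 2) * c ^+ 2).
  rewrite [X in jet2 _ _ X -> _](_ : _ = - (4 * m * k ^+ 2) * c ^+ 2); last by ring.
  by apply: jet2_ext => s; rewrite /phi; ring.
have test2 xi zeta c : xi - zeta = c *: e ->
  \sum_i xi 0 i * Gx i - \sum_i zeta 0 i * Gy i - 4 * m * k * (1 - k * r) * c = 0 /\
  \sum_i \sum_j xi 0 i * xi 0 j * Hx i j - \sum_i \sum_j zeta 0 i * zeta 0 j * Hy i j
    + (4 * m * k ^+ 2) * c ^+ 2 <= 0.
  move=> hxz; have [q q0 hq] := test xi zeta c hxz.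
  have := jet2B (jet2B (jx2 xi) (jy2 zeta)) (phiP2 c).
  rewrite mulNr opprK => h; apply: (jet2_max q0 h) => s /hq.
  by rewrite !scale0r !addr0 mul0r addr0.
pose L := 4 * m * k * (1 - k * r).
have Gye : \sum_i e 0 i * Gy i = L.
  have [|h _] := test2 0 (- e) 1; first by rewrite sub0r opprK scale1r.
  move: h; rewrite big1 => [|i _]; last by rewrite mxE mul0r.
  rewrite (eq_bigr (fun i => - (e 0 i * Gy i))) => [|i _]; last by rewrite mxE mulNr.
  rewrite sumrN -/L; clear; lra.
(* [ebase i - Re i] is a multiple of [e], so the distance between the moving points is affine in [s]
   and the norm never has to be differentiated. *)
pose Re i : 'rV[R]_N := ebase i - (2 * e 0 i) *: e.
have hRe i : ebase i - Re i = (2 * e 0 i) *: e by rewrite /Re opprB addrC subrK.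
have GG i : Gx i = Gy i.
  have [h _] := test2 _ _ _ (hRe i).
  move: h; rewrite sum_ebase_l.
  rewrite (eq_bigr (fun j => (@ebase R N i) 0 j * Gy j - (2 * e 0 i) * (e 0 j * Gy j))); last first.
    by move=> j _; rewrite !mxE; ring.
  rewrite sumrB -mulr_sumr sum_ebase_l Gye -/L; clear; lra.
(* Moving [x] along [ebase i] and [y] along [Re i] changes the distance at rate [2 e_i]. The squares
   of these rates sum to 4, whence [16 m k^2], against a time derivative of at most [2 m k^2]. *)
have HH : \sum_i Hx i i - \sum_i Hy i i + 16 * m * k ^+ 2 <= 0.
  have h i : Hx i i - \sum_j \sum_l (Re i) 0 j * (Re i) 0 l * Hy j l + 16 * m * k ^+ 2 * e 0 i ^+ 2 <= 0.
    have [_] := test2 _ _ _ (hRe i); apply: le_trans.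
    rewrite le_eqVlt; apply/orP; left; apply/eqP; congr (_ - _ + _); last by ring.
    under [RHS]eq_bigr => j _ do (under eq_bigr do rewrite -mulrA; rewrite -mulr_sumr).
    by rewrite sum_ebase_l sum_ebase_l.
  have := ler_sum (index_enum 'I_N) (fun i (_ : true) => h i).
  by rewrite big1_eq big_split /= sumrB refl_trace // -mulr_sumr sum_e2 mulr1.
have dd : - (2 * m / T) <= dx - dy.
  have h : jet1 (fun s => u (t + s) x - u (t + s) y - phi (t + s) r) (dx - dy - - (2 * m / T)).
    have hphi : jet1 (fun s => phi (t + s) r) (- (2 * m / T)).
      apply: (@jet2_jet1 _ _ _ (2 * 0)); apply: jet2_ext (jet2_quad (phi t r) (- (2 * m / T)) 0) => s.
      by rewrite /phi; field; rewrite gt_eqF.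
    have := jet1_lin 1 (-1) (jet1_lin 1 (-1) jx1 jy1) hphi; rewrite !mul1r !mulN1r.
    by under eq_fun do rewrite !mul1r !mulN1r.
  have := jet1_left tp h; rewrite subr_ge0; apply => s /andP[s1 s2].
  rewrite addr0; apply: (mx (t + s, (x, y))) => //=.
  by move: t0' tT' s1 s2; clear => *; apply/andP; split; lra.
have GE : Gx = Gy by apply/funext.
have eqd : dx - dy = \sum_i Hx i i - \sum_i Hy i i by move: jx3 jy3; rewrite GE; clear; lra.
have kT2 : 2 * m / T <= 2 * m * k ^+ 2.
  by rewrite ler_pdivrMr //; have := ler_wpM2l (ltW m0) kT; rewrite mulr1; clear; lra.
have : 0 < m * k ^+ 2 by rewrite mulr_gt0 // exprn_gt0.
move: HH dd eqd kT2; clear; lra.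
Qed.

(** The one-sided bound is tested in the direction of the gradient itself. *)
Lemma grad_bound (f : 'rV[R]_N -> R) x (G : 'I_N -> R) (L q : R) : 0 <= L -> 0 < q ->
  (forall v, jet1 (fun s => f (x + s *: v)) (\sum_i v 0 i * G i)) ->
  (forall y, en (y - x) <= q -> f y - f x <= L * en (y - x)) -> enorm G <= L.
Proof.
move=> L0 q0 hG hL; have [->//|g0] := eqVneq (enorm G) 0.
have gp : 0 < enorm G by rewrite lt_neqAle eq_sym g0 enorm_ge0.
pose v : 'rV[R]_N := \row_i G i.
have nv : en v = enorm G by congr enorm; apply/funext => i; rewrite mxE.
rewrite leNgt; apply/negP => LG.
have e0 : 0 < (enorm G - L) * enorm G / 2 by rewrite divr_gt0 // mulr_gt0 // subr_gt0.
have [d d0 hd] := hG v _ e0.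
pose s := Num.min (d / 2) (q / enorm G).
have s0 : 0 < s by rewrite lt_min !divr_gt0.
have sd : `|s| < d.
  rewrite gtr0_norm //; apply: (@le_lt_trans _ _ (d / 2)); last lra.
  by rewrite ge_min lexx.
have sq : s * enorm G <= q.
  by rewrite -ler_pdivlMr // ge_min lexx orbT.
have := hd s sd; rewrite scale0r addr0 (gtr0_norm s0) ler_norml => /andP[h1 _].
have := hL (x + s *: v); rewrite addrAC subrr add0r enZ nv (gtr0_norm s0) => /(_ sq) h2.
have h3 : \sum_i v 0 i * G i = enorm G ^+ 2.
  by rewrite enorm_sqr; apply: eq_bigr => i _; rewrite mxE expr2.
rewrite h3 in h1.
have : 0 < (enorm G - L) * enorm G * s by rewrite mulr_gt0 // mulr_gt0 // subr_gt0.
move: h1 h2; rewrite !mulrBl; set X := f _; set Y := f x.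
move: (s) (enorm G) => z w; rewrite expr2; lra.
Qed.

End TwoPoint.

(** * Gradient estimate and the supersolution built from [psi] *)

Section Gradient.
Context {R : realType} {N : nat}.
Implicit Types (x y v : 'rV[R]_N) (D Omega : set 'rV[R]_N) (u w : R -> 'rV[R]_N -> R).

Lemma abs_decay Omega a p u : (0 < N)%N -> open Omega -> bounded_set Omega -> 1 < p ->
  @sol R N Omega a p u ->
  exists S dl, [/\ 0 < S, 0 < dl & forall t x, 0 <= t -> Omega x -> `|u t x| <= S * expR (- dl * t)].
Proof.
move=> N0 oO bO p1 su.
have [S1 [d1 [S10 d10 h1]]] := initial_decay N0 oO bO p1 su.
have [S2 [d2 [S20 d20 h2]]] := initial_decay N0 oO bO p1 (sol_opp su).
exists (S1 + S2), (Num.min d1 d2); split; [exact: addr_gt0 | by rewrite lt_min d10 |].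
move=> t x t0 Ox.
have e1 : expR (- d1 * t) <= expR (- Num.min d1 d2 * t).
  by rewrite ler_expR ler_wpM2r // lerN2 ge_min lexx.
have e2 : expR (- d2 * t) <= expR (- Num.min d1 d2 * t).
  by rewrite ler_expR ler_wpM2r // lerN2 ge_min lexx orbT.
have f1 := le_trans (h1 t x t0 Ox) (ler_wpM2l (ltW S10) e1).
have f2 := le_trans (h2 t x t0 Ox) (ler_wpM2l (ltW S20) e2).
have g1 : 0 <= S1 * expR (- Num.min d1 d2 * t) by rewrite mulr_ge0 ?expR_ge0 // ltW.
have g2 : 0 <= S2 * expR (- Num.min d1 d2 * t) by rewrite mulr_ge0 ?expR_ge0 // ltW.
rewrite ler_norml mulrDl; apply/andP; split; move: f1 f2 g1 g2; clear; lra.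
Qed.

Lemma exp_small (S d e : R) : 0 < S -> 0 < d -> 0 < e ->
  exists2 T : R, 0 <= T & forall t, T <= t -> S * expR (- d * t) <= e.
Proof.
move=> S0 d0 e0; exists (S / (e * d)); first by rewrite divr_ge0 ?mulr_ge0 // ltW.
move=> t; rewrite ler_pdivrMr ?mulr_gt0 // => h.
have t0 : 0 < d * t.
  have : 0 < t * (e * d) by apply: lt_le_trans h.
  by rewrite mulrCA pmulr_rgt0 // mulrC.
rewrite mulNr expRN ler_pdivrMr ?expR_gt0 //.
have h1 := expR_ge1Dx (d * t).
have : e * (d * t) <= e * expR (d * t) by rewrite ler_pM2l //; move: h1; clear; lra.
move: h; clear; lra.
Qed.

(** One layer serves all times: large times are covered by the decay, bounded times by compactness.
    The barrier can thus be started at any time. *)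
Lemma small_near_bdry Omega a p u rho g H eps : (0 < N)%N -> open Omega -> bounded_set Omega ->
  1 < p -> sol Omega a p u -> dfun Omega rho g H -> 0 < eps ->
  exists2 dl : R, 0 < dl & forall t x, 0 <= t -> Omega x -> rho x <= dl -> `|u t x| <= eps.
Proof.
move=> N0 oO bO p1 su [[cr _ _ _] rpos rbd _] e0.
have [S [d [S0 d0 hS]]] := abs_decay N0 oO bO p1 su.
have [T T0 hT] := exp_small S0 d0 e0.
apply: contrapT => h.
have /choice[z hz] : forall n : nat, exists z : R * 'rV[R]_N,
    [/\ 0 <= z.1 <= T, Omega z.2, rho z.2 <= n.+1%:R^-1 & eps < `|u z.1 z.2|].
  move=> n; apply: contrapT => hn; apply: h; exists n.+1%:R^-1; first by rewrite invr_gt0.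
  move=> t x t0 Ox rx; have [tT|Tt] := leP t T; last first.
    exact: le_trans (hS t x t0 Ox) (hT _ (ltW Tt)).
  rewrite leNgt; apply/negP => eu; apply: hn; exists (t, x); split => //=.
  by rewrite t0.
have zT n : 0 <= (z n).1 <= T by have [] := hz n.
have zO n : Omega (z n).2 by have [] := hz n.
have zc n : closure Omega (z n).2 by apply: subset_closure.
have [M hM] := bounded_setP bO.
have [t ht] : exists l : R, (fun n => (z n).1) @ Uf --> l.
  apply: (@Uf_bounded _ _ T); apply: nearW => n; have /andP[t0 tT] := zT n.
  by rewrite ger0_norm.
have [x hx] : exists l : 'rV[R]_N, (fun n => (z n).2) @ Uf --> l.
  by apply: (@Uf_bounded_rV _ _ _ M); apply: nearW => n; apply: hM.
have tT : 0 <= t <= T.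
  apply/andP; split.
    by apply: cvgr_to_ge ht _; apply: nearW => n; have /andP[] := zT n.
  by apply: cvgr_to_le ht _; apply: nearW => n; have /andP[] := zT n.
have cx : closure Omega x by apply: closure_Uf hx _; apply: nearW.
have rx : rho x <= 0.
  apply: ler_cvg_to (cvg_comp _ _ hx (cr x)) (@Uf_inv R) _.
  by apply: nearW => n /=; have [] := hz n.
have bx : bdry Omega x.
  by rewrite bdry_open //; split=> // /rpos; rewrite ltNge rx.
have := sol_cont su tT cx zT zc ht hx; have /andP[t0 _] := tT.
rewrite (sol_bd su t0 bx) => /cvgrPdist_lt/(_ eps e0) hu.
have [n] := Uf_ex hu; rewrite sub0r normrN ltNge => /negP; apply.
by have [_ _ _ /ltW] := hz n.
Qed.

(** The barrier bounds [u] linearly in [rho] near the boundary, which is the hypothesis [hb] of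
    [two_point]; at time [T] the resulting modulus of continuity has slope [4 m kap], with [kap] of
    order [1 / sqrt T]. The constant is independent of [tau] and [m], so a decay of [u] passes to
    its gradient. *)
Lemma grad_estimate Omega a p u rho g H : (0 < N)%N -> open Omega -> bounded_set Omega ->
  1 < p <= 2 -> sol Omega a p u -> dfun Omega rho g H ->
  exists2 C : R, 0 < C & forall tau m, 0 <= tau -> 0 < m ->
    (forall t x, tau <= t -> Omega x -> `|u t x| <= m) ->
    forall T x (G : 'I_N -> R), 0 < T <= 1 -> Omega x ->
    (forall v, jet1 (fun s => u (tau + T) (x + s *: v)) (\sum_i v 0 i * G i)) ->
    enorm G <= C * m / Num.sqrt T.
Proof.
move=> N0 oO bO hp su dO.
have p1 : 1 < p by have /andP[] := hp.
have [eps0 [k0 [e0 k00 hbar]]] := barrier oO bO dO hp (normr_ge0 a).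
have [dl dl0 hdl] := small_near_bdry N0 oO bO p1 su dO e0.
have [c [L [dl' [c0 L0 _ _ [_ hL]]]]] := dfun_bounds bO dO.
have [_ rpos _ _] := dO.
(* With [dl^-1], the layer [th rho <= 1] lies in [rho <= dl], where [|u| <= eps0]. *)
pose k := k0 + dl^-1 + 1.
have di0 : 0 < dl^-1 by rewrite invr_gt0.
have k1 : 1 <= k by rewrite /k; move: k00 di0; clear; lra.
have kk0 : k0 <= k by rewrite /k; move: di0; clear; lra.
exists (4 * (k * (L + 1))).
  by rewrite !mulr_gt0 //; move: k1 L0; clear; lra.
move=> tau m tau0 m0 hm T x G /andP[T0 T1] Ox hG.
pose q := Num.sqrt T.
have q0 : 0 < q by rewrite sqrtr_gt0.
have q2 : q ^+ 2 = T by rewrite sqr_sqrtr // ltW.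
have q1 : q <= 1 by rewrite -(@ler_pXn2r _ 2) ?nnegrE ?(ltW q0) // q2 expr1n.
(* Parabolic scaling: [th^2 T = k^2], as the barrier requires. *)
pose th := k / q.
have th0 : 0 < th by rewrite divr_gt0 //; move: k1; clear; lra.
have kth : k <= th by rewrite ler_pdivlMr // ler_piMr //; move: k1; clear; lra.
have thT : th ^+ 2 * T = k ^+ 2 by rewrite -q2 -exprMn /th divfK // gt_eqF.
(* The barrier accepts levels up to [eps0] only; the minimum with [m] keeps the final estimate
   proportional to [m]. *)
pose mb := Num.min m eps0.
have mb0 : 0 < mb by rewrite lt_min m0.
have mbm : mb <= m by rewrite ge_min lexx.
pose w t y := u (tau + t) y.
have sw : sol Omega a p w by apply: sol_shift.
have swN := sol_opp sw.
have hmb t y : 0 <= t <= T -> Omega y -> th * rho y <= 1 -> `|w t y| <= mb.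
  move=> /andP[t0 _] Oy ty; rewrite le_min; apply/andP; split.
    by apply: hm => //; rewrite lerDl.
  apply: hdl => //; first exact: addr_ge0.
  have r0 := rpos y Oy.
  have : rho y <= k^-1.
    rewrite -[k^-1]mul1r ler_pdivlMr //; last by move: k1; clear; lra.
    rewrite mulrC; apply: le_trans ty; rewrite ler_wpM2r // ltW //.
  move/le_trans; apply; rewrite -[dl]invrK lef_pV2 ?posrE //; last by move: k1; clear; lra.
  by rewrite /k; move: k00; clear; lra.
have bar t y : 0 <= t <= T -> Omega y -> th * rho y < 1 ->
    `|w t y| <= mb * (2 * (th * rho y) - (th * rho y) ^+ 2 + (1 - t / T)).
  move=> tT Oy ty.
  have mbe : 0 < mb <= eps0 by rewrite mb0 ge_min lexx orbT.
  have kk : k0 <= th by apply: le_trans kth.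
  have kkT : k0 ^+ 2 <= th ^+ 2 * T.
    by rewrite thT lerXn2r ?nnegrE ?(ltW k00) //; move: k1; clear; lra.
  rewrite ler_norml lerNl; apply/andP; split.
    apply: (hbar (- a) (fun t y => - w t y) mb T th) => //; first by rewrite normrN.
    by move=> t2 y2 h1 h2 h3; apply: le_trans (ler_norm _) _; rewrite normrN; apply: hmb h1 h2 h3.
  apply: (hbar a w mb T th) => //.
  by move=> t' y' h1 h2 h3; apply: le_trans (ler_norm _) (hmb _ _ h1 h2 h3).
(* [rho] is at most [L] times the distance to any boundary point, so [kap] converts the barrier,
   written in [rho], into a bound in terms of [en (y - z)]. *)
pose kap := th * (L + 1).
have kap0 : 0 < kap by rewrite mulr_gt0 //; move: L0; clear; lra.
have hb t y z : 0 <= t <= T -> Omega y -> bdry Omega z ->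
    `|w t y| <= m * (2 * (kap * en (y - z)) + (1 - t / T)).
  move=> tT Oy bz; have /andP[t0 tT'] := tT.
  have tT0 : 0 <= 1 - t / T by rewrite subr_ge0 ler_pdivrMr // mul1r.
  have sk : th * rho y <= kap * en (y - z).
    rewrite /kap -mulrA ler_pM2l //; apply: le_trans (hL y z Oy bz) _.
    by rewrite ler_wpM2r ?enorm_ge0 // lerDl.
  have [s1|s1] := ltP (th * rho y) 1.
    apply: le_trans (bar t y tT Oy s1) _; apply: ler_pM => //; first exact: ltW.
      have := mulr_gt0 th0 (rpos y Oy); move: s1 tT0; clear; move: (th * _) => s; nra.
    have := sqr_ge0 (th * rho y); move: sk; clear; lra.
  apply: le_trans (hm (tau + t) y _ Oy) _; first by rewrite lerDl.
  rewrite -[leLHS]mulr1 ler_pM2l //; move: s1 sk tT0; clear; lra.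
have hmw t y : 0 <= t <= T -> Omega y -> `|w t y| <= m.
  by move=> /andP[t0 _] Oy; apply: hm => //; rewrite lerDl.
have kT : 1 <= kap ^+ 2 * T.
  rewrite /kap exprMn mulrAC thT -exprMn expr_ge1 //; first by move: k1 L0; clear; nra.
  by move: k1 L0; clear; nra.
have tp := two_point oO bO sw T0 m0 kap0 kT hmw hb.
have [r r0 hr] := open_ball oO Ox.
apply: (@grad_bound R N (w T) x G _ (Num.min kap^-1 (r / 2)) _ _ hG).
- by rewrite divr_ge0 ?(ltW q0) // !mulr_ge0 ?(ltW m0) //; move: k1 L0; clear; lra.
- by rewrite lt_min invr_gt0 kap0 divr_gt0.
move=> y; rewrite le_min => /andP[y1 y2].
have Oy : Omega y.
  apply: hr; apply: le_lt_trans (norm_le_enorm _) _; rewrite -/(en (y - x)).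
  by apply: le_lt_trans y2 _; move: r0; clear; lra.
have ky : kap * en (y - x) <= 1.
  by rewrite -[leRHS](mulfV (lt0r_neq0 kap0)) ler_pM2l.
have TT : 0 <= T <= T by rewrite lexx ltW.
apply: le_trans (tp T y x TT Oy Ox ky) _.
rewrite mulfV ?gt_eqF // subrr addr0.
rewrite (_ : 4 * (k * (L + 1)) * m / Num.sqrt T = 4 * m * kap); last first.
  by rewrite /kap /th -/q; ring.
have := mulr_ge0 (ltW m0) (sqr_ge0 (kap * en (y - x))); clear; lra.
Qed.

(* No boundary values are prescribed: only the interior inequality and
   positivity are used. *)
Definition psi_super Omega (l : R) (psi : 'rV[R]_N -> R) : Prop :=
  [/\ forall x (xn : nat -> 'rV[R]_N), Omega x -> xn @ Uf --> x ->
        (fun n => psi (xn n)) @ Uf --> psi x,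
      forall x, Omega x -> 0 < psi x <= 1 &
      forall x, Omega x -> exists g H : 'I_N -> R,
        (forall i, jet2 (fun s => psi (x + s *: ebase i)) (g i) (H i)) /\
        l * psi x <= - \sum_i H i].

Lemma psi_lower Omega l psi rho g H dl : open Omega -> bounded_set Omega ->
  psi_super Omega l psi -> dfun Omega rho g H -> 0 < dl ->
  exists2 c : R, 0 < c & forall x, Omega x -> dl <= rho x -> c <= psi x.
Proof.
move=> oO bO [pc pp _] [[cr _ _ _] rpos rbd _] dl0.
apply: contrapT => h.
have /choice[z hz] : forall n : nat, exists z, [/\ Omega z, dl <= rho z & psi z <= n.+1%:R^-1].
  move=> n; apply: contrapT => hn; apply: h; exists n.+1%:R^-1; first by rewrite invr_gt0.
  move=> x Ox dx; rewrite leNgt; apply/negP => px; apply: hn; exists x; split=> //.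
  exact: ltW.
have [M hM] := bounded_setP bO.
have [x hx] : exists l : 'rV[R]_N, z @ Uf --> l.
  by apply: (@Uf_bounded_rV _ _ _ M); apply: nearW => n; apply: hM; have [] := hz n.
have cx : closure Omega x by apply: closure_Uf hx _; apply: nearW => n; have [] := hz n.
have rx : dl <= rho x.
  by apply: cvgr_to_ge (cvg_comp _ _ hx (cr x)) _; apply: nearW => n /=; have [] := hz n.
have Ox : Omega x.
  apply: contrapT => nOx; have bx : bdry Omega x by rewrite bdry_open.
  by move: rx; rewrite rbd // leNgt dl0.
have : psi x <= 0.
  apply: ler_cvg_to (pc x z Ox hx) (@Uf_inv R) _.
  by apply: nearW => n; have [] := hz n.
by have /andP[p0 _] := pp x Ox; rewrite leNgt p0.
Qed.

Definition exp_decay Omega u (d : R) := exists2 C : R, 0 < C &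
  forall t x, 0 <= t -> Omega x -> `|u t x| <= C * expR (- d * t).

(* Supersolution [A e^(-d' t) (2 B psi + e^(-kap t) (h - B psi))], [h = 1 - M rho^2]:
   [psi] controls the interior and [h] the boundary layer, where psi may degenerate. *)
Lemma decay_half Omega a p u l psi rho g H d d' C0 : (0 < N)%N -> open Omega -> bounded_set Omega ->
  1 < p <= 2 -> sol Omega a p u -> dfun Omega rho g H -> psi_super Omega l psi ->
  0 < d -> 0 < d' <= l -> d' < p * d -> 0 < C0 ->
  (forall t x (G : 'I_N -> R), 0 < t -> Omega x ->
    (forall v, jet1 (fun s => u t (x + s *: v)) (\sum_i v 0 i * G i)) ->
    enorm G <= C0 * expR (- d * t)) ->
  exists2 C : R, 0 < C & forall t x, 0 <= t -> Omega x -> u t x <= C * expR (- d' * t).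
Proof.
move=> N0 oO bO hp su dO ps d0 /andP[d'0 d'l] d'p C00 hG.
have /andP[p1 p2] := hp.
have [c [L [dl [c0 L0 dl0 hC [hc _]]]]] := dfun_bounds bO dO.
have [h0 rpos rbd _] := dO; have [cr cg cH _] := h0.
have [pc pp pj] := ps.
pose E := p * d; pose kap := E - d'.
have kap0 : 0 < kap by rewrite subr_gt0.
have E0 : 0 < E by rewrite mulr_gt0 //; move: p1; clear; lra.
(* Near the boundary [- Lap h >= 2 M (c - c / 2) = E + 2], which beats the loss [E h] due to the
   time derivative. *)
pose M := (E + 2) / c.
have M0 : 0 < M by rewrite divr_gt0 //; move: E0; clear; lra.
have Mc : M * c = E + 2 by rewrite /M divfK // gt_eqF.
clearbody M.
pose d1 := Num.min (Num.min dl (c / (2 * L))) (Num.min 1 (2 * M)^-1).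
have d10 : 0 < d1.
  by rewrite !lt_min dl0 divr_gt0 ?mulr_gt0 // ltr01 invr_gt0 mulr_gt0.
have [d1a d1b d1c d1d] : [/\ d1 <= dl, d1 * L <= c / 2, d1 <= 1 & M * d1 <= 1 / 2].
  have h1 : d1 <= Num.min dl (c / (2 * L)) by rewrite ge_min lexx.
  have h2 : d1 <= Num.min 1 (2 * M)^-1 by rewrite ge_min lexx orbT.
  have := h1; have := h2; rewrite !le_min => /andP[h3 h4] /andP[h5 h6]; split=> //.
    have h7 : d1 * (2 * L) <= c by rewrite -ler_pdivlMr ?mulr_gt0.
    by move: h7; clear; lra.
  have MM : 0 < 2 * M by rewrite mulr_gt0.
  have h7 : d1 * (2 * M) <= 1 by have := ler_wpM2r (ltW MM) h4; rewrite (mulVf (lt0r_neq0 MM)).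
  by move: h7; clear; lra.
have [cp cp0 hcp] := psi_lower oO bO ps dO d10.
pose h x := 1 - M * rho x ^+ 2.
have ch : continuous h by apply: contB; [exact: contC | apply: contZ; apply: cont_sqr].
(* Away from the boundary [psi >= cp]: the second summand lets [kap B psi] dominate there, the third
   makes [B psi + h] large enough at time 0. *)
pose B := 1 + (1 + 2 * M * L ^+ 2 + E) / (kap * cp) + (M * L ^+ 2 + 1) / cp.
have ML : 0 <= M * L ^+ 2 by rewrite mulr_ge0 ?sqr_ge0 // ltW.
have b1 : 0 <= (1 + 2 * M * L ^+ 2 + E) / (kap * cp).
  by rewrite divr_ge0 ?mulr_ge0 ?(ltW kap0) ?(ltW cp0) //; move: ML E0; clear; lra.
have b2 : 0 <= (M * L ^+ 2 + 1) / cp.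
  by rewrite divr_ge0 ?(ltW cp0) //; move: ML; clear; lra.
have B1 : 1 <= B by rewrite /B; move: b1 b2; clear; lra.
have B0 : 0 < B by move: B1; clear; lra.
have Bcp1 : 1 + 2 * M * L ^+ 2 + E <= kap * (B * cp).
  rewrite (_ : kap * (B * cp) = B * (kap * cp)); last by ring.
  by rewrite -ler_pdivrMr ?mulr_gt0 // /B; move: b2; clear; lra.
have Bcp2 : M * L ^+ 2 + 1 <= B * cp.
  by rewrite -ler_pdivrMr // /B; move: b1; clear; lra.
clearbody B.
have hrho2 x : Omega x -> rho x ^+ 2 <= L ^+ 2.
  move=> Ox; have [hr _ _] := hC x Ox; rewrite -[rho x ^+ 2]real_normK ?num_real //.
  by rewrite lerXn2r ?nnegrE // ltW.
have hge x : Omega x -> 1 - M * L ^+ 2 <= h x.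
  by move=> /hrho2 hr; rewrite /h lerD2l lerN2 ler_pM2l.
have hle x : h x <= 1 by rewrite /h gerBl mulr_ge0 ?sqr_ge0 // ltW.
have start x : Omega x -> 1 / 2 <= B * psi x + h x.
  move=> Ox; have /andP[px0 _] := pp x Ox.
  have [rd|rd] := ltP (rho x) d1.
    have : 0 <= B * psi x by rewrite mulr_ge0 // ltW.
    have r0 := rpos x Ox.
    have : M * rho x ^+ 2 <= M * d1.
      by rewrite ler_pM2l // expr2; move: r0 rd d1c; clear; nra.
    rewrite /h; move: d1d; clear; lra.
  have : B * cp <= B * psi x by rewrite ler_pM2l // hcp.
  by have := hge x Ox; move: Bcp2; clear; lra.
(* By [- Lap psi >= l psi] and [d' <= l], the terms in [al] of [w_t - Lap w] add up to something
   nonnegative; what remains is this expression times [be t]. *)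
have strict x : Omega x -> 1 <= kap * (B * psi x) - E * h x +
    2 * M * (\sum_i g i x ^+ 2 + rho x * \sum_i H i x).
  move=> Ox; have /andP[px0 _] := pp x Ox; have [hr hg hH] := hC x Ox.
  have r0 := rpos x Ox; have Eh : E * h x <= E by rewrite -[leRHS]mulr1 ler_pM2l.
  have [rd|rd] := ltP (rho x) d1.
    have : 0 <= kap * (B * psi x) by rewrite !mulr_ge0 ?(ltW kap0) // ltW.
    have gc : c <= \sum_i g i x ^+ 2 by apply: hc => //; apply: lt_le_trans rd _.
    have rH : `|rho x * \sum_i H i x| <= d1 * L.
      by rewrite normrM ler_pM // gtr0_norm // ltW.
    move: rH; rewrite ler_norml => /andP[rH _].
    have : 2 * M * (c - d1 * L) <= 2 * M * (\sum_i g i x ^+ 2 + rho x * \sum_i H i x).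
      by rewrite ler_pM2l ?mulr_gt0 //; move: gc rH; clear; lra.
    have : M * (d1 * L) <= M * (c / 2) by rewrite ler_pM2l.
    move: Mc Eh; clear; lra.
  have h1 : kap * (B * cp) <= kap * (B * psi x) by rewrite !ler_pM2l // hcp.
  have g0 : 0 <= \sum_i g i x ^+ 2 by apply: sumr_ge0 => i _; apply: sqr_ge0.
  have rH : `|rho x * \sum_i H i x| <= L * L by rewrite normrM ler_pM.
  move: rH; rewrite ler_norml => /andP[rH _].
  have : 2 * M * (- (L * L)) <= 2 * M * (\sum_i g i x ^+ 2 + rho x * \sum_i H i x).
    by rewrite ler_pM2l ?mulr_gt0 //; move: g0 rH; clear; lra.
  move: h1 Bcp1 Eh; rewrite expr2; clear; lra.
have [S S0 hS] := sol_bounded 0 bO su.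
(* [2 S] handles the initial values, since [B psi + h >= 1 / 2]; [|a| C0^p] is the size of the
   source; the 1 makes the inequality strict. *)
pose A := 2 * S + `|a| * C0 `^ p + 1.
have aC0 : 0 <= `|a| * C0 `^ p by rewrite mulr_ge0 // powR_ge0.
have A0 : 0 < A by rewrite /A; move: S0 aC0; clear; lra.
exists (A * (2 * B + 1)); first by rewrite mulr_gt0 //; move: B0; clear; lra.
pose al (t : R) := A * expR (- d' * t).
pose be (t : R) := A * expR (- E * t).
have al0 t : 0 < al t by rewrite mulr_gt0 ?expR_gt0.
have be0 t : 0 < be t by rewrite mulr_gt0 ?expR_gt0.
have beal t : 0 <= t -> be t <= al t.
  move=> t0; rewrite ler_pM2l // ler_expR ler_wpM2r // lerN2 /E ltW //.
have cal : continuous al by apply: contZ; apply: cont_exp.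
have cbe : continuous be by apply: contZ; apply: cont_exp.
pose w t x := (2 * B * al t - B * be t) * psi x + be t * h x.
have wpos t x : 0 <= t -> Omega x -> be t * h x <= w t x.
  move=> t0 Ox; rewrite /w lerDr; have /andP[px0 _] := pp x Ox.
  apply: mulr_ge0; last exact: ltW.
  have := ler_wpM2l (ltW B0) (beal t t0); have := mulr_gt0 B0 (al0 t); clear; lra.
suff H1 : forall T t x, 0 <= t <= T -> Omega x -> u t x <= w t x.
  move=> t x t0 Ox; apply: le_trans (H1 t t x _ Ox) _; first by rewrite t0 lexx.
  have /andP[px0 px1] := pp x Ox.
  rewrite (_ : A * (2 * B + 1) * expR (- d' * t) = 2 * B * al t + al t); last first.
    by rewrite /al; ring.
  rewrite /w; apply: lerD.
    apply: (@le_trans _ _ ((2 * B * al t) * psi x)).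
      by rewrite ler_wpM2r ?(ltW px0) // gerBl mulr_ge0 // ltW.
    by rewrite ler_piMr // mulr_ge0 ?mulr_ge0 // ltW.
  apply: le_trans (beal t t0); rewrite -[leRHS]mulr1.
  by apply: ler_wpM2l; [exact: ltW | exact: hle].
have bcoef (t : R) : 0 <= t -> 0 <= 2 * B * al t - B * be t.
  move=> t0; have := ler_wpM2l (ltW B0) (beal t t0); have := mulr_gt0 B0 (al0 t); clear; lra.
move=> T; apply: (comparison oO oO (fun x h => h) bO su).
- move=> t x tn xn tT Ox tnT xnO ht hx; apply: cvgD.
    apply: cvgM; last exact: pc.
    by apply: cvgB; (apply: cvgM; [exact: cvg_cst |]); [exact: (cvg_comp _ _ ht (cal t)) | exact: (cvg_comp _ _ ht (cbe t))].
  apply: cvgM; first exact: (cvg_comp _ _ ht (cbe t)).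
  exact: (cvg_comp _ _ hx (ch x)).
(* [psi] may have no limit at the boundary, but its coefficient is nonnegative and [h] tends to 1,
   so [w] is positive nearby while [u] tends to 0. *)
- move=> t x tn xn tT cx nOx tnT xnO ht hx e e0.
  have bx : bdry Omega x by rewrite bdry_open.
  have /andP[t0 _] := tT.
  have := sol_cont su tT cx tnT (fun n => subset_closure (xnO n)) ht hx.
  rewrite (sol_bd su t0 bx) => /cvgrPdist_lt/(_ e e0) hu.
  have hx1 : h x = 1 by rewrite /h rbd // expr0n mulr0 subr0.
  have : (fun n => h (xn n)) @ Uf --> h x by exact: (cvg_comp _ _ hx (ch x)).
  rewrite hx1 => /cvgrPdist_lt/(_ 1 ltr01) hh.
  apply: filterS (filterI hu hh) => n [].
  rewrite sub0r normrN !ltr_norml => /andP[_ un] /andP[_ hn].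
  have tn0 : 0 <= tn n by have /andP[] := tnT n.
  have := wpos (tn n) (xn n) tn0 (xnO n).
  have : 0 < be (tn n) * h (xn n) by rewrite mulr_gt0 //; move: hn; clear; lra.
  move: un; clear; lra.
- move=> x Ox; rewrite /w /al /be !mulr0 expR0 !mulr1.
  rewrite (_ : _ + _ = A * (B * psi x + h x)); last by ring.
  have := hS 0 x _ (subset_closure Ox); rewrite lexx => /(_ isT) h2.
  have := start x Ox => h3.
  have : A * (1 / 2) <= A * (B * psi x + h x) by rewrite ler_pM2l.
  have := le_trans (ler_norm _) h2; rewrite {1}/A; move: aC0; clear; lra.
- move=> t x /andP[t0 _] Ox.
  have [gp [Hp [jp hp']]] := pj x Ox.
  exists ((2 * B * (- d' * al t) - B * (- E * be t)) * psi x + (- E * be t) * h x),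
    (fun i => (2 * B * al t - B * be t) * gp i + be t * (- M * (2 * rho x * g i x))),
    (fun i => (2 * B * al t - B * be t) * Hp i + be t * (- M * (2 * g i x ^+ 2 + 2 * rho x * H i x))).
  split.
    split.
      have j1 : jet1 (fun s => al (t + s)) (- d' * al t).
        by rewrite /al mulrCA; apply: jet1Z; apply: jet1_exp.
      have j2 : jet1 (fun s => be (t + s)) (- E * be t).
        by rewrite /be mulrCA; apply: jet1Z; apply: jet1_exp.
      have := jet1_lin (2 * B * psi x) (h x - B * psi x) j1 j2.
      rewrite [X in jet1 _ X -> _](_ : _ = (2 * B * (- d' * al t) - B * (- E * be t)) * psi x + - E * be t * h x); last by ring.
      rewrite [X in jet1 X _ -> _](_ : _ = (fun s => w (t + s) x)) //.
      by apply/funext => s; rewrite /w; ring.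
    move=> i; have jr := C3T_jet2 x i h0; have := jet2M jr jr; rewrite /= scale0r addr0 => jr2.
    have := jet2_lin (2 * B * al t - B * be t) (be t) (jp i) (jet2D (jet2_cst 1) (jet2Z (- M) jr2)).
    rewrite !add0r.
    rewrite (_ : g i x * rho x + rho x * g i x = 2 * rho x * g i x); last by ring.
    rewrite (_ : H i x * rho x + 2 * g i x * g i x + rho x * H i x = 2 * g i x ^+ 2 + 2 * rho x * H i x); last by ring.
    by apply: jet2_ext => s; rewrite /w /h; ring.
  move=> jG; have [d2 [G [HH [_ jv _]]]] := sol_jet su t0 Ox.
  have GE : G = (fun i => (2 * B * al t - B * be t) * gp i + be t * (- M * (2 * rho x * g i x))).
    apply/funext => i; apply: jet1_unique (jG i).
    by have := jet2_jet1 (jv (ebase i)); rewrite sum_ebase_l.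
  rewrite -GE.
  (* At the touching point the gradient of [w] is that of [u]: the known decay of [grad u] bounds
     the nonlinear term, whatever the size of [grad psi]. *)
  have nl : a * enorm G `^ p < be t.
    apply: (@le_lt_trans _ _ (`|a| * (C0 * expR (- d * t)) `^ p)).
      apply: nonlin_le; [by move: p1; clear; lra | exact: enorm_ge0 |].
      by apply: hG t0 Ox _ => v; apply: jet2_jet1 (jv v).
    rewrite powRM ?(ltW C00) ?expR_ge0 // -expRM mulrA /be.
    rewrite (_ : - d * t * p = - E * t); last by rewrite /E; ring.
    by rewrite ltr_pM2r ?expR_gt0 // /A; move: S0; clear; lra.
  apply: lt_le_trans nl _.
  rewrite big_split /= -!mulr_sumr big_split /= -!mulr_sumr.
  have q1 : (2 * B * al t - B * be t) * (l * psi x) <= (2 * B * al t - B * be t) * (- \sum_i Hp i).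
    by rewrite ler_wpM2l // bcoef // ltW.
  have q2 : (2 * B * al t - B * be t) * (d' * psi x) <= (2 * B * al t - B * be t) * (l * psi x).
    have /andP[px0 _] := pp x Ox.
    by rewrite ler_wpM2l ?bcoef ?(ltW t0) // ler_wpM2r // ltW.
  have q3 := ler_wpM2l (ltW (be0 t)) (strict x Ox).
  move: q1 q2 q3; rewrite /kap; clear; lra.
Qed.

End Gradient.

(** * Improvement of the decay rate *)

Section Rate.
Context {R : realType} {N : nat}.
Implicit Types (x y v : 'rV[R]_N) (D Omega : set 'rV[R]_N) (u w : R -> 'rV[R]_N -> R).

Lemma exp_decay_le Omega u (d d' : R) : d' <= d -> @exp_decay R N Omega u d -> exp_decay Omega u d'.
Proof.
move=> dd [C C0 h]; exists C => // t x t0 Ox; apply: le_trans (h t x t0 Ox) _.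
by rewrite ler_pM2l // ler_expR ler_wpM2r // lerN2.
Qed.

(** After a shift by one unit of time, the gradient estimate with [T = 1] holds at all positive
    times, as [decay_half] demands; both signs are treated by [sol_opp], and times up to 1 by mere
    boundedness. *)
Lemma exp_decay_step Omega a p u l psi rho g H d d' : (0 < N)%N -> open Omega -> bounded_set Omega ->
  1 < p <= 2 -> sol Omega a p u -> dfun Omega rho g H -> psi_super Omega l psi ->
  0 < d -> 0 < d' <= l -> d' < p * d -> exp_decay Omega u d -> exp_decay Omega u d'.
Proof.
move=> N0 oO bO hp su dO ps d0 d'l d'p [K K0 hK].
have [C C0 hC] := grad_estimate N0 oO bO hp su dO.
pose v t x := u (1 + t) x.
have sv : sol Omega a p v by apply: sol_shift.
have hG t x (G : 'I_N -> R) : 0 < t -> Omega x ->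
    (forall v0, jet1 (fun s => v t (x + s *: v0)) (\sum_i v0 0 i * G i)) ->
    enorm G <= C * K * expR (- d * t).
  move=> t0 Ox hj; rewrite -mulrA.
  rewrite -[leRHS]divr1 -sqrtr1; apply: (hC t (K * expR (- d * t)) (ltW t0) _ _ 1 x G) => //.
  - by rewrite mulr_gt0 ?expR_gt0.
  - move=> s y ts Oy; apply: le_trans (hK s y _ Oy) _; first exact: le_trans (ltW t0) ts.
    by rewrite ler_pM2l // ler_expR !mulNr lerN2 ler_pM2l.
  - by rewrite ltr01 lexx.
  - by move=> v0; have := hj v0; rewrite /v addrC.
have hGN t x (G : 'I_N -> R) : 0 < t -> Omega x ->
    (forall v0, jet1 (fun s => - v t (x + s *: v0)) (\sum_i v0 0 i * G i)) ->
    enorm G <= C * K * expR (- d * t).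
  move=> t0 Ox hj; rewrite (_ : enorm G = enorm (fun i => - G i)).
    apply: (hG t x) => // v0; have := jet1Z (-1) (hj v0).
    rewrite mulN1r -sumrN; under eq_fun do rewrite mulN1r opprK.
    by under eq_bigr do rewrite -mulrN.
  by congr Num.sqrt; apply: eq_bigr => i _; rewrite sqrrN.
have CK0 : 0 < C * K by rewrite mulr_gt0.
have [C1 C10 h1] := decay_half N0 oO bO hp sv dO ps d0 d'l d'p CK0 hG.
have [C2 C20 h2] := decay_half N0 oO bO hp (sol_opp sv) dO ps d0 d'l d'p CK0 hGN.
have [S S0 hS] := sol_bounded 1 bO su.
have [d'0 _] := andP d'l.
have ed : 1 <= expR d' by rewrite -expR0 ler_expR ltW.
exists ((C1 + C2 + S) * expR d'); first by rewrite mulr_gt0 ?expR_gt0 // !addr_gt0.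
move=> t x t0 Ox; rewrite -mulrA -expRD.
have [t1|t1] := leP t 1.
  apply: le_trans (hS t x _ (subset_closure Ox)) _; first by rewrite t0.
  have : 1 <= expR (d' + - d' * t).
    rewrite -expR0 ler_expR; have := ler_wpM2l (ltW d'0) t1; clear; lra.
  by move: C10 C20 S0; clear; nra.
have ee : d' + - d' * t = - d' * (t - 1) by ring.
have s0 : 0 <= t - 1 by rewrite subr_ge0 ltW.
have := h1 (t - 1) x s0 Ox; have := h2 (t - 1) x s0 Ox.
rewrite /v addrC subrK ee; have := expR_gt0 (- d' * (t - 1)).
move: (expR _) => E E0 f1 f2.
have g1 : 0 < C1 * E by rewrite mulr_gt0.
have g2 : 0 < C2 * E by rewrite mulr_gt0.
have g3 : 0 < S * E by rewrite mulr_gt0.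
rewrite ler_norml !mulrDl; apply/andP; split; move: f1 f2 g1 g2 g3; clear; lra.
Qed.

Lemma exp_decay_rate Omega a p u l psi rho g H : (0 < N)%N -> open Omega -> bounded_set Omega ->
  1 < p <= 2 -> sol Omega a p u -> dfun Omega rho g H -> psi_super Omega l psi ->
  0 <= l -> exp_decay Omega u l.
Proof.
move=> N0 oO bO hp su dO ps l0; have /andP[p1 p2] := hp.
have [S [d [S0 d0 hS]]] := abs_decay N0 oO bO p1 su.
have hd : exp_decay Omega u d by exists S.
have [ld|dl] := leP l d; first exact: exp_decay_le hd.
have lp : 0 < l by apply: lt_trans dl.
(* A ratio strictly between 1 and [p]: each step may multiply the rate by [q] and still satisfy the
   strict condition [d' < p * d]. *)
pose q := (1 + p) / 2.
have q1 : 1 < q by rewrite /q; move: p1; clear; lra.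
have qp : q < p by rewrite /q; move: p1; clear; lra.
have step n : exp_decay Omega u (Num.min l (q ^+ n * d)).
  elim: n => [|n IH]; first by apply: exp_decay_le hd; rewrite expr0 mul1r ge_min lexx orbT.
  have qn : 0 < q ^+ n * d by rewrite mulr_gt0 // exprn_gt0 //; move: q1; clear; lra.
  have m0 : 0 < Num.min l (q ^+ n * d) by rewrite lt_min lp.
  apply: (exp_decay_step N0 oO bO hp su dO ps m0) => //.
    rewrite lt_min lp ge_min lexx /= mulr_gt0 // exprn_gt0 //; move: q1; clear; lra.
  rewrite exprS -mulrA; move: m0; have [h|h] := leP l (q ^+ n * d) => m0.
    by apply: (@le_lt_trans _ _ l); [rewrite ge_min lexx | rewrite ltr_pMl].
  apply: (@le_lt_trans _ _ (q * (q ^+ n * d))); first by rewrite ge_min lexx orbT.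
  by rewrite ltr_pM2r.
have [n hn] : exists n, l <= q ^+ n * d.
  have q10 : 0 < (q - 1) * d by rewrite mulr_gt0 // subr_gt0.
  exists (Num.truncn (l / ((q - 1) * d))).+1; set n := _.+1.
  have : l / ((q - 1) * d) < n%:R by exact: truncnS_gt.
  rewrite ltr_pdivrMr // => h.
  have bern : 1 + (q - 1) * n%:R <= q ^+ n.
    elim: (n) => [|k IH]; first by rewrite expr0 mulr0 addr0.
    rewrite exprS -natr1; have : 0 <= (q - 1) * k%:R by rewrite mulr_ge0 // subr_ge0 ltW.
    by move: IH q1; clear; nra.
  have := ler_wpM2r (ltW d0) bern; move: h d0; clear; lra.
by have := step n; rewrite min_l.
Qed.

(** Adding [eps t] makes the second solution a strict supersolution without changing its gradient,
    so the nonlinear terms are identical. *)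
Lemma sol_le Omega a p u w : open Omega -> bounded_set Omega ->
  sol Omega a p u -> sol Omega a p w -> (forall x, Omega x -> u 0 x = w 0 x) ->
  forall t x, 0 <= t -> Omega x -> u t x <= w t x.
Proof.
move=> oO bO su sw h0.
suff H1 : forall eps : R, 0 < eps -> forall T t x, 0 <= t <= T -> Omega x ->
    u t x <= w t x + eps * t.
  move=> t x t0 Ox; apply/ler_addgt0Pr => e e0.
  have t1 : 0 < t + 1 by rewrite ltr_wpDl.
  have eps0 : 0 < e / (t + 1) by rewrite divr_gt0.
  apply: le_trans (H1 _ eps0 t t x _ Ox) _; first by rewrite t0 lexx.
  by rewrite lerD2l mulrAC ler_pdivrMr // ler_pM2l // lerDl.
move=> eps eps0 T.
have ce : continuous (fun t : R => eps * t) by apply: contZ => z; apply: cvg_id.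
have cw D : cyl_cont T D (fun t _ => eps * t).
  by move=> t x tn xn _ _ _ _ ht _; apply: (cvg_comp _ _ ht (ce t)).
apply: (comparison oO oO (fun x h => h) bO su).
- apply: (@cyl_contD R N T Omega w (fun t _ => eps * t)) => //.
  by apply: (@cyl_cont_sub _ _ T Omega (closure Omega)); [exact: subset_closure | exact: (sol_cont sw)].
- apply: (@usc_of_cont _ _ Omega) => //.
    apply: (@cyl_contB _ _ T (closure Omega) u (fun t x => w t x + eps * t)); first exact: (sol_cont su).
    by apply: (@cyl_contD R N T (closure Omega) w (fun t _ => eps * t)) => //; exact: (sol_cont sw).
  move=> t x /andP[t0 _] cx nOx; have bx : bdry Omega x by rewrite bdry_open.
  by rewrite (sol_bd su t0 bx) (sol_bd sw t0 bx) sub0r oppr_le0 add0r mulr_ge0 // ltW.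
- by move=> x Ox; rewrite mulr0 addr0 h0.
- move=> t x /andP[t0 _] Ox; have [d [G [H [[j1 j2] jeq]]]] := sol_pjet sw t0 Ox.
  exists (d + eps), G, H; split; last by move=> _; rewrite -jeq; move: eps0; clear; lra.
  split.
    have h := jet1_lin 1 1 j1 (jet2_jet1 (jet2_quad (eps * t) eps 0)).
    have -> : (fun s => w (t + s) x + eps * (t + s)) =
      (fun s => 1 * w (t + s) x + 1 * (eps * t + eps * s + 0 * s ^+ 2)).
      by apply/funext => s; ring.
    by move: h; rewrite !mul1r.
  by move=> i; have := jet2D (j2 i) (jet2_cst (eps * t)); rewrite !addr0.
Qed.

Lemma sol_uniq Omega a p u w : open Omega -> bounded_set Omega ->
  sol Omega a p u -> sol Omega a p w -> (forall x, Omega x -> u 0 x = w 0 x) ->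
  forall t x, 0 <= t -> Omega x -> u t x = w t x.
Proof.
move=> oO bO su sw h0 t x t0 Ox; apply/le_anti; apply/andP; split.
  exact: (sol_le oO bO su sw h0).
by apply: (sol_le oO bO sw su) => // y Oy; rewrite h0.
Qed.

End Rate.

Lemma cont_pairl (T U : topologicalType) (t : T) : continuous (fun y : U => (t, y)).
Proof. by move=> y; apply: (@cvg_pair _ _ _ (nbhs y)); [exact: cvg_cst | exact: cvg_id]. Qed.

(** * From classical solutions to the two final estimates, given [psi] *)

Section Classical.
Context {R : realType} {N : nat}.
Implicit Types (x y v : 'rV[R]_N) (D Omega : set 'rV[R]_N) (u w : R -> 'rV[R]_N -> R).

Lemma open_Qcyl Omega : open Omega -> open (@Qcyl R N +oo%E Omega).
Proof.
move=> oO.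
have -> : Qcyl +oo%E Omega = [set z | 0 < z.1] `&` [set z | Omega z.2].
  apply/seteqP; split=> [z [h1 _ h2]|z [h1 h2]]; split=> //=; exact: ltry.
have o1 : open (fst @^-1` [set z : R | 0 < z] : set (R * 'rV[R]_N)).
  by apply: open_comp; [move=> z _; exact: cvg_fst | exact: open_gt].
have o2 : open (snd @^-1` Omega : set (R * 'rV[R]_N)).
  by apply: open_comp; [move=> z _; exact: cvg_snd | exact: oO].
exact: openI o1 o2.
Qed.

Lemma within_slice Omega (F : R * 'rV[R]_N -> R) t x : open Omega ->
  {within Qcyl +oo%E Omega, continuous F} -> 0 < t -> Omega x ->
  {for x, continuous (fun y => F (t, y))}.
Proof.
move=> oO cF t0 Ox; have Q : Qcyl +oo%E Omega (t, x) by split=> //=; exact: ltry.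
have cFx : {for (t, x), continuous F}.
  have := cF; rewrite continuous_open_subspace; last exact: open_Qcyl.
  by move=> /(_ (t, x)); apply; rewrite inE.
by apply: (@continuous_comp _ _ _ (fun y : 'rV[R]_N => (t, y)) F) => //; apply: cont_pairl.
Qed.

(** The boundary condition at [t = 0] comes from [u0], which vanishes on the boundary; joint
    continuity of the derivatives is used only on time slices. *)
Lemma classical_sol Omega a p (u0 : 'rV[R]_N -> R) u : open Omega ->
  C0_closure Omega u0 -> classical_solution +oo%E Omega a p u0 u -> sol Omega a p u.
Proof.
move=> oO [_ hu0] [c1 [c2 [c3 c3'] c4 c5] h0 heq hbd]; split.
- move=> T t x tn xn /andP[t0 _] cx tnT cxn ht hx.
  have /subspace_continuousP h := c1.
  have Q : Qcyl_closure +oo%E Omega (t, x) by split=> //=; exact: ltry.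
  have hz : (fun n => (tn n, xn n)) @ Uf --> within (Qcyl_closure +oo%E Omega) (nbhs (t, x)).
    have hz := @cvg_pair _ _ _ Uf (nbhs t) (nbhs x) _ _ _ tn xn ht hx.
    move=> P hP; have hR : \forall n \near Uf, Qcyl_closure +oo%E Omega (tn n, xn n) -> P (tn n, xn n).
      exact: (hz _ _ _ [set z | Qcyl_closure +oo%E Omega z -> P z] hP).
    have hS : \forall n \near Uf, P (tn n, xn n).
      apply: filterS hR => n; apply; split=> //=; last exact: ltry.
      by have /andP[] := tnT n.
    exact: hS.
  exact: (cvg_comp _ _ hz (h (t, x) Q)).
- move=> t x t0 bx; have [->|tn0] := eqVneq t 0.
    by rewrite h0 ?hu0 //; case: bx.
  by apply: hbd => //; [rewrite lt_neqAle eq_sym tn0 | exact: ltry].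
- move=> t x t0 Ox; have Q : Qcyl +oo%E Omega (t, x) by split=> //=; exact: ltry.
  have [r r0 hr] := open_ball oO Ox.
  have Qy y : `|y - x| < r -> Qcyl +oo%E Omega (t, y) by move=> /hr Oy; split=> //=; exact: ltry.
  exists (dt u t x), (fun i => partial i (u t) x), (fun i j => partial j (partial i (u t)) x).
  split.
  + have /derivableP/is_derive_jet1 := c3 (t, x) Q; rewrite /=.
    by under eq_fun do rewrite /GRing.scale /= mulr1.
  + move=> v; apply: (@C2_jet2 _ _ (u t) (fun i => partial i (u t)) (fun i j => partial j (partial i (u t))) x r v r0).
    * by move=> y i /Qy Qy'; apply: derivableP; apply: (c4 i).1 Qy'.
    * by move=> y i /hr Oy; apply: (within_slice oO (c4 i).2).
    * by move=> y i j /Qy Qy'; apply: derivableP; apply: (c5 i j).1 Qy'.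
    * by move=> i j; apply: (within_slice oO (c5 i j).2).
  + have := heq t x Q; rewrite /laplacian => ->; congr (_ * _ `^ _).
    by congr Num.sqrt; apply: eq_bigr => i _; rewrite mxE.
Qed.

Lemma Linfty_le Omega (f : 'rV[R]_N -> R) (M : R) : (0 < N)%N -> 0 <= M ->
  (forall x, Omega x -> `|f x| <= M) -> (Linfty_norm Omega f <= M%:E)%E.
Proof.
move=> N0 M0 h; apply: ereal_inf_lbound; exists M => //; split=> //.
(* The exceptional set is empty and is covered by degenerate boxes; their volume is 0 because
   [0 < N], an empty product being 1. *)
move=> e e0; exists (fun _ => 0), (fun _ => 0); split.
- by move=> k i; rewrite lexx.
- by move=> x [Ox /=]; rewrite ltNge h.
- rewrite eseries0 ?lee_fin ?(ltW e0) // => k _ _.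
  by rewrite (bigD1 (Ordinal N0)) //= mxE subrr mul0r.
Qed.

(** The constant must be chosen before [u]. It is read off from one solution [w], if there is any,
    and uniqueness transports the estimates to every [u] with the same datum. *)
Lemma decay_of_super Omega (l1 l : R) (p a : R) (u0 : 'rV[R]_N -> R) rho g H psi :
  (0 < N)%N -> open Omega -> bounded_set Omega -> 1 < p <= 2 ->
  C0_closure Omega u0 -> dfun Omega rho g H -> psi_super Omega l psi -> 0 <= l -> l1 <= l ->
  exists2 K : R, 0 < K &
    forall u, classical_solution +oo%E Omega a p u0 u -> forall t : R, 0 < t ->
        (Linfty_norm Omega (u t) <= (K * expR (- (t * l1)))%:E)%E /\
        (Linfty_norm Omega (fun x => euclid_norm (grad (u t) x)) <=
           (K * (1 + t `^ (- 2^-1)) * expR (- (t * l1)))%:E)%E.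
Proof.
move=> N0 oO bO hp hu0 dO ps l0 ll.
have [[w cw]|nex] := pselect (exists w, classical_solution +oo%E Omega a p u0 w); last first.
  by exists 1 => // u cu; exfalso; apply: nex; exists u.
have sw := classical_sol oO hu0 cw.
have [K K0 hK] := exp_decay_le ll (exp_decay_rate N0 oO bO hp sw dO ps l0).
have [C C0 hC] := grad_estimate N0 oO bO hp sw dO.
have [K2 K20 hK2] : exp_decay Omega w l by apply: (exp_decay_rate N0 oO bO hp sw dO ps l0).
(* [expR l] is the loss over one unit of time; it serves both for [t <= 1] and for estimating the
   gradient at [t] from time [t - 1]. *)
pose K' := K2 * (1 + C * expR l).
have CE : 0 < C * expR l by rewrite mulr_gt0 ?expR_gt0.
have K'0 : 0 < K' by rewrite mulr_gt0 //; move: CE; clear; lra.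
have ele t : 0 <= t -> expR (- l * t) <= expR (- (t * l1)).
  by move=> t0; rewrite ler_expR mulNr mulrC lerN2 ler_wpM2l.
exists K' => // u cu t t0.
have su := classical_sol oO hu0 cu.
have uw s x : 0 <= s -> Omega x -> u s x = w s x.
  apply: (sol_uniq oO bO su sw) => y Oy.
  case: cu => _ _ hu _ _; case: cw => _ _ hw _ _.
  by rewrite hu ?hw //; apply: subset_closure.
have ue s x : 0 <= s -> Omega x -> `|u s x| <= K2 * expR (- l * s).
  by move=> s0 Ox; rewrite uw // hK2.
split.
  apply: Linfty_le => //; first by rewrite mulr_ge0 ?expR_ge0 // ltW.
  move=> x Ox; apply: le_trans (ue t x (ltW t0) Ox) _.
  apply: ler_pM; rewrite ?expR_ge0 ?(ltW K20) ?ele ?(ltW t0) //.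
  by rewrite /K' ler_peMr ?(ltW K20) //; move: CE; clear; lra.
have tp0 : 0 <= t `^ (- 2^-1) by apply: powR_ge0.
apply: Linfty_le => //.
  by apply: mulr_ge0 (expR_ge0 _); apply: mulr_ge0 (ltW K'0) _; move: tp0; clear; lra.
move=> x Ox; rewrite ger0_norm ?sqrtr_ge0 //.
have [d [G [H2 [_ jv _]]]] := sol_jet su t0 Ox.
have gG : euclid_norm (grad (u t) x) = enorm G.
  congr Num.sqrt; apply: eq_bigr => i _; congr (_ ^+ 2); rewrite mxE /partial.
  have := jet2_jet1 (jv (ebase i)); rewrite sum_ebase_l => /is_derive_jet1 h.
  exact: derive_val.
have [C' C'0 hC'] : exists2 C', C' = C & forall tau m, 0 <= tau -> 0 < m ->
    (forall t x, tau <= t -> Omega x -> `|u t x| <= m) ->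
    forall T, 0 < T <= 1 -> tau + T = t -> enorm G <= C' * m / Num.sqrt T.
  exists C => // tau m tau0 m0 hm T T1 tT.
  have [d' [G' [H2' [_ jv' _]]]] := sol_jet sw t0 Ox.
  have GG : G = G'.
    apply/funext => i; have h1 := jet2_jet1 (jv (ebase i)); have h2 := jet2_jet1 (jv' (ebase i)).
    rewrite !sum_ebase_l in h1 h2; apply: jet1_unique h1 _.
    move=> e e0; have [q q0 hq] := h2 e e0; have [r r0 hr] := line_in (ebase i) oO Ox.
    exists (Num.min q r); first by rewrite lt_min q0.
    move=> s; rewrite lt_min => /andP[/hq + /hr Os].
    by rewrite !uw ?(ltW t0) // scale0r addr0.
  rewrite GG; apply: (hC tau m tau0 m0 _ T x G' T1 Ox).
    move=> s y ts Oy; rewrite -uw ?hm //; exact: le_trans ts.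
  by move=> v; rewrite tT; apply: jet2_jet1 (jv' v).
rewrite gG; have el : 1 <= expR l by rewrite -expR0 ler_expR.
(* Up to time 1 the gradient estimate starts at time 0 and produces the factor [t^(-1/2)]; later it
   starts one unit of time earlier. *)
have [t1|t1] := leP t 1.
  have := hC' 0 K2 (lexx _) K20 _ t; rewrite t0 t1 add0r => /(_ _ isT erefl) h.
  apply: le_trans (h _) _.
    move=> s y s0 Oy; apply: le_trans (ue s y s0 Oy) _.
    by rewrite ler_piMr ?(ltW K20) // -expR0 ler_expR mulNr oppr_le0 mulr_ge0.
  have -> : t `^ (- 2^-1) = (Num.sqrt t)^-1.
    by rewrite powRN powR12_sqrt // ltW.
  have st0 : 0 < (Num.sqrt t)^-1 by rewrite invr_gt0 sqrtr_gt0.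
  have e1 : 1 <= expR l * expR (- (t * l1)).
    rewrite -expRD -expR0 ler_expR subr_ge0; apply: le_trans (_ : t * l <= _).
      by rewrite ler_pM2l.
    by rewrite ler_piMl.
  rewrite C'0 (_ : K' * _ * _ = (K2 * (1 + (Num.sqrt t)^-1)) * ((1 + C * expR l) * expR (- (t * l1)))); last first.
    by rewrite /K'; ring.
  rewrite (_ : C * K2 / Num.sqrt t = (K2 * (Num.sqrt t)^-1) * C); last by ring.
  apply: ler_pM; rewrite ?mulr_ge0 ?(ltW K20) ?(ltW st0) ?(ltW C0) //.
    by rewrite ler_pM2l // lerDr.
  rewrite mulrDl mul1r; have := expR_gt0 (- (t * l1)).
  have : C * 1 <= C * (expR l * expR (- (t * l1))) by rewrite ler_pM2l.
  by clear; lra.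
have s0 : 0 <= t - 1 by rewrite subr_ge0 ltW.
have := hC' (t - 1) (K2 * expR (- l * (t - 1))) s0 _ _ 1.
rewrite ltr01 lexx subrK sqrtr1 divr1 => /(_ _ _ isT erefl) h.
apply: le_trans (h _ _) _.
- by rewrite mulr_gt0 ?expR_gt0.
- move=> s y ts Oy; apply: le_trans (ue s y (le_trans s0 ts) Oy) _.
  by rewrite ler_pM2l // ler_expR !mulNr lerN2 ler_wpM2l.
rewrite C'0 (_ : - l * (t - 1) = l + - l * t); last by ring.
rewrite expRD (_ : C * _ = K2 * (C * expR l) * expR (- l * t)); last by ring.
apply: ler_pM; rewrite ?expR_ge0 ?ele ?(ltW t0) //.
  by rewrite mulr_ge0 ?(ltW K20) ?(ltW CE).
rewrite /K' -mulrA ler_pM2l //; move: CE tp0; clear; nra.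
Qed.

End Classical.

(** * Defining function of a domain with C3 boundary *)

Section C3TClosure.
Context {R : realType} {N : nat}.
Implicit Types (x y v : 'rV[R]_N) (D Omega : set 'rV[R]_N).

Lemma C3T_lin (f1 f2 : 'rV[R]_N -> R) g1 H1 g2 H2 a b : C3T f1 g1 H1 -> C3T f2 g2 H2 ->
  C3T (fun x => a * f1 x + b * f2 x) (fun i x => a * g1 i x + b * g2 i x)
      (fun i x => a * H1 i x + b * H2 i x).
Proof.
move=> [c1 cg1 cH1 t1] [c2 cg2 cH2 t2]; split.
- by apply: contD; apply: contZ.
- by move=> i; apply: contD; apply: contZ.
- by move=> i; apply: contD; apply: contZ.
- move=> M; have [C1 C10 h1] := t1 M; have [C2 C20 h2] := t2 M.
  exists (`|a| * C1 + `|b| * C2); first by rewrite addr_ge0 // mulr_ge0.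
  move=> x i s xM s1; have f1x := h1 x i s xM s1; have f2x := h2 x i s xM s1.
  rewrite (_ : _ - _ = a * (f1 (x + s *: ebase i) - f1 x - g1 i x * s - H1 i x / 2 * s ^+ 2)
    + b * (f2 (x + s *: ebase i) - f2 x - g2 i x * s - H2 i x / 2 * s ^+ 2)); last by ring.
  apply: le_trans (ler_normD _ _) _.
  rewrite [leRHS]mulrDl (normrM a) (normrM b) -(mulrA _ C1) -(mulrA _ C2).
  by apply: lerD; rewrite ler_wpM2l.
Qed.

Lemma C3T_cst (c : R) : C3T (fun _ : 'rV[R]_N => c) (fun _ _ => 0) (fun _ _ => 0).
Proof.
split; [exact: contC | by move=> i; exact: contC | by move=> i; exact: contC |].
move=> M; exists 0 => // x i s _ _.
by rewrite !mul0r !subr0 subrr normr0.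
Qed.

Lemma C3T_ext (f f' : 'rV[R]_N -> R) g g' H H' : C3T f g H ->
  (forall x, f x = f' x) -> (forall i x, g i x = g' i x) -> (forall i x, H i x = H' i x) ->
  C3T f' g' H'.
Proof.
move=> h e1 e2 e3; have -> : f' = f by apply/funext.
have -> : g' = g by apply/funext => i; apply/funext => x.
by have -> : H' = H by apply/funext => i; apply/funext => x.
Qed.

Definition cubic_taylor (P P' P'' : R -> R) :=
  [/\ continuous P, continuous P', continuous P'' &
   exists2 C : R, 0 <= C & forall y d : R, `|P (y + d) - P y - P' y * d - P'' y / 2 * d ^+ 2| <= C * `|d| ^+ 3].

Lemma cont_comp (T : topologicalType) (f : T -> R) (P : R -> R) :
  continuous f -> continuous P -> continuous (fun z => P (f z)).
Proof. by move=> cf cP z; apply: continuous_comp; [apply: cf | apply: cP]. Qed.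

Lemma C3T_comp P P' P'' (f : 'rV[R]_N -> R) g H : cubic_taylor P P' P'' -> C3T f g H ->
  C3T (fun x => P (f x)) (fun i x => P' (f x) * g i x)
      (fun i x => P' (f x) * H i x + P'' (f x) * g i x ^+ 2).
Proof.
move=> [cP cP' cP'' [CP CP0 hP]] [cf cg cH tf]; split.
- exact: cont_comp.
- by move=> i; apply: contM => //; exact: cont_comp.
- by move=> i; apply: contD; apply: contM; (try exact: cont_comp) => //; apply: cont_sqr.
move=> M; have [C C0 hC] := tf M.
have [A1 A10 hA1] := cont_bounded M (cont_comp cf cP').
have [A2 A20 hA2] := cont_bounded M (cont_comp cf cP'').
have /choice[G0 hG0] : forall i, exists C : R, 0 < C /\ forall x, `|x| <= M -> `|g i x| <= C /\ `|H i x| <= C.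
  move=> i; have [B1 B10 hB1] := cont_bounded M (cg i); have [B2 B20 hB2] := cont_bounded M (cH i).
  exists (B1 + B2); split; first exact: addr_gt0.
  by move=> x xM; have a1 := hB1 x xM; have a2 := hB2 x xM; split; move: a1 a2 B10 B20; clear; lra.
pose G := \sum_i G0 i.
have hG i x : `|x| <= M -> `|g i x| <= G /\ `|H i x| <= G.
  move=> xM; have [_ /(_ x xM)[h1 h2]] := hG0 i.
  have : G0 i <= G by rewrite /G (bigD1 i) //= lerDl sumr_ge0 // => j _; have [/ltW] := hG0 j.
  by move: h1 h2 => h1 h2 h3; split; move: h1 h2 h3; clear; lra.
have GG0 : 0 <= G by apply: sumr_ge0 => j _; have [/ltW] := hG0 j.
pose D := 2 * G + C.
have D0 : 0 <= D by rewrite /D; move: GG0 C0; clear; lra.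
exists (A1 * C + A2 * ((G + C) * (D + G)) + CP * D ^+ 3).
  apply: addr_ge0; last by rewrite mulr_ge0 // exprn_ge0.
  apply: addr_ge0; first by rewrite mulr_ge0 // ltW.
  by apply: mulr_ge0; [exact: ltW | rewrite mulr_ge0 // addr_ge0].
move=> x i s xM s1.
pose d := f (x + s *: ebase i) - f x.
pose r := d - g i x * s - H i x / 2 * s ^+ 2.
have hr : `|r| <= C * `|s| ^+ 3 by exact: hC.
have [hg hH] := hG i x xM.
have s0 := normr_ge0 s.
have s21 : `|s| ^+ 2 <= `|s| by rewrite expr2 ler_piMl.
have s32 : `|s| ^+ 3 <= `|s| ^+ 2 by rewrite exprS ler_piMl // exprn_ge0.
have s20 : 0 <= `|s| ^+ 2 by rewrite exprn_ge0.
have hdgs : `|d - g i x * s| <= (G + C) * `|s| ^+ 2.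
  rewrite (_ : d - _ = H i x / 2 * s ^+ 2 + r); last by rewrite /r; ring.
  apply: le_trans (ler_normD _ _) _; rewrite normrM normrM normrX (ger0_norm (_ : 0 <= 2^-1)) ?invr_ge0 //.
  have h1 : `|H i x| * `|s| ^+ 2 <= G * `|s| ^+ 2 by rewrite ler_wpM2r.
  have h2 : C * `|s| ^+ 3 <= C * `|s| ^+ 2 by rewrite ler_wpM2l.
  have h3 : 0 <= `|H i x| * `|s| ^+ 2 by rewrite mulr_ge0.
  by move: hr h1 h2 h3; clear; lra.
have hgs : `|g i x * s| <= G * `|s| by rewrite normrM ler_wpM2r.
have hd : `|d| <= D * `|s|.
  rewrite (_ : d = (d - g i x * s) + g i x * s); last by ring.
  apply: le_trans (ler_normD _ _) _.
  have : (G + C) * `|s| ^+ 2 <= (G + C) * `|s| by rewrite ler_wpM2l // addr_ge0.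
  by move: hdgs hgs; rewrite /D; clear; lra.
have hdpg : `|d + g i x * s| <= (D + G) * `|s|.
  by apply: le_trans (ler_normD _ _) _; rewrite mulrDl lerD.
have := hP (f x) d; rewrite (_ : f x + d = f (x + s *: ebase i)); last by rewrite /d; ring.
set Q := P _ - _ - _ - _ => hQ.
(* The last product is [d^2 - (g s)^2]: its first factor is [O(s^2)], its second [O(s)]. *)
rewrite (_ : _ - _ = Q + (P' (f x) * r + P'' (f x) / 2 * ((d - g i x * s) * (d + g i x * s)))); last first.
  by rewrite /Q /r; field.
apply: le_trans (ler_normD _ _) _; apply: le_trans (lerD hQ (ler_normD _ _)) _.
have e1 : CP * `|d| ^+ 3 <= CP * (D * `|s|) ^+ 3.
  by rewrite ler_wpM2l // lerXn2r ?nnegrE // mulr_ge0.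
have e2 : `|P' (f x) * r| <= A1 * (C * `|s| ^+ 3) by rewrite normrM ler_pM // hA1.
have e3 : `|P'' (f x) / 2 * ((d - g i x * s) * (d + g i x * s))| <= A2 * (((G + C) * `|s| ^+ 2) * ((D + G) * `|s|)).
  rewrite normrM; apply: ler_pM => //.
    rewrite normrM (ger0_norm (_ : 0 <= 2^-1)) ?invr_ge0 //.
    by have := hA2 x xM; have := normr_ge0 (P'' (f x)); clear; lra.
  by rewrite normrM ler_pM.
move: e1 e2 e3; rewrite exprMn !exprS expr0 !mulr1.
move: (`|Q|) (`|P' _ * _|) (`|P'' _ / 2 * _|) (`|s|) (`|d|) => *; lra.
Qed.

Lemma taylor_sqr : cubic_taylor (fun y : R => y ^+ 2) (fun y : R => 2 * y) (fun _ => 2).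
Proof.
have ci : continuous (fun y : R => y) by move=> y; apply: cvg_id.
split; [exact: cont_sqr | exact: contZ | exact: contC |].
by exists 0 => // y d; rewrite mul0r (_ : _ - _ = 0) ?normr0 //; field.
Qed.

Lemma cont_pos : continuous (fun y : R => Num.max y 0).
Proof.
have -> : (fun y : R => Num.max y 0) = (fun y : R => 2^-1 * (y + `|y|)).
  apply/funext => y; have [y0|y0] := leP 0 y; last by rewrite ltr0_norm // subrr mulr0.
  by rewrite ger0_norm //; field.
apply: contZ; apply: contD; first by move=> y; apply: cvg_id.
exact: norm_continuous.
Qed.

(** The cube of the positive part is the simplest cut-off profile with a cubic Taylor remainder: its
    second derivative is Lipschitz. *)
Lemma taylor_cub : cubic_taylor (fun y : R => Num.max y 0 ^+ 3) (fun y : R => 3 * Num.max y 0 ^+ 2)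
   (fun y : R => 6 * Num.max y 0).
Proof.
split.
- have -> : (fun y : R => Num.max y 0 ^+ 3) = (fun y : R => Num.max y 0 * Num.max y 0 ^+ 2).
    by apply/funext => y; rewrite exprS.
  by apply: contM; [exact: cont_pos | apply: cont_sqr; exact: cont_pos].
- by apply: contZ; apply: cont_sqr; exact: cont_pos.
- by apply: contZ; exact: cont_pos.
exists 1 => // y d; rewrite mul1r -normrX.
have [y0|y0] := leP 0 y.
  have [z0|z0] := leP 0 (y + d).
    by rewrite (_ : _ - _ = d ^+ 3) //; field.
  rewrite (_ : _ - _ = d ^+ 3 - (y + d) ^+ 3); last by field.
  have d0 : d < 0 by move: y0 z0; clear; lra.
  have a1 : d ^+ 3 <= (y + d) ^+ 3.
    rewrite -subr_ge0 (_ : _ - _ = y * ((y + d) ^+ 2 + (y + d) * d + d ^+ 2)); last by ring.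
    rewrite mulr_ge0 // addr_ge0 ?sqr_ge0 // addr_ge0 ?sqr_ge0 // mulr_le0 // ltW //.
  have a2 : (y + d) ^+ 3 <= 0 by rewrite exprS mulr_le0_ge0 ?sqr_ge0 // ltW.
  have a3 : d ^+ 3 <= 0 by apply: le_trans a1 a2.
  by rewrite (ler0_norm a3) ler0_norm; move: a1 a2; clear; lra.
have [z0|z0] := leP 0 (y + d).
  rewrite (_ : _ - _ = (y + d) ^+ 3); last by field.
  rewrite !ger0_norm ?exprn_ge0 //; last by move: y0 z0; clear; lra.
  by rewrite lerXn2r ?nnegrE //; move: y0 z0; clear; lra.
by rewrite (_ : _ - _ = 0) ?normr0 //; field.
Qed.

(** Polarisation: a product is a quarter of the difference of the squares of sum and difference. *)
Lemma C3T_M (f1 f2 : 'rV[R]_N -> R) g1 H1 g2 H2 : C3T f1 g1 H1 -> C3T f2 g2 H2 ->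
  C3T (fun x => f1 x * f2 x) (fun i x => f1 x * g2 i x + f2 x * g1 i x)
      (fun i x => f1 x * H2 i x + 2 * g1 i x * g2 i x + f2 x * H1 i x).
Proof.
move=> h1 h2; have a := C3T_comp taylor_sqr (C3T_lin 1 1 h1 h2).
have b := C3T_comp taylor_sqr (C3T_lin 1 (-1) h1 h2).
apply: C3T_ext (C3T_lin (4^-1) (- 4^-1) a b) _ _ _ => [x|i x|i x]; by field.
Qed.

Lemma C3T_sum (I : eqType) (s : seq I) (f : I -> 'rV[R]_N -> R) g H :
  (forall j, j \in s -> C3T (f j) (g j) (H j)) ->
  C3T (fun x => \sum_(j <- s) f j x) (fun i x => \sum_(j <- s) g j i x)
      (fun i x => \sum_(j <- s) H j i x).
Proof.
elim: s => [|j s IH] h.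
  by apply: C3T_ext (C3T_cst 0) _ _ _ => [x|i x|i x]; rewrite big_nil.
have hj := h j (mem_head _ _).
have {}IH := IH (fun k ks => h k (mem_behead (ks : k \in behead (j :: s)))).
by apply: C3T_ext (C3T_lin 1 1 hj IH) _ _ _ => [x|i x|i x]; rewrite big_cons !mul1r.
Qed.

Lemma C3T_coord k : C3T (fun x : 'rV[R]_N => x 0 k) (fun i _ => (i == k)%:R) (fun _ _ => 0).
Proof.
split; [exact: coord_continuous | by move=> i; exact: contC | by move=> i; exact: contC |].
move=> M; exists 0 => // x i s _ _.
by rewrite !mxE eqxx /= eq_sym !mul0r subr0 [s * _]mulrC (_ : _ - _ = 0) ?normr0 //; ring.
Qed.

Lemma C3T_sqn x0 : C3T (fun x => sqn (x - x0)) (fun i x => 2 * (x 0 i - x0 0 i)) (fun _ _ => 2).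
Proof.
split.
- have -> : (fun x => sqn (x - x0)) = (fun x => \sum_i (x 0 i - x0 0 i) ^+ 2).
    by apply/funext => x; apply: eq_bigr => i _; rewrite !mxE.
  by apply: cont_sumf => i; apply: cont_sqr; apply: contB; [exact: coord_continuous | exact: contC].
- by move=> i; apply: contZ; apply: contB; [exact: coord_continuous | exact: contC].
- by move=> i; exact: contC.
move=> M; exists 0 => // x i s _ _.
rewrite (_ : x + s *: ebase i - x0 = x - x0 + s *: ebase i) ?sqn_ebase; last by rewrite addrAC.
by rewrite !mxE mul0r (_ : _ - _ = 0) ?normr0 //; field.
Qed.

End C3TClosure.

Section Taylor3.
Context {R : realType}.

Lemma taylor3 (F F1 F2 F3 : R -> R) (K s : R) :
  (forall z : R, `|z| <= 1 -> is_derive z 1 F (F1 z)) ->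
  (forall z : R, `|z| <= 1 -> is_derive z 1 F1 (F2 z)) ->
  (forall z : R, `|z| <= 1 -> is_derive z 1 F2 (F3 z)) ->
  (forall z : R, `|z| <= 1 -> `|F3 z| <= K) -> `|s| <= 1 ->
  `|F s - F 0 - F1 0 * s - F2 0 / 2 * s ^+ 2| <= K * `|s| ^+ 3.
Proof.
move=> h1 h2 h3 hK s1.
have K0 : 0 <= K by apply: le_trans (hK 0 _); rewrite ?normr0.
have b2 z : `|z| <= 1 -> `|F2 z - F2 0| <= K * `|z|.
  move=> z1; apply: (@mvt_bound _ F2 F3) => q _ qz; first by apply: h3; apply: le_trans z1.
  by apply: hK; apply: le_trans z1.
have b1 z : `|z| <= 1 -> `|F1 z - F1 0 - F2 0 * z| <= K * `|z| ^+ 2.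
  move=> z1; pose E := F1 - (fun y => F2 0 * y + 0 * y ^+ 2).
  have -> : F1 z - F1 0 - F2 0 * z = E z - E 0 by rewrite /E !fctE; ring.
  rewrite expr2 mulrA; apply: (@mvt_bound _ E (fun y => F2 y - (F2 0 + 2 * 0 * y))) => q _ qz.
    apply: is_deriveB; first by apply: h2; apply: le_trans z1.
    exact: is_derive_quad.
  rewrite mulr0 mul0r addr0; apply: le_trans (b2 q (le_trans qz z1)) _.
  by rewrite ler_wpM2l.
pose E := F - (fun y => F1 0 * y + F2 0 / 2 * y ^+ 2).
have -> : F s - F 0 - F1 0 * s - F2 0 / 2 * s ^+ 2 = E s - E 0 by rewrite /E !fctE; ring.
rewrite exprSr mulrA; apply: (@mvt_bound _ E (fun y => F1 y - (F1 0 + 2 * (F2 0 / 2) * y))) => q _ qs.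
  apply: is_deriveB; first by apply: h1; apply: le_trans s1.
  exact: is_derive_quad.
rewrite (_ : 2 * (F2 0 / 2) * q = F2 0 * q); last by field.
rewrite opprD addrA; apply: le_trans (b1 q (le_trans qs s1)) _.
by rewrite ler_wpM2l // lerXn2r ?nnegrE.
Qed.

Lemma withinT (T : topologicalType) (f : T -> R) : {within setT, continuous f} -> continuous f.
Proof.
by rewrite continuous_open_subspace; [move=> h x; apply: h; rewrite inE | exact: openT].
Qed.

End Taylor3.

Lemma jet1_sign (R : realType) (F : R -> R) (d sg : R) : jet1 F d -> F 0 = 0 -> `|sg| = 1 -> 0 < sg * d ->
  exists2 q : R, 0 < q & forall s, 0 < s < q -> 0 < F (sg * s).
Proof.
move=> hF F0 sg1 sd; have e0 : 0 < sg * d / 2 by rewrite divr_gt0.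
have [q q0 hq] := hF _ e0; exists q => // s /andP[s0 sq].
have := hq (sg * s); rewrite normrM sg1 mul1r gtr0_norm // => /(_ sq).
rewrite F0 subr0 ler_norml => /andP[h _].
have : 0 < sg * d * s by rewrite mulr_gt0.
by move: h; clear; lra.
Qed.

Lemma cont_eps (R : realType) (V W : normedModType R) (f : V -> W) (x : V) :
  (forall e : R, 0 < e -> exists2 d : R, 0 < d & forall y, `|y - x| < d -> `|f y - f x| < e) ->
  {for x, continuous f}.
Proof.
move=> h; apply/cvgrPdist_lt => e e0; have [d d0 hd] := h e e0.
apply/nbhs_ballP; exists d => // y; rewrite -ball_normE /= => xy.
by rewrite distrC hd // distrC.
Qed.

Section Graph.
Context {R : realType} {N : nat}.

Lemma col'_cont (i : 'I_N) : continuous (fun x : 'rV[R]_N => col' i x).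
Proof.
move=> x; apply: cont_eps => e e0; exists e => // y xy.
apply: norm_rV_lt => // j; rewrite !mxE.
by have := coord_le (y - x) (lift i j); rewrite !mxE => /le_lt_trans; apply.
Qed.

Lemma col'_norm (i : 'I_N) (x : 'rV[R]_N) : `|col' i x| <= `|x|.
Proof. by apply: norm_rV_le => // j; rewrite mxE; apply: coord_le. Qed.

Lemma col'_ebase (i k : 'I_N) s (x : 'rV[R]_N) : col' i (x + s *: ebase k) =
  if unlift i k is Some k' then col' i x + s *: ebase k' else col' i x.
Proof.
apply/rowP => j; rewrite !mxE eqxx /=.
case: unliftP => [k' ->|->]; rewrite !mxE ?eqxx /=.
  by rewrite (inj_eq lift_inj).
by rewrite eq_sym (negbTE (neq_lift _ _)) mulr0 addr0.
Qed.

(** A step along axis [i] leaves [col' i] unchanged and any other axis becomes an axis of the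
    smaller space, so only third derivatives of [gamma] along a single axis enter the remainder. *)
Lemma C3T_graph (i : 'I_N) (gamma : 'rV[R]_N.-1 -> R) : Ck 3 setT gamma ->
  C3T (fun x => gamma (col' i x))
   (fun k x => if unlift i k is Some k' then partial k' gamma (col' i x) else 0)
   (fun k x => if unlift i k is Some k' then partial k' (partial k' gamma) (col' i x) else 0).
Proof.
move=> [c0 h1].
have d1 k x : derivable gamma x (ebase k) by apply: (h1 k).1.
have c1 k : continuous (partial k gamma) by apply: withinT; case: (h1 k).2.
have d2 k j x : derivable (partial k gamma) x (ebase j) by case: (h1 k).2 => _ /(_ j)[+ _]; apply.
have c2 k j : continuous (partial j (partial k gamma)).
  by apply: withinT; case: (h1 k).2 => _ /(_ j)[_ []].
have d3 k j l x : derivable (partial j (partial k gamma)) x (ebase l).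
  by case: (h1 k).2 => _ /(_ j)[_ [_ /(_ l)[+ _]]]; apply.
have c3 k j l : continuous (partial l (partial j (partial k gamma))).
  by apply: withinT; case: (h1 k).2 => _ /(_ j)[_ [_ /(_ l)[_ []]]].
have cc (f : 'rV[R]_N.-1 -> R) : continuous f -> continuous (fun x : 'rV[R]_N => f (col' i x)).
  by move=> cf x; apply: (@continuous_comp _ _ _ (fun x => col' i x) f); [exact: col'_cont | exact: cf].
split.
- by apply: cc; apply: withinT.
- by move=> k; case: unliftP => [k' _|_]; [exact: cc | exact: contC].
- by move=> k; case: unliftP => [k' _|_]; [exact: cc | exact: contC].
move=> M.
have /choice[G hG] : forall k, exists C : R, 0 < C /\ forall z, `|z| <= M + 1 ->
    `|partial k (partial k (partial k gamma)) z| <= C.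
  by move=> k; have [C C0 hC] := cont_bounded (M + 1) (c3 k k k); exists C.
exists (\sum_k G k); first by apply: sumr_ge0 => k _; have [/ltW] := hG k.
move=> x k s xM s1; rewrite col'_ebase; case: unliftP => [k' _|_]; last first.
  rewrite !mul0r !subr0 subrr normr0 mulr_ge0 ?exprn_ge0 //.
  by apply: sumr_ge0 => j _; have [/ltW] := hG j.
have [G0 hG'] := hG k'; pose z := col' i x.
apply: (@le_trans _ _ (G k' * `|s| ^+ 3)); last first.
  rewrite ler_wpM2r ?exprn_ge0 // (bigD1 k') //= lerDl sumr_ge0 // => j _.
  by have [/ltW] := hG j.
have e1 (q : R) : `|q| <= 1 -> is_derive q 1 (fun s => gamma (z + s *: ebase k'))
    (partial k' gamma (z + q *: ebase k')).
  by move=> _; apply: line_derive; exact: derivableP (d1 _ _).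
have e2 (q : R) : `|q| <= 1 -> is_derive q 1 (fun s => partial k' gamma (z + s *: ebase k'))
    (partial k' (partial k' gamma) (z + q *: ebase k')).
  by move=> _; apply: line_derive; exact: derivableP (d2 _ _ _).
have e3 (q : R) : `|q| <= 1 -> is_derive q 1
    (fun s => partial k' (partial k' gamma) (z + s *: ebase k'))
    (partial k' (partial k' (partial k' gamma)) (z + q *: ebase k')).
  by move=> _; apply: line_derive; exact: derivableP (d3 _ _ _ _).
have e4 (q : R) : `|q| <= 1 -> `|partial k' (partial k' (partial k' gamma)) (z + q *: ebase k')| <= G k'.
  move=> q1; apply: hG'; apply: le_trans (ler_normD _ _) _.
  by rewrite norm_ebase lerD // (le_trans (col'_norm _ _)).
have := taylor3 e1 e2 e3 e4 s1.
by rewrite !scale0r !addr0.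
Qed.

End Graph.

(** * Gluing local defining functions *)

Section DefiningFunction.
Context {R : realType} {N : nat}.
Implicit Types (x y v : 'rV[R]_N) (D Omega : set 'rV[R]_N).

Definition local_def Omega x0 (q : R) (r : 'rV[R]_N -> R) g H :=
  [/\ 0 < q, C3T r g H, forall x, `|x - x0| < q -> (Omega x <-> 0 < r x) &
   forall x, `|x - x0| < q -> bdry Omega x -> exists i, g i x != 0].

Lemma local_def_ex Omega x0 : open Omega -> C3_boundary Omega -> closure Omega x0 ->
  exists q r g H, local_def Omega x0 q r g H.
Proof.
move=> oO hC c0; have [Ox0|nOx0] := pselect (Omega x0).
  have [q q0 hq] := open_ball oO Ox0.
  exists q, (fun=> 1), (fun _ _ => 0), (fun _ _ => 0); split=> //.
  - exact: C3T_cst.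
  - by move=> x /hq Ox; split=> // _; exact: ltr01.
  - by move=> x /hq Ox; rewrite bdry_open // => -[].
have b0 : bdry Omega x0 by rewrite bdry_open.
have [i [b [gamma [cg nr]]]] := hC x0 b0.
have /nbhs_ballP[q /= q0 hq] := nr.
pose e : R := (-1) ^+ b.
have hr := C3T_lin e (- e) (C3T_coord i) (C3T_graph i cg).
eexists q, _, _, _; split; [exact: q0 | exact: hr | |].
- move=> x xq; have := hq x; rewrite -ball_normE /= distrC => /(_ xq).
  by rewrite mulrBr mulNr -/e.
- move=> x _ _; exists i; rewrite eqxx unlift_none mulr1 mulr0 addr0.
  by rewrite signr_eq0.
Qed.

(** A negative value would persist nearby, where points of [Omega] must exist; a positive one would
    put [x] in the open set. *)
Lemma local_def_bdry Omega x0 q r g H x : open Omega -> local_def Omega x0 q r g H ->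
  `|x - x0| < q -> bdry Omega x -> r x = 0.
Proof.
move=> oO [q0 [cr _ _ _] h1 _] xq; rewrite bdry_open // => -[cx nOx].
apply/le_anti/andP; split.
  by rewrite leNgt; apply/negP => rx; apply: nOx; apply/h1.
rewrite leNgt; apply/negP => rx.
have n1 : \forall y \near x, r y < 0.
  have /cvgrPdist_lt/(_ (- r x)) := cr x; rewrite oppr_gt0 => /(_ rx).
  by apply: filterS => y; rewrite ltr_norml => /andP[+ _]; move: rx; clear; lra.
have n2 : \forall y \near x, `|y - x0| < q.
  have d0 : 0 < q - `|x - x0| by rewrite subr_gt0.
  apply/nbhs_ballP; exists (q - `|x - x0|) => // y; rewrite -ball_normE /= => xy.
  rewrite -(subrK x y) -addrA; apply: le_lt_trans (ler_normD _ _) _.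
  by rewrite distrC -ltrBrDr.
have [y [Oy [y1 y2]]] := cx _ (filterI n1 n2).
by have /(h1 _ y2) := Oy; rewrite ltNge (ltW y1).
Qed.

(** The cube makes the gradient vanish together with the function, so inactive terms drop out of the
    gradient of a weighted sum. *)
Definition bump (q : R) x0 x := Num.max (q ^+ 2 - sqn (x - x0)) 0 ^+ 3.

Lemma bump_C3T q x0 : exists g H, C3T (bump q x0) g H /\
  (forall x, bump q x0 x = 0 -> forall i, g i x = 0).
Proof.
have h := C3T_comp taylor_cub (C3T_lin 1 (-1) (C3T_cst (q ^+ 2)) (C3T_sqn x0)).
eexists _, _; split.
  apply: C3T_ext h _ (fun _ _ => erefl) (fun _ _ => erefl) => x.
  by rewrite /bump mul1r mulN1r.
move=> x; rewrite /bump mul1r mulN1r => /eqP; rewrite expf_eq0 /= => /eqP -> i.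
by rewrite expr0n mulr0 mul0r.
Qed.

Lemma bump_ge0 q x0 x : 0 <= bump q x0 x.
Proof. by rewrite exprn_ge0 // le_max lexx orbT. Qed.

Lemma bump_gt0 q x0 x : 0 < q -> 0 < bump q x0 x -> `|x - x0| < q.
Proof.
move=> q0 h; have : 0 < q ^+ 2 - sqn (x - x0).
  by rewrite ltNge; apply/negP => h1; move: h; rewrite /bump max_r // expr0n ltxx.
rewrite subr_gt0 => h1; apply: norm_rV_lt => // i.
rewrite -(@ltr_pXn2r _ 2) ?nnegrE ?(ltW q0) // real_normK ?num_real //.
by apply: le_lt_trans h1; rewrite /sqn (bigD1 i) //= lerDl sumr_ge0 // => j _; apply: sqr_ge0.
Qed.

Lemma bump_center q x0 : 0 < q -> 0 < bump q x0 x0.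
Proof.
move=> q0; rewrite exprn_gt0 // lt_max subrr (_ : sqn 0 = 0); last first.
  by rewrite /sqn big1 // => i _; rewrite mxE expr0n.
by rewrite subr0 exprn_gt0.
Qed.

(** Local defining functions are added with bump weights. No normalisation of the weights is
    required: all terms are nonnegative in [Omega], and at a boundary point their gradients cannot
    cancel. *)
Lemma dfun_ex Omega : open Omega -> bounded_set Omega -> C3_boundary Omega ->
  exists rho g H, dfun Omega rho g H.
Proof.
move=> oO bO hC; have [M hM] := bounded_setP bO.
have cO : compact (closure Omega).
  apply: bounded_closed_compact; last exact: closed_closure.
  exists M; split; first exact: num_real.
  by move=> y My x cx; apply: le_trans (closure_bounded hM cx) (ltW My).
have /choice[Q hQ] : forall x0, exists Q : R * ('rV[R]_N -> R) * ('I_N -> 'rV[R]_N -> R) *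
     ('I_N -> 'rV[R]_N -> R) * ('I_N -> 'rV[R]_N -> R) * ('I_N -> 'rV[R]_N -> R),
   let: (q, r, g, H, bg, bH) := Q in closure Omega x0 ->
     local_def Omega x0 q r g H /\ (C3T (bump q x0) bg bH /\
       (forall x, bump q x0 x = 0 -> forall i, bg i x = 0)).
  move=> x0; have [c0|nc] := pselect (closure Omega x0); last first.
    by exists (0, fun=> 0, fun _ _ => 0, fun _ _ => 0, fun _ _ => 0, fun _ _ => 0).
  have [q [r [g [H ld]]]] := local_def_ex oO hC c0.
  by have [bg [bH hb]] := bump_C3T q x0; exists (q, r, g, H, bg, bH).
pose q z := (Q z).1.1.1.1.1; pose r z := (Q z).1.1.1.1.2; pose g z := (Q z).1.1.1.2.
pose H z := (Q z).1.1.2; pose bg z := (Q z).1.2; pose bH z := (Q z).2.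
have {}hQ z : closure Omega z -> local_def Omega z (q z) (r z) (g z) (H z) /\
   (C3T (bump (q z) z) (bg z) (bH z) /\ (forall x, bump (q z) z x = 0 -> forall i, bg z i x = 0)).
  by move=> cz; have := hQ z; rewrite /q /r /g /H /bg /bH; case: (Q z) => [[[[[? ?] ?] ?] ?] ?]; apply.
have [S SO cS] : finite_subset_cover (closure Omega) (fun z => [set x | 0 < bump (q z) z x]) (closure Omega).
  have := cO; rewrite compact_cover; apply.
    move=> z cz; have [_ [[cb _ _ _] _]] := hQ z cz.
    exact: (@open_comp _ _ (bump (q z) z) [set y : R | 0 < y] (in1W cb) (@open_gt _ 0)).
  move=> x cx; exists x => //=; apply: bump_center.
  by have [[]] := hQ x cx.
pose s := [seq z <- finmap.enum_fset S | `[< closure Omega z >]].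
have sO z : z \in s -> closure Omega z by rewrite mem_filter => /andP[/asboolP].
have cs x : closure Omega x -> exists2 z, z \in s & 0 < bump (q z) z x.
  move=> /cS[z /= zS bz]; exists z => //; rewrite mem_filter; apply/andP; split=> //.
  by apply/asboolP; have := SO z zS; rewrite inE.
clearbody s.
pose rho x := \sum_(z <- s) bump (q z) z x * r z x.
have C3 : C3T rho (fun i x => \sum_(z <- s) (bump (q z) z x * g z i x + r z x * bg z i x))
   (fun i x => \sum_(z <- s) (bump (q z) z x * H z i x + 2 * bg z i x * g z i x + r z x * bH z i x)).
  apply: C3T_sum => z zs; have [[_ h1 _ _] [h2 _]] := hQ z (sO z zs).
  exact: C3T_M h2 h1.
have near_z z x : z \in s -> 0 < bump (q z) z x -> `|x - z| < q z.
  by move=> zs; apply: bump_gt0; have [[]] := hQ z (sO z zs).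
have term0 z x : z \in s -> Omega x -> 0 <= bump (q z) z x * r z x.
  move=> zs Ox; have [b0|b0] := leP (bump (q z) z x) 0.
    by rewrite (_ : bump _ _ _ = 0) ?mul0r //; apply/le_anti; rewrite b0 bump_ge0.
  have [[_ _ h1 _] _] := hQ z (sO z zs).
  by rewrite mulr_ge0 ?bump_ge0 // ltW //; apply/h1 => //; exact: near_z.
have rbd z x : z \in s -> 0 < bump (q z) z x -> bdry Omega x -> r z x = 0.
  move=> zs b0; have [h1 _] := hQ z (sO z zs).
  by apply: (local_def_bdry oO h1); apply: near_z.
have bz0 z x : 0 < bump (q z) z x \/ bump (q z) z x = 0.
  have [b0|b0] := ltP 0 (bump (q z) z x); [by left | right].
  by apply/le_anti; rewrite b0 bump_ge0.
have rhoO x : Omega x -> 0 < rho x.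
  move=> Ox; rewrite lt_neqAle eq_sym /rho big_seq_cond; apply/andP; split; last first.
    by apply: sumr_ge0 => z /andP[zs _]; apply: term0.
  apply/negP; rewrite psumr_eq0 => [|z /andP[zs _]]; last exact: term0.
  move=> /allP al; have [z zs bz] := cs x (subset_closure Ox).
  have := al z zs; rewrite zs /= mulf_eq0 gt_eqF //= => /eqP r0.
  have [[_ _ h1 _] _] := hQ z (sO z zs).
  by have /(h1 x (near_z z x zs bz)) := Ox; rewrite r0 ltxx.
have rhob x : bdry Omega x -> rho x = 0.
  move=> bx; rewrite /rho big_seq_cond big1 // => z /andP[zs _].
  by have [b0|->] := bz0 z x; rewrite ?mul0r // (rbd z x) // mulr0.
(* An axis along which one active local function grows leads into [Omega], so the other active ones
   cannot decrease along it. *)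
have gradb x : bdry Omega x -> exists i, \sum_(z <- s) (bump (q z) z x * g z i x + r z x * bg z i x) != 0.
  move=> bx; have [z0 z0s b0] := cs x bx.1.
  have [[_ h30 hpos0 hg0] _] := hQ z0 (sO z0 z0s).
  have [i gi0] := hg0 x (near_z _ _ z0s b0) bx; exists i.
  pose sg := Num.sg (g z0 i x).
  have sgn : `|sg| = 1 by rewrite normr_sg gi0.
  have sg1 : 0 < sg * g z0 i x by rewrite -normrEsg normr_gt0.
  have tm z : z \in s -> bump (q z) z x * g z i x + r z x * bg z i x = bump (q z) z x * g z i x.
    move=> zs; have [bp|bp] := bz0 z x; first by rewrite (rbd z x) // mul0r addr0.
    by have [_ [_ hb]] := hQ z (sO z zs); rewrite hb // mulr0 addr0.
  have [d d0 hd] : exists2 d : R, 0 < d & forall t, 0 < t < d -> Omega (x + (sg * t) *: ebase i).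
    have r0 : r z0 (x + 0 *: ebase i) = 0 by rewrite scale0r addr0 (rbd z0 x).
    have [d d0 hd] := jet1_sign (jet2_jet1 (C3T_jet2 x i h30)) r0 sgn sg1.
    have m0 : 0 < q z0 - `|x - z0| by rewrite subr_gt0 near_z.
    exists (Num.min d (q z0 - `|x - z0|)); first by rewrite lt_min d0.
    move=> t; rewrite lt_min => /andP[t0 /andP[td tm']].
    apply/(hpos0 _ _).2; last by apply: hd; rewrite t0.
    rewrite addrAC; apply: le_lt_trans (ler_normD _ _) _.
    by rewrite norm_ebase normrM sgn mul1r gtr0_norm // -ltrBrDl.
  have gz z : z \in s -> 0 < bump (q z) z x -> 0 <= sg * g z i x.
    move=> zs bz; rewrite leNgt; apply/negP => neg.
    have [[_ h3z hposz _] _] := hQ z (sO z zs).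
    have r0 : - r z (x + 0 *: ebase i) = 0 by rewrite scale0r addr0 (rbd z x) ?oppr0.
    have sgp : 0 < sg * - g z i x by rewrite mulrN oppr_gt0.
    have j : jet1 (fun t => - r z (x + t *: ebase i)) (- g z i x).
      by have := jet1Z (-1) (jet2_jet1 (C3T_jet2 x i h3z)); rewrite mulN1r; under eq_fun do rewrite mulN1r.
    have [d' d'0 hd'] := jet1_sign j r0 sgn sgp.
    have m0 : 0 < q z - `|x - z| by rewrite subr_gt0 near_z.
    pose m := Num.min d (Num.min d' (q z - `|x - z|)).
    have mp : 0 < m by rewrite !lt_min d0 d'0.
    have : m / 2 < m by move: mp; clear; lra.
    rewrite {2}/m !lt_min => /and3P[m1 m2 m3].
    have m20 : 0 < m / 2 by move: mp; clear; lra.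
    have := hd (m / 2); rewrite m20 m1 => /(_ isT) Om.
    have := hd' (m / 2); rewrite m20 m2 => /(_ isT); rewrite oppr_gt0 ltNge => /negP; apply.
    apply: ltW; apply/(hposz _ _).1 => //.
    rewrite addrAC; apply: le_lt_trans (ler_normD _ _) _.
    by rewrite norm_ebase normrM sgn mul1r gtr0_norm // -ltrBrDl.
  have pos : 0 < \sum_(z <- s) sg * (bump (q z) z x * g z i x).
    have t0 z : z \in s -> 0 <= sg * (bump (q z) z x * g z i x).
      move=> zs; have [bp|->] := bz0 z x; last by rewrite mul0r mulr0.
      by rewrite mulrCA mulr_ge0 ?bump_ge0 // gz.
    rewrite lt_neqAle eq_sym big_seq_cond; apply/andP; split; last first.
      by apply: sumr_ge0 => z /andP[zs _]; apply: t0.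
    apply/negP; rewrite psumr_eq0 => [|z /andP[zs _]]; last exact: t0.
    move=> /allP /(_ z0 z0s); rewrite z0s /= mulrCA mulf_eq0 gt_eqF //=.
    by rewrite gt_eqF.
  apply/eqP => eq0; move: pos; rewrite -mulr_sumr.
  rewrite (_ : \sum_(z <- s) bump (q z) z x * g z i x = 0) ?mulr0 ?ltxx //.
  by rewrite -[RHS]eq0 big_seq [RHS]big_seq; apply: eq_bigr => z zs; rewrite tm.
pose gr i x := \sum_(z <- s) (bump (q z) z x * g z i x + r z x * bg z i x).
have [cr cgr0 _ _] := C3.
have cgr i : continuous (gr i) by apply: cgr0.
eexists rho, gr, _; split; [exact: C3 | exact: rhoO | exact: rhob |].
(* If the uniform lower bound failed, a limit of points of [Omega] would be a boundary point with
   vanishing gradient. *)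
apply: contrapT => nc.
have /choice[z hz] : forall n : nat, exists z, [/\ Omega z, rho z <= n.+1%:R^-1 &
    \sum_i gr i z ^+ 2 <= n.+1%:R^-1].
  move=> n; apply: contrapT => hn; apply: nc; exists n.+1%:R^-1; first by rewrite invr_gt0.
  exists n.+1%:R^-1; first by rewrite invr_gt0.
  move=> x Ox rx; rewrite leNgt; apply/negP => gx; apply: hn; exists x; split=> //; exact: ltW.
have [x hx] : exists l : 'rV[R]_N, z @ Uf --> l.
  by apply: (@Uf_bounded_rV _ _ _ M); apply: nearW => n; apply: hM; have [] := hz n.
have cx : closure Omega x by apply: closure_Uf hx _; apply: nearW => n; have [] := hz n.
have rx : rho x <= 0.
  apply: ler_cvg_to (cvg_comp _ _ hx (cr x)) (@Uf_inv R) _.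
  by apply: nearW => n /=; have [] := hz n.
have bx : bdry Omega x by rewrite bdry_open //; split=> // /rhoO; rewrite ltNge rx.
have gx : \sum_i gr i x ^+ 2 <= 0.
  have cg2 : continuous (fun x => \sum_i gr i x ^+ 2) by apply: cont_sumf => i; apply: cont_sqr.
  apply: ler_cvg_to (cvg_comp _ _ hx (cg2 x)) (@Uf_inv R) _.
  by apply: nearW => n /=; have [] := hz n.
have [i] := gradb x bx; rewrite -/(gr i x) => /negP; apply.
rewrite -sqrf_eq0; apply/eqP; apply/le_anti; rewrite sqr_ge0 andbT.
by apply: le_trans gx; rewrite (bigD1 i) //= lerDl sumr_ge0 // => j _; apply: sqr_ge0.
Qed.


End DefiningFunction.

(** * The discrete Dirichlet problem *)

Section Discrete.
Context {R : realType} {N : nat}.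
Implicit Types (x y c : 'rV[R]_N) (i j : 'I_N) (w z f : 'rV[R]_N -> R) (A : set 'rV[R]_N).

(** Undivided second difference, of the order of [h^2] times the Laplacian. *)
Definition lap (h : R) w x :=
  \sum_i (w (x + h *: ebase i) + w (x - h *: ebase i) - 2 * w x).

Lemma lapB h f g x : lap h (fun y => f y - g y) x = lap h f x - lap h g x.
Proof. by rewrite /lap -sumrB; apply: eq_bigr => i _; ring. Qed.

Lemma lapZ h (a : R) f x : lap h (fun y => a * f y) x = a * lap h f x.
Proof. by rewrite /lap mulr_sumr; apply: eq_bigr => i _; ring. Qed.

Lemma lap_nbr h w x : \sum_i (w (x + h *: ebase i) + w (x - h *: ebase i)) =
  lap h w x + 2 * N%:R * w x.
Proof.
rewrite /lap sumrB sumr_const card_ord -mulr_natl; ring.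
Qed.

(** No maximum point is sought: at a point where [z > 0], [z] lies below the average of its
    neighbours by [eta / (2 N)], so each round lowers the upper bound by this amount, and finitely
    many rounds bring it to 0. *)
Lemma disc_max (h : R) A z (B eta : R) : (0 < N)%N -> (forall x, A x -> z x <= B) -> 0 < eta ->
  (forall x, A x -> 0 < z x -> eta <= lap h z x /\
     forall i, (A (x + h *: ebase i) \/ z (x + h *: ebase i) <= 0) /\
               (A (x - h *: ebase i) \/ z (x - h *: ebase i) <= 0)) ->
  forall x, A x -> z x <= 0.
Proof.
move=> N0 hB eta0 hz x Ax.
have n0 : 0 < 2 * N%:R :> R by rewrite mulr_gt0 // ltr0n.
pose e := eta / (2 * N%:R).
have e0 : 0 < e by rewrite divr_gt0.
have H k : forall x, A x -> z x <= Num.max 0 (B - k%:R * e).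
  elim: k => [|k IH] y Ay; first by rewrite mul0r subr0 le_max hB // orbT.
  have [zy|zy] := leP (z y) 0; first by rewrite le_max zy.
  have [hl hn] := hz y Ay zy.
  set S := Num.max 0 (B - k%:R * e) in IH.
  have S0 : 0 <= S by rewrite le_max lexx.
  have nb u : A u \/ z u <= 0 -> z u <= S by move=> [/IH//|/le_trans]; apply.
  have : \sum_i (z (y + h *: ebase i) + z (y - h *: ebase i)) <= \sum_(i < N) (S + S).
    by apply: ler_sum => i _; have [h1 h2] := hn i; rewrite lerD ?nb.
  rewrite lap_nbr sumr_const card_ord -mulr_natl => h3.
  have h4 : z y <= S - e.
    rewrite -(ler_pM2l n0) mulrBr /e mulrCA mulfV ?gt_eqF // mulr1.
    by move: h3 hl; clear; lra.
  have S1 : S = B - k%:R * e.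
    rewrite /S max_r // leNgt; apply/negP => lt0.
    have S00 : S = 0 by rewrite /S max_l // ltW.
    by move: h4 zy e0; rewrite S00; clear; lra.
  by rewrite le_max; apply/orP; right; rewrite -natr1; move: h4; rewrite S1; clear; lra.
rewrite leNgt; apply/negP => zx.
have := H (Num.truncn (B / e)).+1 x Ax; rewrite leNgt => /negP; apply.
have := truncnS_gt (B / e); rewrite ltr_pdivrMr // => h1.
by rewrite max_l //; move: h1; clear; lra.
Qed.

Definition quadb (be ga al de : R) c i x :=
  be * (x 0 i - c 0 i) - ga * (x 0 i - c 0 i) ^+ 2 + al * sqn (x - c) + de.

Lemma coord_step x i j (s : R) : (x + s *: ebase j) 0 i = x 0 i + s * (j == i)%:R.
Proof. by rewrite !mxE eqxx /= eq_sym. Qed.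

Lemma sqn_step x c j (s : R) : sqn (x + s *: ebase j - c) = sqn (x - c) + 2 * (x 0 j - c 0 j) * s + s ^+ 2.
Proof.
by rewrite (_ : x + s *: ebase j - c = (x - c) + s *: ebase j) ?sqn_ebase ?mxE //; rewrite addrAC.
Qed.

Lemma lap_quadb h be ga al de c i x :
  lap h (quadb be ga al de c i) x = h ^+ 2 * (2 * N%:R * al - 2 * ga).
Proof.
rewrite /lap (eq_bigr (fun j => 2 * al * h ^+ 2 - 2 * ga * h ^+ 2 * (j == i)%:R)); last first.
  move=> j _; rewrite -scaleNr /quadb !coord_step !sqn_step.
  by case: (j == i); rewrite ?mulr1 ?mulr0; ring.
rewrite sumrB sumr_const card_ord -mulr_sumr -[_ *+ N]mulr_natl (bigD1 i) //= eqxx big1 => [|j /negbTE ->//].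
rewrite (_ : true%:R = 1 :> R) //; ring.
Qed.

Definition mirror c i x := x - (2 * (x 0 i - c 0 i)) *: ebase i.

Lemma lap_mirror h c i w x : lap h (fun y => w (mirror c i y)) x = lap h w (mirror c i x).
Proof.
apply: eq_bigr => j _; congr (_ - _).
have E (s : R) : mirror c i (x + s *: ebase j) = mirror c i x + (if j == i then - s else s) *: ebase j.
  rewrite /mirror coord_step; case: eqP => [->|_]; last by rewrite mulr0 addr0 addrAC.
  by rewrite mulr1; apply/rowP => l; rewrite !mxE; ring.
rewrite -scaleNr !E; case: eqP => _; last by rewrite scaleNr.
by rewrite opprK addrC scaleNr.
Qed.

(* Brandt's argument: [w - w o mirror] is compared with a quadratic on half of a
   cube, the mirror hyperplane lying half a mesh away from [x0]. *)
Lemma disc_gradient_onesided (h r M F : R) w x0 i : (0 < N)%N -> 0 < h <= r -> 0 < M -> 0 <= F ->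
  (forall x, `|x - x0| <= r + 2 * h -> `|w x| <= M) ->
  (forall x, `|x - x0| <= r + 2 * h -> `|lap h w x| <= F * h ^+ 2) ->
  w (x0 + h *: ebase i) - w x0 <= h * (r * F + (2 * N%:R + 2) * M / r).
Proof.
move=> N0 /andP[h0 hr] M0 F0 hw hl.
have r0 : 0 < r by apply: lt_le_trans hr.
have n1 : 1 <= N%:R :> R by rewrite ler1n.
(* The mirror image of [x0 + h *: ebase i] is then [x0], and [phi] there is the increment to be
   bounded. *)
pose c := x0 + (h / 2) *: ebase i.
pose al := 2 * M / r ^+ 2.
have al0 : 0 < al by rewrite divr_gt0 ?mulr_gt0 // exprn_gt0.
have alr : al * r ^+ 2 = 2 * M by rewrite /al divfK // gt_eqF // exprn_gt0.
pose ga := F + N%:R * al + al / 2.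
have ga0 : 0 < ga.
  have : 0 <= N%:R * al by rewrite mulr_ge0 // ltW.
  by rewrite /ga; move: al0 F0; clear; lra.
pose be := 2 * r * ga.
(* [al] makes [b >= 2 M] on the sides of the cube; [ga] makes [lap h b] equal to [- (2 F + al) h^2];
   [be] keeps [be t - ga t^2] nonnegative for [0 <= t <= 2 r]; the constant makes [b] plus its
   mirror image nonnegative next to the hyperplane. *)
pose b := quadb be ga al (ga * h ^+ 2 / 4) c i.
pose phi y := w y - w (mirror c i y).
pose z y := phi y - b y.
pose A : set 'rV[R]_N := [set y | `|y - c| < r /\ exists k : nat, y 0 i - c 0 i = (k%:R + 2^-1) * h].
have cx0 : `|c - x0| <= h / 2.
  by rewrite /c addrAC subrr add0r norm_ebase ger0_norm // divr_ge0 // ltW.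
have yE : x0 + h *: ebase i = c + (h / 2) *: ebase i.
  by rewrite /c -addrA -scalerDl; congr (_ + _ *: _); field.
have ti : (x0 + h *: ebase i) 0 i - c 0 i = h / 2.
  by rewrite /c !coord_step eqxx !mulr1; field.
clearbody c.
have toc y : `|y - c| <= r + h -> `|y - x0| <= r + 2 * h.
  move=> yc; rewrite -(subrK c y) -addrA; apply: le_trans (ler_normD _ _) _.
  by move: yc cx0 h0; clear; lra.
have nrefl y : `|mirror c i y - c| <= `|y - c|.
  apply: norm_rV_le => // j; have := coord_le (y - c) j; rewrite /mirror !mxE eqxx /=.
  case: (j == i) / eqP => [->|_]; last by rewrite mulr0 subr0.
  rewrite mulr1 (_ : _ - _ - _ = - (y 0 i - c 0 i)) ?normrN //; ring.
have phi_le y : `|y - c| <= r + h -> phi y <= 2 * M.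
  move=> yc; have := hw y (toc y yc); have := hw _ (toc _ (le_trans (nrefl y) yc)).
  by rewrite !ler_norml /phi => /andP[h1 _] /andP[_ h2]; move: h1 h2; clear; lra.
have step_c y j (s : R) : A y -> `|s| <= h -> `|y + s *: ebase j - c| <= r + h.
  move=> [yc _] sh; rewrite addrAC; apply: le_trans (ler_normD _ _) _.
  by rewrite norm_ebase lerD // ltW.
have out y : `|y - c| <= r + h -> r <= `|y - c| -> 0 <= y 0 i - c 0 i -> z y <= 0.
  move=> yc ry t0; rewrite subr_le0; apply: le_trans (phi_le y yc) _.
  have t2 : y 0 i - c 0 i <= 2 * r.
    have := coord_le (y - c) i; rewrite !mxE => h1; have := ler_norm (y 0 i - c 0 i).
    by move: h1 yc hr; clear; lra.
  have sq : r ^+ 2 <= sqn (y - c).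
    rewrite -(@ler_sqrt _ (r ^+ 2)) ?sqn_ge0 // sqrtr_sqr gtr0_norm //.
    exact: le_trans ry (norm_le_enorm (y - c)).
  have g1 : al * r ^+ 2 <= al * sqn (y - c) by rewrite ler_pM2l.
  have g2 : 0 <= (y 0 i - c 0 i) * (ga * (2 * r - (y 0 i - c 0 i))).
    by rewrite mulr_ge0 // mulr_ge0 ?(ltW ga0) // subr_ge0.
  have g3 : 0 <= ga * h ^+ 2 by rewrite mulr_ge0 ?sqr_ge0 // ltW.
  rewrite /b /quadb /be; move: alr g1 g2 g3; clear; move: (y 0 i - c 0 i) => t; lra.
have yA y (k : nat) : `|y - c| <= r + h -> y 0 i - c 0 i = (k%:R + 2^-1) * h -> A y \/ z y <= 0.
  move=> yc yk; have [ry|ry] := leP r `|y - c|.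
    right; apply: out => //; rewrite yk mulr_ge0 ?(ltW h0) // addr_ge0 ?invr_ge0 //.
  by left; split=> //; exists k.
have key : forall y, A y -> z y <= 0.
  have eta0 : 0 < al * h ^+ 2 by rewrite mulr_gt0 // exprn_gt0.
  apply: (@disc_max h A z (2 * M + ga * (2 * r) ^+ 2) _ N0 _ eta0).
    move=> y [yc _]; rewrite /z.
    have yc' : `|y - c| <= r + h by rewrite ltW // (lt_le_trans yc) // lerDl ltW.
    have t2 : `|y 0 i - c 0 i| <= r.
      by have := coord_le (y - c) i; rewrite !mxE; move: yc; clear; lra.
    have g1 : 0 <= al * sqn (y - c) by rewrite mulr_ge0 ?sqn_ge0 // ltW.
    have g3 : 0 <= ga * h ^+ 2 by rewrite mulr_ge0 ?sqr_ge0 // ltW.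
    have g4 : 0 <= ga * ((y 0 i - c 0 i) ^+ 2 + 2 * r * (y 0 i - c 0 i) - (y 0 i - c 0 i) ^+ 2 * 2 + (2 * r) ^+ 2).
      rewrite mulr_ge0 ?(ltW ga0) //; move: t2; rewrite ler_norml => /andP[a1 a2].
      by move: a1 a2 r0; clear; move: (y 0 i - c 0 i) => t; nra.
    have := phi_le y yc'; rewrite /b /quadb /be; move: g1 g3 g4; clear.
    by move: (y 0 i - c 0 i) => t; lra.
  move=> y Ay zy; have [yc [k yk]] := Ay.
  have yc' : `|y - c| <= r + h by rewrite ltW // (lt_le_trans yc) // lerDl ltW.
  split.
    rewrite /z lapB /phi lapB lap_mirror lap_quadb.
    have := hl y (toc y yc'); have := hl _ (toc _ (le_trans (nrefl y) yc')).
    rewrite !ler_norml => /andP[_ h1] /andP[h2 _].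
    rewrite (_ : h ^+ 2 * _ = - (2 * F * h ^+ 2) - al * h ^+ 2); last by rewrite /ga; field.
    by move: h1 h2; clear; lra.
  have hh : `|h| <= h by rewrite gtr0_norm.
  have hhN : `|- h| <= h by rewrite normrN gtr0_norm.
  move=> j; have [ji|ji] := eqVneq j i; last first.
    split.
      by apply: (yA _ k); [apply: step_c | rewrite coord_step (negbTE ji) mulr0 addr0].
    rewrite -scaleNr.
    by apply: (yA _ k); [apply: step_c | rewrite coord_step (negbTE ji) mulr0 addr0].
  rewrite ji; split.
    apply: (yA _ k.+1); first exact: step_c.
    rewrite coord_step eqxx mulr1 addrAC yk -natr1; ring.
  rewrite -scaleNr; case: k yk => [|k] yk; last first.
    apply: (yA _ k); first exact: step_c.
    rewrite coord_step eqxx mulr1 addrAC yk -natr1; ring.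
  (* In the layer next to the hyperplane the lower neighbour is the mirror image of [y], where [phi]
     takes the opposite value. *)
  right; have yr : y + (- h) *: ebase i = mirror c i y.
    by rewrite /mirror yk scaleNr; congr (_ - _ *: _); field.
  have rr : mirror c i (mirror c i y) = y.
    by apply/rowP => l; rewrite /mirror !mxE !eqxx /= mulr1; ring.
  move: zy; rewrite yr /z /phi rr /b /quadb.
  have -> : sqn (mirror c i y - c) = sqn (y - c).
    by rewrite /mirror -scaleNr sqn_step; ring.
  have -> : (mirror c i y) 0 i - c 0 i = - (y 0 i - c 0 i).
    by rewrite /mirror !mxE !eqxx /= mulr1; ring.
  rewrite yk; have : 0 <= al * sqn (y - c) by rewrite mulr_ge0 ?sqn_ge0 // ltW.
  by clear; lra.
have := key (x0 + h *: ebase i) _.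
have -> : z (x0 + h *: ebase i) = w (x0 + h *: ebase i) - w x0 - (be * (h / 2) - ga * (h / 2) ^+ 2 + al * (h / 2) ^+ 2 + ga * h ^+ 2 / 4).
  rewrite /z /phi /b /quadb ti; congr (_ - w _ - (_ - _ + _ * _ + _)).
    by rewrite /mirror ti (_ : 2 * (h / 2) = h) ?addrK //; field.
  by rewrite yE -addrA [_ - c]addrC addrA subrr add0r -(add0r (_ *: _)) sqn_ebase mxE /sqn big1 => [|j _]; rewrite ?mxE ?expr0n //; ring.
move=> /(_ _) H; apply: le_trans (_ : be * (h / 2) - ga * (h / 2) ^+ 2 + al * (h / 2) ^+ 2 + ga * h ^+ 2 / 4 <= _); last first.
  rewrite (_ : (2 * N%:R + 2) * M / r = (N%:R + 1) * al * r); last first.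
    by rewrite /al; field; rewrite gt_eqF.
  have : al * h * h <= al * h * r by rewrite ler_pM2l // mulr_gt0.
  by rewrite /be /ga; have := mulr_gt0 (mulr_gt0 al0 h0) r0; clear; lra.
rewrite -subr_le0; apply: H; split.
  by rewrite yE addrAC subrr add0r norm_ebase ger0_norm ?divr_ge0 ?(ltW h0) //; move: h0 hr; clear; lra.
by exists 0%N; rewrite ti; field.
Qed.

Lemma disc_gradient (h r M F : R) w x0 i : (0 < N)%N -> 0 < h <= r -> 0 < M -> 0 <= F ->
  (forall x, `|x - x0| <= r + 2 * h -> `|w x| <= M) ->
  (forall x, `|x - x0| <= r + 2 * h -> `|lap h w x| <= F * h ^+ 2) ->
  `|w (x0 + h *: ebase i) - w x0| <= h * (r * F + (2 * N%:R + 2) * M / r).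
Proof.
move=> N0 hr M0 F0 hw hl; rewrite ler_norml; apply/andP; split; last exact: disc_gradient_onesided.
have hw' x : `|x - x0| <= r + 2 * h -> `|-1 * w x| <= M by move=> xr; rewrite mulN1r normrN hw.
have hl' x : `|x - x0| <= r + 2 * h -> `|lap h (fun y => -1 * w y) x| <= F * h ^+ 2.
  by move=> xr; rewrite lapZ mulN1r normrN hl.
by have := disc_gradient_onesided i N0 hr M0 F0 hw' hl'; clear; lra.
Qed.

Definition dquot1 (h : R) i f x := h^-1 * (f (x + h *: ebase i) - f x).

Lemma lap_dquot1 h i f x : lap h (dquot1 h i f) x = h^-1 * (lap h f (x + h *: ebase i) - lap h f x).
Proof.
rewrite /dquot1 lapZ lapB; congr (_ * (_ - _)); apply: eq_bigr => j _.
by congr (f _ + f _ - _); rewrite addrAC.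
Qed.

Definition disc_eq (h : R) x0 (rr M l cc : R) f := forall x, `|x - x0| <= rr ->
  `|f x| <= M /\ lap h f x = - (h ^+ 2 * (l * f x + cc)).

(** [lap] commutes with difference quotients, so a quotient solves the same equation on a smaller
    cube, with constant term 0; the lemma can therefore be iterated. *)
Lemma disc_step (h r rr M L l cc : R) x0 f i : (0 < N)%N -> 0 < h -> 2 * h <= r -> 0 < M ->
  0 <= l <= L -> 0 <= cc <= 1 -> disc_eq h x0 rr M l cc f ->
  disc_eq h x0 (rr - 2 * r) (r * (L * M + 1) + (2 * N%:R + 2) * M / r) l 0 (dquot1 h i f).
Proof.
move=> N0 h0 hr M0 /andP[l0 lL] /andP[c0 c1] hf x xr.
have near y : `|y - x| <= r + 2 * h -> `|y - x0| <= rr.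
  move=> yx; rewrite -(subrK x y) -addrA; apply: le_trans (ler_normD _ _) _.
  by move: yx xr hr; clear; lra.
have L0 : 0 <= L by apply: le_trans lL.
have F0 : 0 <= L * M + 1 by rewrite addr_ge0 // mulr_ge0 // ltW.
split.
  rewrite /dquot1 normrM normfV (gtr0_norm h0) [leLHS]mulrC ler_pdivrMr // [leRHS]mulrC.
  apply: disc_gradient => //.
  - by rewrite h0 /=; move: hr h0; clear; lra.
  - by move=> y /near /hf [].
  - move=> y /near /hf [fy ->]; rewrite normrN normrM ger0_norm ?sqr_ge0 // mulrC ler_wpM2r ?sqr_ge0 //.
    apply: le_trans (ler_normD _ _) _; rewrite normrM (ger0_norm l0) (ger0_norm c0).
    by apply: lerD => //; apply: ler_pM.
have hx : `|x - x| <= r + 2 * h by rewrite subrr normr0; move: hr h0; clear; lra.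
have hxi : `|x + h *: ebase i - x| <= r + 2 * h.
  by rewrite addrAC subrr add0r norm_ebase gtr0_norm //; move: hr h0; clear; lra.
by rewrite lap_dquot1 (hf _ (near _ hx)).2 (hf _ (near _ hxi)).2 /dquot1; ring.
Qed.

End Discrete.

(** * Minimal supersolutions on the grid *)

Section MinimalSupersolution.
Context {R : realType} {N : nat}.
Implicit Types (x y : 'rV[R]_N) (i j : 'I_N) (w : 'rV[R]_N -> R) (A : set 'rV[R]_N).

Definition disc_super A (h l : R) w := (exists B, forall x, 0 <= w x <= B) /\
  forall x, A x -> h ^+ 2 * (l * w x + 1) <= - lap h w x.

Definition nbr (h : R) w x := \sum_i (w (x + h *: ebase i) + w (x - h *: ebase i)).

(** The neighbours are separated from the centre: this form is monotone in the neighbouring values,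
    so infima and truncations can be inserted. *)
Lemma disc_superE A h l w x : h ^+ 2 * (l * w x + 1) <= - lap h w x <->
  h ^+ 2 + nbr h w x <= (2 * N%:R - h ^+ 2 * l) * w x.
Proof. by rewrite /nbr lap_nbr; split; lra. Qed.

Lemma nbr_le h w w' x : (forall y, y != x -> w y <= w' y) -> h != 0 -> nbr h w x <= nbr h w' x.
Proof.
move=> hw h0.
have ne i (s : R) : s != 0 -> x + s *: ebase i != x.
  move=> s0; rewrite -subr_eq0 addrAC subrr add0r; apply/eqP => /(congr1 (fun v : 'rV[R]_N => v 0 i)).
  by rewrite !mxE !eqxx mulr1; apply/eqP.
apply: ler_sum => i _; rewrite -scaleNr; apply: lerD; apply: hw; apply: ne => //.
by rewrite oppr_eq0.
Qed.

Definition wmin A h l x := inf [set w x | w in disc_super A h l].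

Section Fixed.
Variables (A : set 'rV[R]_N) (h l : R).
Hypotheses (h0 : 0 < h) (Ane : A !=set0) (Sne : exists w, disc_super A h l w).

Let S x := [set w x | w in disc_super A h l].

Let S_inf x : has_inf (S x).
Proof.
split; first by have [w hw] := Sne; exists (w x), w.
by exists 0 => _ [w [[B hB] _] <-]; have /andP[] := hB x.
Qed.

Lemma wmin_ge0 x : 0 <= wmin A h l x.
Proof. by apply: lb_le_inf; [case: (S_inf x) | move=> _ [w [[B hB] _] <-]; have /andP[] := hB x]. Qed.

Lemma wmin_le w x : disc_super A h l w -> wmin A h l x <= w x.
Proof. by move=> hw; apply: ge_inf; [case: (S_inf x) | exists w]. Qed.

Lemma kappa_gt0 : 0 < 2 * N%:R - h ^+ 2 * l.
Proof.
have [w [[B hB] hw]] := Sne; have [x Ax] := Ane.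
have /(disc_superE A) h1 := hw x Ax.
have h2 : 0 < h ^+ 2 + nbr h w x.
  rewrite ltr_pwDl ?exprn_gt0 // sumr_ge0 // => i _.
  by rewrite addr_ge0 //; [have /andP[] := hB (x + h *: ebase i) | have /andP[] := hB (x - h *: ebase i)].
have /andP[w0 _] := hB x.
rewrite ltNge; apply/negP => k0; have := lt_le_trans h2 h1.
by rewrite ltNge => /negP; apply; rewrite mulr_le0_ge0.
Qed.

Lemma wmin_disc_super : disc_super A h l (wmin A h l).
Proof.
split.
  have [w hw] := Sne; have [[B hB] _] := hw; exists B => x; rewrite wmin_ge0 /=.
  by apply: le_trans (wmin_le x hw) _; have /andP[] := hB x.
move=> x Ax; apply/(disc_superE A).
rewrite -ler_pdivrMl ?kappa_gt0 // mulrC; apply: lb_le_inf; first by case: (S_inf x).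
move=> _ [w hw <-]; rewrite mulrC ler_pdivrMl ?kappa_gt0 //.
have [_ /(_ x Ax)/(disc_superE A)] := hw; apply: le_trans.
by rewrite lerD2l; apply: nbr_le; [move=> y _; exact: wmin_le | rewrite gt_eqF].
Qed.

(** Replacing a supersolution by 0 outside [A] only lowers neighbouring values, hence leaves a
    supersolution. *)
Lemma wmin_out x : ~ A x -> wmin A h l x = 0.
Proof.
move=> nAx; apply/le_anti; rewrite wmin_ge0 andbT.
have [w0 [[B hB] hw]] := Sne.
pose w y := if `[< A y >] then w0 y else 0.
have ww y : 0 <= w y <= w0 y.
  by rewrite /w; have /andP[h1 _] := hB y; case: asboolP => _; rewrite ?lexx ?h1.
rewrite (_ : 0 = w x); last by rewrite /w; case: asboolP.
apply: wmin_le; split.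
  exists B => y; have /andP[h1 h2] := ww y; rewrite h1 /=; apply: le_trans h2 _.
  by have /andP[] := hB y.
move=> y Ay; have /(disc_superE A) := hw y Ay; rewrite (disc_superE A).
rewrite (_ : w0 y = w y); last by rewrite /w; case: asboolP.
apply: le_trans; rewrite lerD2l; apply: nbr_le; last by rewrite gt_eqF.
by move=> z _; have /andP[] := ww z.
Qed.

(** Perron's argument: were the inequality strict at [x], lowering the single value there to [v]
    would give a smaller supersolution. *)
Lemma wmin_eq x : A x -> lap h (wmin A h l) x = - (h ^+ 2 * (l * wmin A h l x + 1)).
Proof.
move=> Ax; have [[B hB] hsup] := wmin_disc_super; apply/le_anti/andP; split.
  by rewrite lerNr hsup.
have k0 := kappa_gt0.
set k := 2 * N%:R - h ^+ 2 * l in k0.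
pose v := k^-1 * (h ^+ 2 + nbr h (wmin A h l) x).
have vle : v <= wmin A h l x.
  by rewrite /v ler_pdivrMl //; apply/(disc_superE A)/hsup.
have v0 : 0 <= v.
  rewrite mulr_ge0 ?invr_ge0 ?(ltW k0) // addr_ge0 ?sqr_ge0 // sumr_ge0 // => i _.
  by rewrite addr_ge0 ?wmin_ge0.
pose w y := if y == x then v else wmin A h l y.
have wle y : 0 <= w y <= wmin A h l y.
  by rewrite /w; case: eqP => [->|_]; rewrite ?v0 ?vle ?lexx ?wmin_ge0.
have hw : disc_super A h l w.
  split.
    exists B => y; have /andP[h1 h2] := wle y; rewrite h1 /=; apply: le_trans h2 _.
    by have /andP[] := hB y.
  move=> y Ay; apply/(disc_superE A).
  have hn : nbr h w y <= nbr h (wmin A h l) y.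
    by apply: nbr_le; [move=> z _; have /andP[] := wle z | rewrite gt_eqF].
  rewrite {2}/w; case: eqP => [yx|_].
    by rewrite yx in hn *; rewrite /v mulrA mulfV ?gt_eqF // mul1r lerD2l.
  by have /(disc_superE A) := hsup y Ay; apply: le_trans; rewrite lerD2l.
have := wmin_le x hw; rewrite /w eqxx => h1.
have : k * wmin A h l x <= h ^+ 2 + nbr h (wmin A h l) x.
  by rewrite -ler_pdivlMl.
by rewrite /k /nbr lap_nbr; lra.
Qed.

End Fixed.

Lemma disc_super_mono A h l l' w : l' <= l -> disc_super A h l w -> disc_super A h l' w.
Proof.
move=> ll [[B hB] hw]; split; first by exists B.
move=> x Ax; apply: le_trans (hw x Ax); rewrite ler_wpM2l ?sqr_ge0 // lerD2r ler_wpM2r //.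
by have /andP[] := hB x.
Qed.

(* If minimal supersolutions exist and are bounded by b at parameter l, then
   doubling them gives a supersolution at parameter l + 1/(2b). *)
Lemma min_super_blowup A (h l0 b : R) : 0 < h -> A !=set0 -> 0 <= l0 -> 0 < b ->
  (exists w, disc_super A h 0 w) ->
  exists l w, [/\ 0 <= l <= l0, exists B, forall x, 0 <= w x <= B,
    forall x, ~ A x -> w x = 0,
    forall x, A x -> lap h w x = - (h ^+ 2 * (l * w x + 1)) &
    l = l0 \/ exists2 x, A x & b <= w x].
Proof.
move=> h0 Ane l00 b0 S0.
have sol l : (exists w, disc_super A h l w) -> [/\ exists B, forall x, 0 <= wmin A h l x <= B,
    forall x, ~ A x -> wmin A h l x = 0 &
    forall x, A x -> lap h (wmin A h l) x = - (h ^+ 2 * (l * wmin A h l x + 1))].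
  move=> hs; split.
  - by case: (wmin_disc_super h0 Ane hs).
  - by move=> x nA; apply: wmin_out.
  - by move=> x Ax; apply: wmin_eq.
pose E := [set l | 0 <= l <= l0 /\ exists w, disc_super A h l w].
have E0 : E 0 by split=> //; rewrite lexx.
have [E1|nE1] := pselect (E l0).
  have [h1 h2 h3] := sol l0 E1.2.
  by exists l0, (wmin A h l0); split=> //; [rewrite l00 lexx | left].
have ubE : has_sup E.
  by split; [exists 0 | exists l0 => l [/andP[]]].
have e0 : 0 < (2 * b)^-1 by rewrite invr_gt0 mulr_gt0.
have [l [lE hs] sl] := sup_adherent e0 ubE.
have [h1 h2 h3] := sol l hs.
exists l, (wmin A h l); split=> //; right; apply: contrapT => nb.
have hb x : wmin A h l x <= b.
  have [Ax|nAx] := pselect (A x); last by rewrite h2 // ltW.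
  by rewrite leNgt; apply/negP => bx; apply: nb; exists x => //; exact: ltW.
pose l' := l + (2 * b)^-1.
have w0 x : 0 <= wmin A h l x by have [B hB] := h1; have /andP[] := hB x.
have S' : disc_super A h l' (fun x => 2 * wmin A h l x).
  split.
    have [B hB] := h1; exists (2 * B) => x; have /andP[a1 a2] := hB x.
    by rewrite mulr_ge0 //= ler_pM2l.
  move=> x Ax; rewrite lapZ h3 //.
  suff Q : 0 <= 2 * (l * wmin A h l x + 1) - (l' * (2 * wmin A h l x) + 1).
    by have := mulr_ge0 (sqr_ge0 h) Q; clear; lra.
  have : (2 * b)^-1 * (2 * wmin A h l x) <= 1.
    rewrite invfM mulrACA mulVf ?mul1r // -(mulVf (lt0r_neq0 b0)) ler_wpM2l ?hb //.
    by rewrite invr_ge0 ltW.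
  by rewrite /l' mulrDl; clear; lra.
have /andP[l0' ll0] := lE.
have [l'l|ll'] := leP l' l0.
  have : E l' by split; [rewrite l'l andbT addr_ge0 // ltW | exists (fun x => 2 * wmin A h l x)].
  move=> El'; have : l' <= sup E by apply: ub_le_sup => //; case: ubE.
  by rewrite leNgt => /negP; apply; move: sl; rewrite /l'; clear; lra.
apply: nE1; split; first by rewrite l00 lexx.
by exists (fun x => 2 * wmin A h l x); apply: disc_super_mono S'; exact: ltW.
Qed.

(** The paraboloid [(B - |x|^2) / (2 N)] has the exact second difference [- h^2]. It is cut off at
    distance 1 from the ball containing [A], which grid neighbours do not exceed since [h <= 1]. *)
Lemma disc_super0 A (h M : R) : (0 < N)%N -> 0 < h <= 1 -> (forall x, A x -> `|x| <= M) ->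
  exists w, disc_super A h 0 w.
Proof.
move=> N0 /andP[h0 h1] hM.
have n0 : 0 < 2 * N%:R :> R by rewrite mulr_gt0 // ltr0n.
pose B := N%:R * (M + 1) ^+ 2.
pose w x := if `|x| <= M + 1 then (2 * N%:R)^-1 * (B - sqn x) else 0.
have B0 : 0 <= B by rewrite mulr_ge0 ?sqr_ge0.
exists w; split.
  exists ((2 * N%:R)^-1 * B) => x; rewrite /w; case: ifP => [xM|_].
    rewrite mulr_ge0 ?invr_ge0 ?(ltW n0) ?subr_ge0 ?sqn_le //=.
    by rewrite ler_pM2l ?invr_gt0 // gerBl sqn_ge0.
  by rewrite lexx /= mulr_ge0 ?invr_ge0 // ltW.
move=> x Ax; have xM := hM x Ax.
have wE y : `|y - x| <= 1 -> w y = (2 * N%:R)^-1 * (B - sqn y).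
  move=> yx; rewrite /w ifT // -(subrK x y); apply: le_trans (ler_normD _ _) _.
  by move: yx xM; clear; lra.
have -> : lap h w x = lap h (fun y => (2 * N%:R)^-1 * (B - sqn y)) x.
  apply: eq_bigr => i _; rewrite !wE //.
  - by rewrite subrr normr0.
  - by rewrite addrAC subrr add0r normrN norm_ebase gtr0_norm.
  - by rewrite addrAC subrr add0r norm_ebase gtr0_norm.
rewrite lapZ (lapB h (fun=> B)).
have -> : lap h (fun=> B) x = 0 by rewrite /lap big1 // => i _; ring.
have -> : lap h sqn x = 2 * N%:R * h ^+ 2.
  rewrite /lap (eq_bigr (fun=> 2 * h ^+ 2)); last by move=> i _; rewrite -scaleNr !sqn_ebase; ring.
  by rewrite sumr_const card_ord -[_ *+ N]mulr_natl; ring.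
by rewrite mul0r add0r mulr1 sub0r mulrN opprK mulrA mulVf ?mul1r // gt_eqF.
Qed.

End MinimalSupersolution.

(** * Passage to the limit in the mesh size *)

Section Rounding.
Context {R : realType} {N : nat}.
Implicit Types (x y c : 'rV[R]_N) (i j : 'I_N).

(** Grid functions are handled as step functions invariant under [rnd], so that functions for
    different meshes live on the same space and limits can be taken at every point. *)
Definition rnd (h : R) x : 'rV[R]_N := \row_i (h * (Num.floor (x 0 i / h))%:~R).

Lemma rnd_step (h : R) x j (m : int) : 0 < h ->
  rnd h (x + (m%:~R * h) *: ebase j) = rnd h x + (m%:~R * h) *: ebase j.
Proof.
move=> h0; apply/rowP => i; rewrite coord_step !mxE eqxx /= eq_sym.
have -> : (x 0 i + m%:~R * h * (j == i)%:R) / h = x 0 i / h + (m *+ (j == i))%:~R.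
  by case: (j == i); rewrite ?mulr1n ?mulr0n ?mulr1 ?mulr0; field; rewrite gt_eqF.
rewrite floorDrz ?intr_int // intrKfloor intrD mulrDr; congr (_ + _).
by case: (j == i); rewrite ?mulr1n ?mulr0n ?mulr1 ?mulr0 // mulrC.
Qed.

Lemma rnd_near (h : R) x : 0 < h -> `|rnd h x - x| <= h.
Proof.
move=> h0; apply: norm_rV_le => [|i]; first exact: ltW.
rewrite !mxE.
have h1 := floor_le (x 0 i / h); have h2 := floorD1_gt (x 0 i / h).
set k := Num.floor _ in h1 h2 *; rewrite intrD in h2.
rewrite ler_pdivlMr // in h1; rewrite ltr_pdivrMr // in h2.
by rewrite ler_norml; apply/andP; split; move: h1 h2; clear; lra.
Qed.

Lemma rnd_id (h : R) x : 0 < h -> rnd h (rnd h x) = rnd h x.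
Proof.
move=> h0; apply/rowP => i; rewrite !mxE; congr (h * _).
by rewrite mulrAC divff ?gt_eqF // mul1r intrKfloor.
Qed.

Lemma rnd_ex (h s : R) x j : 0 < h -> 0 <= s -> exists k : nat,
  `|k%:R * h - s| <= h /\ rnd h (x + s *: ebase j) = rnd h (x + (k%:R * h) *: ebase j).
Proof.
move=> h0 s0; pose a := Num.floor (x 0 j / h); pose b := Num.floor ((x 0 j + s) / h).
have ab : a <= b by apply: le_floor; rewrite ler_pM2r ?invr_gt0 // lerDl.
have [k kE] : exists k : nat, b - a = k%:Z.
  by exists `|b - a|%N; rewrite gez0_abs // subr_ge0.
have kR : k%:R = b%:~R - a%:~R :> R by rewrite -[k%:R]/(k%:Z%:~R) -kE rmorphB.
exists k; split.
  have h1 := floor_le (x 0 j / h); have h2 := floorD1_gt (x 0 j / h).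
  have h3 := floor_le ((x 0 j + s) / h); have h4 := floorD1_gt ((x 0 j + s) / h).
  rewrite -/a -/b !intrD in h1 h2 h3 h4; rewrite kR.
  rewrite !ler_pdivlMr // in h1 h3; rewrite !ltr_pdivrMr // in h2 h4.
  by rewrite ler_norml; apply/andP; split; move: h1 h2 h3 h4; clear; lra.
rewrite (rnd_step x j k) //; apply/rowP => i; rewrite coord_step !mxE eqxx /= eq_sym.
case: (j =P i) => [<-|_]; last by rewrite !mulr0 !addr0.
rewrite !mulr1 -/a -/b; move: kR; rewrite -[k%:R]/(k%:Z%:~R) => ->; ring.
Qed.

(** A displacement [s] ends in the same cell as a whole number of grid steps, off by at most [h];
    the quotients are then summed along these steps. *)
Lemma disc_lip (h rr M : R) f x0 j : 0 < h -> 0 <= M -> (forall x, f (rnd h x) = f x) ->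
  (forall x, `|x - x0| <= rr -> `|dquot1 h j f x| <= M) ->
  forall x s, 0 <= s -> `|x - x0| <= rr -> `|x + s *: ebase j - x0| <= rr ->
  `|f (x + s *: ebase j) - f x| <= M * (s + h) /\
  forall k, (k%:R * h <= s + h) -> `|f (x + (k%:R * h) *: ebase j) - f x| <= M * (k%:R * h).
Proof.
move=> h0 M0 fr hd x s s0 xr xsr.
have seg t : 0 <= t -> t <= s -> `|x + t *: ebase j - x0| <= rr.
  move=> t0 ts; apply: norm_rV_le => [|i]; first exact: le_trans xr.
  have := le_trans (coord_le (x - x0) i) xr; have := le_trans (coord_le (x + s *: ebase j - x0) i) xsr.
  have E u : (x + u *: ebase j - x0) 0 i = x 0 i - x0 0 i + u * (j == i)%:R.
    by rewrite addrAC coord_step !mxE.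
  rewrite !E !mxE; case: (j == i); rewrite ?mulr1 ?mulr0 ?addr0 //.
  by rewrite !ler_norml => /andP[h1 h2] /andP[h3 h4]; apply/andP; split; move: t0 ts h1 h2 h3 h4; clear; lra.
have K k : (k%:R * h <= s + h) -> `|f (x + (k%:R * h) *: ebase j) - f x| <= M * (k%:R * h).
  elim: k => [|k IH] hk; first by rewrite !mul0r scale0r addr0 subrr normr0 mulr0.
  have hk1 : k%:R * h <= s by move: hk; rewrite -natr1; clear; lra.
  have -> : x + (k.+1%:R * h) *: ebase j = x + (k%:R * h) *: ebase j + h *: ebase j.
    by rewrite -addrA -scalerDl -natr1 mulrDl mul1r.
  have := hd _ (seg _ (mulr_ge0 (ler0n _ k) (ltW h0)) hk1).
  rewrite /dquot1 normrM normfV (gtr0_norm h0) mulrC ler_pdivrMr // => h1.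
  have h2 := IH (le_trans hk1 (ler_wpDr (ltW h0) (lexx s))).
  set u := f (x + (k%:R * h) *: ebase j) in h1 h2 *; rewrite -natr1.
  have := ler_normD (f (x + (k%:R * h) *: ebase j + h *: ebase j) - u) (u - f x).
  rewrite addrA subrK; move: h1 h2; clear; lra.
split=> //; have [k [hk E]] := rnd_ex x j h0 s0.
rewrite -fr E fr; move: hk; rewrite ler_norml => /andP[_ hk].
have hk' : k%:R * h <= s + h by move: hk; clear; lra.
by apply: le_trans (K k hk') _; rewrite ler_wpM2l.
Qed.

Lemma disc_taylor (h rr M1 M2 : R) f x0 j : 0 < h -> 0 <= M1 -> 0 <= M2 -> (forall x, f (rnd h x) = f x) ->
  (forall x, `|x - x0| <= rr -> `|dquot1 h j f x| <= M1) ->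
  (forall x, `|x - x0| <= rr -> `|dquot1 h j (dquot1 h j f) x| <= M2) ->
  forall x s, 0 <= s -> `|x - x0| <= rr -> `|x + s *: ebase j - x0| <= rr ->
  `|f (x + s *: ebase j) - f x - s * dquot1 h j f x| <= M2 * (s + h) ^+ 2 + h * M1.
Proof.
move=> h0 M10 M20 fr hd1 hd2 x s s0 xr xsr.
have gr y : dquot1 h j f (rnd h y) = dquot1 h j f y.
  have E := rnd_step y j 1 h0; rewrite !mul1r in E.
  by rewrite /dquot1 -E !fr.
have [_ K] := disc_lip h0 M20 gr hd2 s0 xr xsr.
set g := dquot1 h j f in K gr *.
have S k : k%:R * h <= s + h ->
    `|f (x + (k%:R * h) *: ebase j) - f x - k%:R * h * g x| <= M2 * (k%:R * h) ^+ 2.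
  elim: k => [|k IH] hk; first by rewrite !mul0r scale0r addr0 subrr subr0 normr0 expr0n /= mulr0.
  have hk1 : k%:R * h <= s + h by apply: le_trans hk; rewrite ler_pM2r // ler_nat.
  have -> : x + (k.+1%:R * h) *: ebase j = x + (k%:R * h) *: ebase j + h *: ebase j.
    by rewrite -addrA -scalerDl -natr1 mulrDl mul1r.
  have h1 := K k hk1; have h2 := IH hk1.
  set y := x + _ *: _ in h1 h2 *.
  have E : f (y + h *: ebase j) = f y + h * g y by rewrite /g /dquot1 mulVKf ?gt_eqF // [RHS]addrC subrK.
  rewrite E -natr1; have -> : f y + h * g y - f x - (k%:R + 1) * h * g x =
    (f y - f x - k%:R * h * g x) + h * (g y - g x) by ring.
  apply: le_trans (ler_normD _ _) _; rewrite normrM (gtr0_norm h0).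
  have h3 : h * `|g y - g x| <= h * (M2 * (k%:R * h)) by rewrite ler_pM2l.
  have h4 : 0 <= M2 * (k%:R * h) * h by rewrite !mulr_ge0 // ltW.
  have h5 : 0 <= M2 * h ^+ 2 by rewrite mulr_ge0 // sqr_ge0.
  by rewrite [(_ + 1) * h]mulrDl mul1r sqrrD; move: h2 h3 h4 h5; clear; lra.
have [k [hk E]] := rnd_ex x j h0 s0.
have hk' : k%:R * h <= s + h by move: hk; rewrite ler_norml => /andP[_]; clear; lra.
rewrite -fr E fr.
have -> : f (x + (k%:R * h) *: ebase j) - f x - s * g x =
  (f (x + (k%:R * h) *: ebase j) - f x - k%:R * h * g x) + (k%:R * h - s) * g x by ring.
apply: le_trans (ler_normD _ _) _; apply: lerD.
  apply: le_trans (S k hk') _; rewrite ler_wpM2l // ler_sqr ?nnegrE ?addr_ge0 ?mulr_ge0 //; exact: ltW.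
by rewrite normrM ler_pM // /g hd1.
Qed.

End Rounding.

(** * Limits of grid functions and of their difference quotients *)

Section Limits.
Context {R : realType} {N : nat}.
Implicit Types (x y c : 'rV[R]_N) (i j : 'I_N) (f : nat -> 'rV[R]_N -> R).

Definition mesh n : R := n.+1%:R^-1.

Lemma mesh_gt0 n : 0 < mesh n. Proof. by rewrite invr_gt0. Qed.

Definition Ulim (a : nat -> R) : R := lim (a @ Uf).

Lemma Ulim_eq a l : a @ Uf --> l -> Ulim a = l.
Proof. by move=> h; apply: cvg_lim h. Qed.

Lemma UlimP a M : (\forall n \near Uf, `|a n| <= M) -> a @ Uf --> Ulim a.
Proof. by move=> /Uf_bounded[l hl]; rewrite (Ulim_eq hl). Qed.

Lemma Uf_le (a b : nat -> R) l m : a @ Uf --> l -> b @ Uf --> m ->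
  (\forall n \near Uf, a n <= b n) -> l <= m.
Proof. by move=> ha hb hab; apply: (ler_cvg_to ha hb hab). Qed.

Lemma Uf_norm_le (a b : nat -> R) l m : a @ Uf --> l -> b @ Uf --> m ->
  (\forall n \near Uf, `|a n| <= b n) -> `|l| <= m.
Proof. by move=> ha hb hab; apply: (Uf_le (cvg_norm ha) hb hab). Qed.

Definition ubd x0 (rr : R) f M := \forall n \near Uf, forall x, `|x - x0| <= rr -> `|f n x| <= M.

Definition dquot j f n := dquot1 (mesh n) j (f n).

Definition flim f x := Ulim (f ^~ x).

Definition grid_inv f := forall n x, f n (rnd (mesh n) x) = f n x.

Lemma grid_invD f j : grid_inv f -> grid_inv (dquot j f).
Proof.
move=> fr n x; have E := rnd_step x j 1 (mesh_gt0 n); rewrite !mul1r in E.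
by rewrite /dquot /dquot1 -E !fr.
Qed.

Lemma flim_cvg x0 rr f M x : ubd x0 rr f M -> `|x - x0| <= rr -> (f ^~ x) @ Uf --> flim f x.
Proof. by move=> hf xr; apply: (@UlimP _ M); apply: filterS hf => n; apply. Qed.

Lemma step_back x s j : x + s *: ebase j + (- s) *: ebase j = x.
Proof. by rewrite -addrA -scalerDl subrr scale0r addr0. Qed.

Lemma flim_lip x0 rr f M0 M1 j x s : grid_inv f -> 0 <= M1 -> ubd x0 rr f M0 -> ubd x0 rr (dquot j f) M1 ->
  `|x - x0| <= rr -> `|x + s *: ebase j - x0| <= rr ->
  `|flim f (x + s *: ebase j) - flim f x| <= M1 * `|s|.
Proof.
move=> fr M10 hf hd; wlog s0 : x s / 0 <= s.
  move=> W xr xsr; have [s0|s0] := leP 0 s; first exact: W.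
  have := W (x + s *: ebase j) (- s); rewrite step_back normrN [`|flim f x - _|]distrC.
  by apply=> //; rewrite oppr_ge0 ltW.
move=> xr xsr; rewrite (ger0_norm s0).
have h1 : (fun n => f n (x + s *: ebase j) - f n x) @ Uf --> flim f (x + s *: ebase j) - flim f x.
  by apply: cvgB; apply: flim_cvg; eauto.
have h2 : (fun n => M1 * (s + mesh n)) @ Uf --> M1 * (s + 0).
  by apply: cvgM; [exact: cvg_cst | apply: cvgD; [exact: cvg_cst | exact: Uf_inv]].
rewrite addr0 in h2; apply: (Uf_norm_le h1 h2); apply: filterS hd => n hd.
by have [] := disc_lip (mesh_gt0 n) M10 (fr n) hd s0 xr xsr.
Qed.

(** The factor 2 comes from negative [s]: the forward estimate is then based at the other endpoint,
    and moving the quotient back costs another [M2 s^2]. *)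
Lemma flim_taylor x0 rr f M0 M1 M2 j x s : grid_inv f -> 0 <= M1 -> 0 <= M2 -> ubd x0 rr f M0 ->
  ubd x0 rr (dquot j f) M1 -> ubd x0 rr (dquot j (dquot j f)) M2 ->
  `|x - x0| <= rr -> `|x + s *: ebase j - x0| <= rr ->
  `|flim f (x + s *: ebase j) - flim f x - s * flim (dquot j f) x| <= 2 * M2 * s ^+ 2.
Proof.
move=> fr M10 M20 hf hd hd2.
have W t y : 0 <= t -> `|y - x0| <= rr -> `|y + t *: ebase j - x0| <= rr ->
    `|flim f (y + t *: ebase j) - flim f y - t * flim (dquot j f) y| <= M2 * t ^+ 2.
  move=> t0 yr ytr.
  have h1 : (fun n => f n (y + t *: ebase j) - f n y - t * dquot j f n y) @ Uf -->
      flim f (y + t *: ebase j) - flim f y - t * flim (dquot j f) y.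
    apply: cvgB; first by apply: cvgB; apply: flim_cvg; eauto.
    by apply: cvgM; [exact: cvg_cst | apply: flim_cvg; eauto].
  have h2 : (fun n => M2 * (t + mesh n) ^+ 2 + mesh n * M1) @ Uf --> M2 * (t + 0) ^+ 2 + 0 * M1.
    apply: cvgD; apply: cvgM; [exact: cvg_cst| | exact: Uf_inv | exact: cvg_cst].
    by apply: cvg_sqr; apply: cvgD; [exact: cvg_cst | exact: Uf_inv].
  rewrite addr0 mul0r addr0 in h2; apply: (Uf_norm_le h1 h2).
  apply: filterS (filterI hd hd2) => n [hd' hd2'].
  exact: (disc_taylor (mesh_gt0 n) M10 M20 (fr n) hd' hd2' t0 yr ytr).
move=> xr xsr; have [s0|s0] := leP 0 s.
  by apply: le_trans (W s x s0 xr xsr) _; rewrite ler_wpM2r ?sqr_ge0 //; move: M20; clear; lra.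
have s0' : 0 <= - s by rewrite oppr_ge0 ltW.
have := W (- s) (x + s *: ebase j) s0' xsr.
rewrite step_back sqrrN => /(_ xr) h1.
have h2 := flim_lip (grid_invD j fr) M20 hd hd2 xr xsr; rewrite (ltr0_norm s0) in h2.
have -> : flim f (x + s *: ebase j) - flim f x - s * flim (dquot j f) x =
  - (flim f x - flim f (x + s *: ebase j) - - s * flim (dquot j f) (x + s *: ebase j)) +
  s * (flim (dquot j f) (x + s *: ebase j) - flim (dquot j f) x) by ring.
apply: le_trans (ler_normD _ _) _; rewrite normrN normrM (ltr0_norm s0).
have h3 : - s * `|flim (dquot j f) (x + s *: ebase j) - flim (dquot j f) x| <= - s * (M2 * - s).
  by rewrite ler_wpM2l.
by move: h1 h3; clear; lra.
Qed.

Lemma in_cube y x0 (rr : R) j s : `|s| < rr - `|y - x0| -> `|y + s *: ebase j - x0| <= rr.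
Proof.
move=> h; rewrite addrAC; apply: le_trans (ler_normD _ _) _; rewrite norm_ebase.
by move: h; clear; lra.
Qed.

Lemma flim_derive x0 rr f M0 M1 M2 j y : grid_inv f -> 0 <= M1 -> 0 <= M2 -> ubd x0 rr f M0 ->
  ubd x0 rr (dquot j f) M1 -> ubd x0 rr (dquot j (dquot j f)) M2 -> `|y - x0| < rr ->
  is_derive y (ebase j) (flim f) (flim (dquot j f) y).
Proof.
move=> fr M10 M20 hf hd hd2 yr; apply/is_derive_jet1 => e e0.
have K0 : 0 < 2 * M2 + 1 by move: M20; clear; lra.
exists (Num.min (rr - `|y - x0|) (e / (2 * M2 + 1))).
  by rewrite lt_min subr_gt0 yr divr_gt0.
move=> s; rewrite lt_min => /andP[s1 s2]; rewrite scale0r addr0.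
have := flim_taylor fr M10 M20 hf hd hd2 (ltW yr) (in_cube j s1).
rewrite [s * _]mulrC => /le_trans; apply; rewrite -(real_normK (num_real s)) expr2 mulrA.
rewrite ltr_pdivlMr // in s2; rewrite ler_wpM2r //.
have := normr_ge0 s; move: s2; clear; lra.
Qed.

Lemma flim_cont x0 rr f M0 (M1 : R) y : grid_inv f -> 0 <= M1 -> ubd x0 rr f M0 ->
  (forall j, ubd x0 rr (dquot j f) M1) -> `|y - x0| < rr -> {for y, continuous (flim f)}.
Proof.
move=> fr M10 hf hd yr; apply: cont_eps => e e0.
have dl0 : 0 < rr - `|y - x0| by rewrite subr_gt0.
have K0 : 0 < M1 * N%:R + 1 by rewrite ltr_wpDl // mulr_ge0.
exists (Num.min (rr - `|y - x0|) (e / (M1 * N%:R + 1))).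
  by rewrite lt_min dl0 divr_gt0.
move=> z; rewrite lt_min => /andP[z1 z2]; rewrite ltr_pdivlMr // in z2.
have inb u : `|u - y| < rr - `|y - x0| -> `|u - x0| <= rr.
  move=> h; rewrite -(subrK y u) -addrA; apply: le_trans (ler_normD _ _) _.
  by move: h; clear; lra.
have := @coord_total R N (flim f) (fun=> 0) y _ M1 _ (z - y) z1.
rewrite big1 => [|i _]; last by rewrite mulr0.
rewrite addrCA subrr addr0 subr0 => H; apply: le_lt_trans (H _) _.
  move=> u i s u1 u2; rewrite mulr0 subr0.
  exact: (flim_lip fr M10 hf (hd i) (inb _ u1) (inb _ u2)).
apply: le_lt_trans (_ : M1 * (N%:R * `|z - y|) < e).
  by rewrite ler_wpM2l // sum_norm_le.
by have := normr_ge0 (z - y); move: z2; clear; lra.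
Qed.

Lemma lap_dquot2 (h : R) (w : 'rV[R]_N -> R) x : 0 < h ->
  lap h w x = h ^+ 2 * \sum_i dquot1 h i (dquot1 h i w) (x - h *: ebase i).
Proof.
move=> h0; rewrite /lap mulr_sumr; apply: eq_bigr => i _; rewrite /dquot1 subrK.
by field; rewrite gt_eqF.
Qed.

(** Three uses of [disc_step] bound the quotients up to order 3, while the cube shrinks from [8 r]
    to [2 r]. Hence the limits of the quotients of order at most 2 are continuous, and each is the
    derivative of the preceding one. The third quotients also absorb the shift by one mesh between
    [lap] and the iterated forward quotient. *)
Lemma disc_limit f x0 (r M L : R) (l cc : nat -> R) : (0 < N)%N -> 0 < r -> 0 < M -> 0 <= L ->
  grid_inv f -> (forall n, 0 <= l n <= L) -> (forall n, 0 <= cc n <= 1) ->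
  (\forall n \near Uf, disc_eq (mesh n) x0 (8 * r) M (l n) (cc n) (f n)) ->
  forall y, `|y - x0| < 2 * r ->
  [/\ {for y, continuous (flim f)},
      forall i, is_derive y (ebase i) (flim f) (flim (dquot i f) y) /\ {for y, continuous (flim (dquot i f))},
      forall i j, is_derive y (ebase j) (flim (dquot i f)) (flim (dquot j (dquot i f)) y) /\
                  {for y, continuous (flim (dquot j (dquot i f)))} &
      \sum_i flim (dquot i (dquot i f)) y = - (Ulim l * flim f y + Ulim cc)].
Proof.
move=> N0 r0 M0 L0 fr hl hc hf y yr.
pose K (m : R) : R := r * (L * m + 1) + (2 * N%:R + 2) * m / r.
have K0 m : 0 < m -> 0 < K m.
  by move=> m0; rewrite ltr_wpDr ?mulr_gt0 // ?divr_ge0 ?mulr_ge0 ?addr_ge0 ?mulr_ge0 ?(ltW m0) ?(ltW r0) // ltr_wpDl // ?mulr_ge0 // ltW.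
have hsm : \forall n \near Uf, 2 * mesh n <= r.
  have /cvgrPdist_lt/(_ (r / 2)) := @Uf_inv R; rewrite divr_gt0 // => /(_ isT).
  apply: filterS => n; rewrite sub0r normrN gtr0_norm ?mesh_gt0 // -/(mesh n).
  by clear; lra.
have step g rr m (c' : nat -> R) i : 0 < m -> (forall n, 0 <= c' n <= 1) ->
    (\forall n \near Uf, disc_eq (mesh n) x0 rr m (l n) (c' n) (g n)) ->
    \forall n \near Uf, disc_eq (mesh n) x0 (rr - 2 * r) (K m) (l n) 0 (dquot i g n).
  move=> m0 hc' hg; apply: filterS (filterI hsm hg) => n [h1 h2].
  exact: (disc_step i N0 (mesh_gt0 n) h1 m0 (hl n) (hc' n) h2).
have z01 : forall n : nat, 0 <= (0 : R) <= 1 by rewrite lexx ler01.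
have toU g rr m (c' : nat -> R) : 2 * r <= rr ->
    (\forall n \near Uf, disc_eq (mesh n) x0 rr m (l n) (c' n) (g n)) -> ubd x0 (2 * r) g m.
  by move=> h; apply: filterS => n hg x xr; have [] := hg x (le_trans xr h).
have s1 i := step f _ _ _ i M0 hc hf.
have s2 i j := step _ _ _ _ j (K0 _ M0) z01 (s1 i).
have s3 i j k := step _ _ _ _ k (K0 _ (K0 _ M0)) z01 (s2 i j).
have b0 : ubd x0 (2 * r) f M by apply: toU hf; move: r0; clear; lra.
have b1 i : ubd x0 (2 * r) (dquot i f) (K M) by apply: toU (s1 i); move: r0; clear; lra.
have b2 i j : ubd x0 (2 * r) (dquot j (dquot i f)) (K (K M)) by apply: toU (s2 i j); move: r0; clear; lra.
have b3 i j k : ubd x0 (2 * r) (dquot k (dquot j (dquot i f))) (K (K (K M))).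
  by apply: toU (s3 i j k); move: r0; clear; lra.
have k1 := ltW (K0 _ M0); have k2 := ltW (K0 _ (K0 _ M0)).
have k3 := ltW (K0 _ (K0 _ (K0 _ M0))).
have g1 i := grid_invD i fr; have g2 i j := grid_invD j (g1 i).
split.
- exact: (flim_cont fr k1 b0 b1 yr).
- by move=> i; split; [exact: (flim_derive fr k1 k2 b0 (b1 i) (b2 i i) yr) | exact: (flim_cont (g1 i) k2 (b1 i) (b2 i) yr)].
- move=> i j; split; first exact: (flim_derive (g1 i) k2 k3 (b1 i) (b2 i j) (b3 i j j) yr).
  exact: (flim_cont (g2 i j) k3 (b2 i j) (b3 i j) yr).
have yr' := ltW yr.
have c1 : (fun n => - (l n * f n y + cc n)) @ Uf --> - (Ulim l * flim f y + Ulim cc).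
  apply: cvgN; apply: cvgD; last first.
    by apply: (@UlimP _ 1); apply: nearW => n; have /andP[? ?] := hc n; rewrite ger0_norm.
  apply: cvgM; last exact: (flim_cvg b0 yr').
  by apply: (@UlimP _ L); apply: nearW => n; have /andP[? ?] := hl n; rewrite ger0_norm.
have c2 : (fun n => \sum_i dquot i (dquot i f) n y) @ Uf --> \sum_i flim (dquot i (dquot i f)) y.
  by apply: cvg_sumf => i; apply: (flim_cvg (b2 i i) yr').
have c3 : (fun n => mesh n * (N%:R * K (K (K M)))) @ Uf --> 0 * (N%:R * K (K (K M))).
  by apply: cvgM; [exact: Uf_inv | exact: cvg_cst].
rewrite mul0r in c3.
have c4 : (fun n => \sum_i dquot i (dquot i f) n y - - (l n * f n y + cc n)) @ Uf -->
    \sum_i flim (dquot i (dquot i f)) y - - (Ulim l * flim f y + Ulim cc) by exact: cvgB c2 c1.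
apply/eqP; rewrite -subr_eq0 -normr_le0; apply: (Uf_norm_le c4 c3).
have b3' : \forall n \near Uf, forall i x, `|x - x0| <= 2 * r -> `|dquot i (dquot i (dquot i f)) n x| <= K (K (K M)).
  have : \forall n \near Uf, forall i, disc_eq (mesh n) x0 (8 * r - 2 * r - 2 * r - 2 * r) (K (K (K M))) (l n) 0 (dquot i (dquot i (dquot i f)) n).
    by apply: filter_forall => i; exact: s3.
  apply: filterS => n h i x xr; have [] // := h i x.
  by apply: le_trans xr _; move: r0; clear; lra.
have hsy : \forall n \near Uf, mesh n < 2 * r - `|y - x0|.
  have /cvgrPdist_lt/(_ (2 * r - `|y - x0|)) := @Uf_inv R; rewrite subr_gt0 => /(_ yr).
  by apply: filterS => n; rewrite sub0r normrN gtr0_norm ?mesh_gt0.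
apply: filterS (filterI hf (filterI b3' hsy)) => n [hfn [hb hy]].
have h0 := mesh_gt0 n; have yr8 : `|y - x0| <= 8 * r by move: yr' r0; clear; lra.
have [_] := hfn y yr8; rewrite lap_dquot2 // => E.
have -> : - (l n * f n y + cc n) = \sum_i dquot1 (mesh n) i (dquot1 (mesh n) i (f n)) (y - mesh n *: ebase i).
  have hne : mesh n ^+ 2 != 0 by rewrite gt_eqF // exprn_gt0.
  apply: (mulfI hne).
  by rewrite mulrN -E.
rewrite -sumrB mulrCA -[N in N%:R]card_ord mulr_natl -sumr_const.
apply: le_trans (ler_norm_sum _ _ _) _; apply: ler_sum => i _.
have hyi : `|y - mesh n *: ebase i - x0| <= 2 * r.
  by rewrite -scaleNr; apply: in_cube; rewrite normrN gtr0_norm.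
have := hb i _ hyi; rewrite /dquot {1}/dquot1 subrK normrM normfV (gtr0_norm h0).
by rewrite mulrC ler_pdivrMr // mulrC.
Qed.

End Limits.

(** * Normalised discrete solutions and their boundary barrier *)

Section DiscreteProblem.
Context {R : realType} {N : nat}.
Implicit Types (x y : 'rV[R]_N) (i j : 'I_N) (G : set 'rV[R]_N).

Lemma seg_bdry G x y : open G -> G x -> ~ G y ->
  exists2 t : R, 0 <= t <= 1 & bdry G (x + t *: (y - x)).
Proof.
move=> oG Gx nGy; pose S := [set t : R | 0 <= t <= 1 /\ G (x + t *: (y - x))].
have S0 : S 0 by split; [rewrite lexx ler01 | rewrite scale0r addr0].
have hS : has_sup S by split; [exists 0 | exists 1 => t [/andP[]]].
have t0 : 0 <= sup S by apply: ub_le_sup => //; case: hS.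
have t1 : sup S <= 1 by apply: ge_sup; [exists 0 | move=> t [/andP[]]].
exists (sup S); first by rewrite t0.
rewrite bdry_open //; split.
  have /choice[tn htn] : forall n : nat, exists t, S t /\ sup S - mesh n < t.
    by move=> n; have [t ? ?] := sup_adherent (mesh_gt0 n) hS; exists t.
  apply: (@closure_Uf _ _ _ (fun n => x + tn n *: (y - x))); last first.
    by apply: nearW => n; have [[]] := htn n.
  apply: cvgD; first exact: cvg_cst.
  apply: cvgZr_tmp; apply/cvgrPdist_lt => e e0.
  have /cvgrPdist_lt/(_ e e0) := @Uf_inv R; apply: filterS => n.
  rewrite sub0r normrN gtr0_norm ?mesh_gt0 // -/(mesh n) => h.
  have [St lt] := htn n; have := ub_le_sup (proj2 hS) St => h2.
  by rewrite ger0_norm ?subr_ge0 //; move: lt h; clear; lra.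
move=> Gs; have s1 : sup S < 1.
  rewrite lt_neqAle t1 andbT; apply/eqP => E; apply: nGy.
  by move: Gs; rewrite E scale1r addrC subrK.
have [r r0 hr] := line_in (y - x) oG Gs.
pose s := Num.min (r / 2) (1 - sup S).
have s0 : 0 < s by rewrite lt_min divr_gt0 //= subr_gt0.
have sr : `|s| < r.
  by rewrite gtr0_norm //; apply: le_lt_trans (_ : r / 2 < r); [rewrite ge_min lexx | move: r0; clear; lra].
have sle : s <= 1 - sup S by rewrite ge_min lexx orbT.
have : S (sup S + s).
  split; first by apply/andP; split; move: s0 t0 sle; clear; lra.
  by rewrite scalerDl addrA; apply: hr.
move=> /(ub_le_sup (proj2 hS)); move: s0; clear; lra.
Qed.

Lemma lap_rnd (h : R) v x : 0 < h -> lap h (fun y => v (rnd h y)) x = lap h v (rnd h x).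
Proof.
move=> h0; apply: eq_bigr => i _; congr (_ + _ - _); congr (v _).
  by have := rnd_step x i 1 h0; rewrite !mul1r.
by have := rnd_step x i (-1) h0; rewrite mulrN1z !mulN1r !scaleNr.
Qed.

Lemma normalized_super_ex G (h l0 M : R) : (0 < N)%N -> 0 < h <= 1 -> (forall x, G x -> `|x| <= M) -> 0 <= l0 ->
  exists (v : 'rV[R]_N -> R) (l c : R),
  [/\ 0 <= l <= l0, 0 <= c <= 1, forall x, 0 <= v x <= 1, forall x, v (rnd h x) = v x &
      forall x, ~ G (rnd h x) -> v x = 0] /\
  [/\ forall x, G (rnd h x) -> lap h v x = - (h ^+ 2 * (l * v x + c)), l = l0 \/ c <= h &
      c = 1 \/ exists x, [/\ G x, rnd h x = x & 1 / 2 <= v x]].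
Proof.
move=> N0 /[dup] h01 /andP[h0 h1] hM l00.
pose A := [set x | G x /\ rnd h x = x].
(* A coarse grid may have no node in [G]; the zero function then works with [c = 1]. *)
have [Ane|An] := pselect (A !=set0); last first.
  exists (fun=> 0), l0, 1; split; split=> //.
  - by rewrite l00 lexx.
  - by rewrite ler01 lexx.
  - by rewrite lexx ler01.
  - by move=> x Gx; case: An; exists (rnd h x); split=> //; rewrite rnd_id.
  - by left.
  - by left.
have S0 : exists w, disc_super A h 0 w by apply: (@disc_super0 _ _ A h M) => // x [/hM].
(* Blow-up threshold [1 / h]: once it is reached, the constant term left after normalisation is at
   most [h], hence 0 in the limit. *)
have hV0 : 0 < h^-1 by rewrite invr_gt0.
have [l [w [hl [B hB] wout weq wbig]]] := min_super_blowup h0 Ane l00 hV0 S0.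
pose W := [set w x | x in setT].
have W0 : W !=set0 by exists (w 0), 0.
have supW : has_sup W by split=> //; exists B => _ [x _ <-]; have /andP[] := hB x.
have wW x : w x <= sup W by apply: ub_le_sup; [case: supW | exists x].
(* [m] is the larger of 1 and [sup W]. After division by it either [c = 1] or some value is at least
   1/2, which prevents a trivial limit. *)
have [m [m1 wm mor]] : exists m, [/\ 1 <= m, forall x, w x <= m & m = 1 \/ exists2 x, A x & m <= 2 * w x].
  have [s1|s1] := leP (sup W) 1.
    by exists 1; split=> //; [move=> x; apply: le_trans s1 | left].
  exists (sup W); split=> //; [exact: ltW | right].
  have s0 : 0 < sup W / 2 by move: s1; clear; lra.
  have [_ [x _ <-] hx] := sup_adherent s0 supW.
  exists x; last by move: hx; clear; lra.
  apply: contrapT => /wout w0; move: hx; rewrite w0; move: s1; clear; lra.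
have m0 : 0 < m by apply: lt_le_trans m1.
have mV : 0 < m^-1 by rewrite invr_gt0.
exists (fun x => m^-1 * w (rnd h x)), l, m^-1; split; split.
- exact: hl.
- by rewrite ltW //= invf_le1.
- move=> x; have /andP[w0 _] := hB (rnd h x); rewrite mulr_ge0 ?(ltW mV) //=.
  by rewrite mulrC ler_pdivrMr // mul1r.
- by move=> x; rewrite rnd_id.
- by move=> x nG; rewrite wout ?mulr0 // => -[].
- move=> x Gx; rewrite (lapZ h m^-1 (fun y => w (rnd h y))) lap_rnd // weq; last by split=> //; rewrite rnd_id.
  ring.
- case: wbig => [->|[x Ax hx]]; [by left | right].
  by rewrite invf_ple ?posrE //; apply: le_trans hx (wm x).
- case: mor => [->|[x [Gx xE] hx]]; [by left; rewrite invr1 | right].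
  exists x; split=> //; rewrite xE [m^-1 * _]mulrC ler_pdivlMr //; move: hx; clear; lra.
Qed.

(* Discrete analogue of the barrier [2s - s^2], [s = k rho], up to an error O(h). *)
Lemma disc_barrier G (M l0 : R) rho g H : (0 < N)%N -> open G -> (forall x, G x -> `|x| <= M) ->
  dfun G rho g H -> 0 <= l0 ->
  exists K h0 : R, [/\ 0 < K, 0 < h0 & forall (h : R) (v : 'rV[R]_N -> R) (l c : R), 0 < h <= h0 -> 0 <= l <= l0 -> 0 <= c <= 1 ->
    (forall x, 0 <= v x <= 1) -> (forall x, ~ G (rnd h x) -> v x = 0) ->
    (forall x, G (rnd h x) -> lap h v x = - (h ^+ 2 * (l * v x + c))) ->
    forall x, G x -> rnd h x = x -> v x <= K * (rho x + h)].
Proof.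
move=> N0 oG hM dG l00.
have bG : bounded_set G by exists M; split; [exact: num_real | move=> m Mm x Gx; exact: le_trans (hM x Gx) (ltW Mm)].
have [c [C [dl [c0 C0 dl0 hC [hc _]]]]] := dfun_bounds bG dG.
have [h0 rpos rb _] := dG.
have [L L0 hL] := C3T_lip (M + 1) h0.
(* The second summand makes the concavity beat both the second derivatives of [rho] and the
   right-hand side; the third makes [k rho < 1 / 2] imply [rho < dl]. *)
pose k := 1 + (C + l0 + 2) / c + 1 / (2 * dl).
have kc : C + l0 + 2 <= k * c.
  have E : (C + l0 + 2) / c * c = C + l0 + 2 by rewrite divfK ?gt_eqF.
  rewrite /k 2!mulrDl E; have : 0 <= 1 / (2 * dl) * c by rewrite mulr_ge0 ?divr_ge0 ?mulr_ge0 // ltW.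
  by move: c0; clear; lra.
have k1 : 1 <= k.
  have : 0 <= (C + l0 + 2) / c by rewrite divr_ge0 ?ltW //; move: C0 l00; clear; lra.
  have : 0 <= 1 / (2 * dl) by rewrite divr_ge0 // mulr_ge0 // ltW.
  by rewrite /k; clear; lra.
have kdl : 1 / 2 <= k * dl.
  rewrite /k mulrDl (_ : 1 / (2 * dl) * dl = 1 / 2); last by field; rewrite gt_eqF.
  rewrite lerDr mulr_ge0 ?(ltW dl0) // addr_ge0 // divr_ge0 ?(ltW c0) //.
  by move: C0 l00; clear; lra.
clearbody k; have k0 : 0 < k by apply: lt_le_trans k1.
have hf := C3T_lin (2 * k) (- k ^+ 2) h0 (C3T_M h0 h0).
set f := (fun x => _) in hf; set Hf := (X in C3T _ _ X) in hf.
have [_ _ _ tf] := hf; have [Cf Cf0 hCf] := tf M.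
(* The second bound absorbs the cubic Taylor errors; the third limits the change of [k rho] over one
   grid step to 1/4. *)
pose hm := Num.min 1 (Num.min ((l0 + 2) / (4 * N%:R * Cf + 1)) (1 / (4 * k * L))).
have n0 : 0 <= N%:R :> R by [].
have d0 : 0 < 4 * N%:R * Cf + 1 by rewrite ltr_wpDl // !mulr_ge0.
have kL0 : 0 < 4 * k * L by rewrite !mulr_gt0.
exists (4 * k + 6 * k * L), hm; split.
- by rewrite addr_gt0 ?mulr_gt0.
- by rewrite !lt_min ltr01 !divr_gt0 //=; move: l00; clear; lra.
move=> h v l cc /andP[hp]; rewrite !le_min => /and3P[hh1 hh2 hh3] /andP[l_0 ll0] /andP[cc0 cc1] hv vout veq.
rewrite ler_pdivlMr // in hh2; rewrite ler_pdivlMr // in hh3.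
have fE x : f x = k * rho x * (2 - k * rho x) by rewrite /f; ring.
(* The factor 2 gives [b >= 1] as soon as a grid step has left [k rho < 1 / 2]. The term in [h]
   covers neighbours outside [G]: the grid edge crosses the boundary, so [|rho|] is at most [L h]
   there. *)
pose b x := 2 * f x + 6 * k * L * h.
pose B := [set x | [/\ G x, rnd h x = x & k * rho x < 1 / 2]].
have main x : B x -> v x - b x <= 0.
  have h20 : 0 < h ^+ 2 by rewrite exprn_gt0.
  apply: (@disc_max R N h B (fun x => v x - b x) 1 (h ^+ 2)) => //.
    move=> y [Gy _ ky]; have /andP[_ v1] := hv y.
    have : 0 <= f y by rewrite fE !mulr_ge0 ?(ltW k0) ?(ltW (rpos _ Gy)) //; move: ky; clear; lra.
    have : 0 <= 6 * k * L * h by rewrite !mulr_ge0 // ltW.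
    by rewrite /b; move: v1; clear; lra.
  move=> y [Gy yE ky] _; split.
    have lb : lap h b y = 2 * lap h f y.
      by rewrite -lapZ; apply: eq_bigr => i _; rewrite /b; ring.
    rewrite lapB lb veq ?yE //.
    have yM := hM y Gy; have h1' : `|h| <= 1 by rewrite gtr0_norm.
    have lf : lap h f y <= h ^+ 2 * (\sum_i Hf i y) + 2 * N%:R * (Cf * h ^+ 3).
      have -> : 2 * N%:R * (Cf * h ^+ 3) = \sum_(i < N) (2 * (Cf * h ^+ 3)).
        by rewrite sumr_const card_ord -mulr_natl; ring.
      rewrite mulr_sumr -big_split; apply: ler_sum => i _ /=.
      have e1 := hCf y i h yM h1'; have h1n : `|- h| <= 1 by rewrite normrN.
      have e2 := hCf y i (- h) yM h1n.
      rewrite -/(f _) -/(f _) -/(Hf _ _) scaleNr normrN sqrrN (gtr0_norm hp) in e2.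
      rewrite -/(f _) -/(f _) -/(Hf _ _) (gtr0_norm hp) in e1.
      move: e1 e2; rewrite !ler_norml => /andP[_ e1] /andP[_ e2].
      by move: e1 e2; clear; lra.
    have [_ _ hH] := hC y Gy.
    have sH : \sum_i Hf i y = 2 * k * (1 - k * rho y) * \sum_i H i y - 2 * k ^+ 2 * \sum_i g i y ^+ 2.
      by rewrite !mulr_sumr -sumrB; apply: eq_bigr => i _; rewrite /Hf; ring.
    have ry := rpos y Gy.
    have rdl : rho y < dl by rewrite -(ltr_pM2l k0); apply: lt_le_trans ky kdl.
    have gc := hc y Gy rdl.
    have kr : 0 <= k * rho y by rewrite mulr_ge0 // ltW.
    have s1 : (1 - k * rho y) * \sum_i H i y <= C.
      have : (1 - k * rho y) * \sum_i H i y <= (1 - k * rho y) * C.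
        rewrite ler_wpM2l //; first by move: ky; clear; lra.
        exact: le_trans (ler_norm _) hH.
      have := mulr_ge0 kr (ltW C0); clear; lra.
    have s2 : \sum_i Hf i y <= 2 * k * (C - k * c).
      have a1 : 2 * k * ((1 - k * rho y) * \sum_i H i y) <= 2 * k * C by rewrite ler_pM2l ?mulr_gt0.
      have a2 : 2 * k ^+ 2 * c <= 2 * k ^+ 2 * \sum_i g i y ^+ 2 by rewrite ler_pM2l ?mulr_gt0 ?exprn_gt0.
      by rewrite sH; move: a1 a2; clear; lra.
    have s3 : \sum_i Hf i y <= - 2 * (l0 + 2).
      have : 2 * (l0 + 2) <= 2 * k * (k * c - C).
        by apply: ler_pM => //; move: k1 kc l00; clear; lra.
      by move: s2; clear; lra.
    have s4 : l * v y + cc <= l0 + 1.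
      have /andP[v0 v1] := hv y.
      by apply: lerD => //; rewrite -[l0]mulr1 ler_pM.
    have s5 : h ^+ 2 * (\sum_i Hf i y) + 2 * N%:R * (Cf * h ^+ 3) <= h ^+ 2 * (- 2 * (l0 + 2) + (l0 + 2) / 2).
      have -> : 2 * N%:R * (Cf * h ^+ 3) = h ^+ 2 * (2 * N%:R * Cf * h) by ring.
      rewrite -mulrDr ler_pM2l // lerD //; move: hh2 hp; clear; lra.
    have s6 : h ^+ 2 * (l * v y + cc) <= h ^+ 2 * (l0 + 1) by rewrite ler_pM2l.
    have s7 : 0 <= h ^+ 2 * l0 by rewrite mulr_ge0 // ltW.
    by move: lf s5 s6 s7 h20; clear; lra.
  have nb y' : rnd h y' = y' -> `|y' - y| <= h -> B y' \/ v y' - b y' <= 0.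
    move=> y'E yy.
    have yM1 : `|y| <= M + 1 by have := hM y Gy; clear; lra.
    have y'M : `|y'| <= M + 1.
      by have := ler_normD y (y' - y); rewrite addrC subrK; have := hM y Gy; move: yy hh1; clear; lra.
    have kLh : k * L * h <= 1 / 4 by move: hh3; clear; lra.
    have kLh0 : 0 <= k * L * h by rewrite !mulr_ge0 // ltW.
    have [Gy'|nGy'] := pselect (G y'); last first.
      right; rewrite vout ?y'E // sub0r oppr_le0.
      have [t /andP[t0 t1] bt] := seg_bdry oG Gy nGy'.
      set z := y + t *: (y' - y) in bt.
      have zE : y' - z = (1 - t) *: (y' - y) by rewrite /z scalerBl scale1r opprD addrA.
      have zy : `|y' - z| <= h.
        rewrite zE normrZ ger0_norm ?subr_ge0 //; apply: le_trans yy.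
        by rewrite ler_piMl //; move: t0; clear; lra.
      have zM : `|z| <= M + 1.
        have := closure_bounded hM (proj1 bt); clear; lra.
      have := hL y' z y'M zM; rewrite (rb _ bt) subr0 => h1.
      have {}h1 : `|k * rho y'| <= k * L * h.
        rewrite normrM gtr0_norm // -mulrA ler_pM2l //; apply: le_trans h1 _.
        by rewrite ler_pM2l.
      rewrite /b fE; move: h1; set q := k * rho y'; rewrite ler_norml => /andP[q1 q2].
      have : 0 <= (k * L * h - q) * (k * L * h + q) by rewrite mulr_ge0 //; move: q1 q2; clear; lra.
      have : (k * L * h) * (k * L * h) <= 1 / 4 * (k * L * h) by rewrite ler_wpM2r.
      by move: q1 kLh0; clear; lra.
    have [ky'|ky'] := ltP (k * rho y') (1 / 2); first by left.
    right; have /andP[_ v1] := hv y'.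
    have h1 := hL y' y y'M yM1.
    have {}h1 : k * (rho y' - rho y) <= k * L * h.
      rewrite -mulrA ler_pM2l //; apply: le_trans (ler_norm _) (le_trans h1 _).
      by rewrite ler_pM2l.
    have h2 : k * rho y' <= 3 / 4 by move: h1 ky kLh; clear; lra.
    have : 1 / 2 * (5 / 4) <= f y' by rewrite fE; apply: ler_pM => //; move: h2; clear; lra.
    by rewrite /b; move: v1 kLh0; clear; lra.
  move=> i; split; apply: nb.
  - by have := rnd_step y i 1 hp; rewrite !mul1r yE.
  - by rewrite addrAC subrr add0r norm_ebase gtr0_norm.
  - by have := rnd_step y i (-1) hp; rewrite mulrN1z !mulN1r !scaleNr yE.
  - by rewrite addrAC subrr add0r normrN norm_ebase gtr0_norm.
move=> x Gx xE; have rx := rpos x Gx.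
have e1 : 0 <= k * rho x by rewrite mulr_ge0 // ltW.
have e2 : 0 <= k * L * h by rewrite !mulr_ge0 // ltW.
have e3 : 0 <= k * L * rho x by rewrite !mulr_ge0 // ltW.
have e4 : 0 <= k * h by rewrite !mulr_ge0 // ltW.
have [kx|kx] := ltP (k * rho x) (1 / 2).
  have := main x; rewrite /b fE => /(_ (And3 Gx xE kx)).
  have := mulr_ge0 e1 e1; move: e1 e2 e3 e4; clear; lra.
by have /andP[_ v1] := hv x; move: kx v1 e2 e3 e4; clear; lra.
Qed.

End DiscreteProblem.

Section LimitFunction.
Context {R : realType} {N : nat}.
Implicit Types (x y : 'rV[R]_N) (i j : 'I_N) (G : set 'rV[R]_N).

Lemma disc_lip_abs (h rr M : R) f x0 j x s : 0 < h -> 0 <= M -> (forall x, f (rnd h x) = f x) ->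
  (forall x, `|x - x0| <= rr -> `|dquot1 h j f x| <= M) ->
  `|x - x0| <= rr -> `|x + s *: ebase j - x0| <= rr ->
  `|f (x + s *: ebase j) - f x| <= M * (`|s| + h).
Proof.
move=> h0 M0 fr hd; wlog s0 : x s / 0 <= s.
  move=> W xr xsr; have [s0|s0] := leP 0 s; first exact: W.
  have := W (x + s *: ebase j) (- s); rewrite step_back normrN [`|f x - _|]distrC.
  by apply=> //; rewrite oppr_ge0 ltW.
by move=> xr xsr; rewrite (ger0_norm s0); have [] := disc_lip h0 M0 fr hd s0 xr xsr.
Qed.

Lemma Uf_cst (a : R) : (fun=> a) @ Uf --> a.
Proof. exact: cvg_cst. Qed.
Arguments Uf_cst : clear implicits.

Lemma cvg_rnd x : (fun n => rnd (mesh n) x) @ Uf --> x.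
Proof.
apply/cvgrPdist_lt => e e0; have /cvgrPdist_lt/(_ e e0) := @Uf_inv R; apply: filterS => n.
rewrite sub0r normrN gtr0_norm ?mesh_gt0 // -/(mesh n) distrC; apply: le_lt_trans.
exact: rnd_near (mesh_gt0 n).
Qed.

Arguments cvg_rnd : clear implicits.

Lemma mesh_lt (e : R) : 0 < e -> \forall n \near Uf, mesh n < e.
Proof.
move=> e0; have /cvgrPdist_lt/(_ e e0) := @Uf_inv R; apply: filterS => n.
by rewrite sub0r normrN gtr0_norm ?mesh_gt0.
Qed.

(* Either [c > 0] and the parameter reached [l0], or the normalised minimal
   supersolutions blow up and their limit is an eigenfunction. *)
Lemma limit_fun G (M l0 : R) rho g H : (0 < N)%N -> open G -> G !=set0 ->
  (forall x, G x -> `|x| <= M) -> dfun G rho g H -> 0 <= l0 ->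
  exists (v : 'rV[R]_N -> R) (D1 : 'I_N -> 'rV[R]_N -> R) (D2 : 'I_N -> 'I_N -> 'rV[R]_N -> R) (mu c : R),
  [/\ continuous v, forall x, 0 <= v x <= 1, forall x, ~ G x -> v x = 0 &
   forall x, G x -> [/\ forall i : 'I_N, is_derive x (ebase i) v (D1 i x) /\ {for x, continuous (D1 i)},
     forall i j : 'I_N, is_derive x (ebase j) (D1 i) (D2 i j x) /\ {for x, continuous (D2 i j)} &
     \sum_i D2 i i x = - (mu * v x + c)]] /\
  [/\ 0 <= mu <= l0, 0 <= c, c = 0 -> exists2 x, G x & 0 < v x & 0 < c -> mu = l0].
Proof.
move=> N0 oG G0 hM dG l00.
have h01 n : 0 < (mesh n : R) <= 1 by rewrite mesh_gt0 invf_le1 ?ler1n.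
have /choice[v_ /choice[l_ /choice[c_ hA]]] := fun n => normalized_super_ex N0 (h01 n) hM l00.
have [K [h0 [K0 h00 hK]]] := disc_barrier N0 oG hM dG l00.
have [[cr _ _ _] rpos rb _] := dG.
have vr : grid_inv v_ by move=> n; have [[]] := hA n.
have v01 n x : 0 <= v_ n x <= 1 by have [[]] := hA n.
have vn n x : `|v_ n x| <= 1 by have /andP[? ?] := v01 n x; rewrite ger0_norm.
have l01 n : 0 <= l_ n <= l0 by have [[]] := hA n.
have c01 n : 0 <= c_ n <= 1 by have [[]] := hA n.
have vcvg x : (v_ ^~ x) @ Uf --> flim v_ x by apply: (@UlimP _ _ 1); apply: nearW.
have lcvg : l_ @ Uf --> Ulim l_.
  by apply: (@UlimP _ _ l0); apply: nearW => n; have /andP[? ?] := l01 n; rewrite ger0_norm.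
have ccvg : c_ @ Uf --> Ulim c_.
  by apply: (@UlimP _ _ 1); apply: nearW => n; have /andP[? ?] := c01 n; rewrite ger0_norm.
have ub x : 0 <= flim v_ x <= 1.
  apply/andP; split.
    by apply: (Uf_le (Uf_cst 0) (vcvg x)); apply: nearW => n; have /andP[] := v01 n x.
  by apply: (Uf_le (vcvg x) (Uf_cst 1)); apply: nearW => n; have /andP[] := v01 n x.
have rcvg (xn : nat -> 'rV[R]_N) x : xn @ Uf --> x ->
    (fun n => K * (`|rho (xn n)| + mesh n)) @ Uf --> K * (`|rho x| + 0).
  move=> hx; apply: cvgM; first exact: cvg_cst.
  by apply: cvgD; [apply: cvg_norm; exact: (cvg_comp _ _ hx (cr x)) | exact: Uf_inv].
have barr : \forall n \near Uf, forall x, G x -> rnd (mesh n) x = x -> v_ n x <= K * (`|rho x| + mesh n).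
  apply: filterS (mesh_lt h00) => n hn x Gx xE.
  have [[_ _ _ _ vout] [veq _ _]] := hA n.
  have hn' : 0 < (mesh n : R) <= h0 by apply/andP; split; [exact: mesh_gt0 | exact: ltW].
  apply: le_trans (hK _ _ _ _ hn' (l01 n) (c01 n) (v01 n) vout veq x Gx xE) _.
  by rewrite ler_pM2l // lerD2r ler_norm.
(* The discrete barrier in the limit; it yields the zero boundary values and the continuity of
   [flim v_] at the boundary. *)
have vrho x : flim v_ x <= K * `|rho x|.
  have rx := rcvg _ _ (cvg_rnd x); rewrite addr0 in rx; apply: (Uf_le (vcvg x) rx).
  apply: filterS barr => n hn; rewrite -vr.
  have [Gr|nGr] := pselect (G (rnd (mesh n) x)); first by apply: hn => //; rewrite rnd_id ?mesh_gt0.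
  have [[_ _ _ _ vout] _] := hA n.
  by rewrite vout ?rnd_id ?mesh_gt0 // mulr_ge0 ?(ltW K0) // addr_ge0 // ltW ?mesh_gt0.
have out x : ~ closure G x -> exists2 r : R, 0 < r & forall y, `|y - x| < r -> ~ G y.
  move=> ncl; have [|r r0 hr] := @open_ball _ _ (~` closure G) x _ ncl.
    exact: closed_openC (@closed_closure _ G).
  by exists r => // y /hr h /subset_closure.
have v0 x : ~ G x -> flim v_ x = 0.
  move=> nG; have [cl|/out[r r0 hr]] := pselect (closure G x).
    have bx : bdry G x by rewrite bdry_open.
    apply/eqP; rewrite eq_le; have /andP[-> _] := ub x.
    by rewrite andbT; have := vrho x; rewrite (rb _ bx) normr0 mulr0.
  apply: Ulim_eq; apply: cvg_near_cst; apply: filterS (mesh_lt r0) => n hn.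
  have [[_ _ _ _ vout] _] := hA n; apply: vout; apply: hr.
  exact: le_lt_trans (rnd_near x (mesh_gt0 n)) hn.
have loc x : G x -> exists2 r : R, 0 < r & \forall n \near Uf, disc_eq (mesh n) x (8 * r) 1 (l_ n) (c_ n) (v_ n).
  move=> Gx; have [r0 r00 hr] := open_ball oG Gx.
  (* The cube has radius [8 r], and rounding moves its points by less than [r]. *)
  exists (r0 / 9); first by rewrite divr_gt0.
  have r9 : 0 < r0 / 9 by rewrite divr_gt0.
  apply: filterS (mesh_lt r9) => n hn y yr; split=> //.
  have [_ [veq _ _]] := hA n; apply: veq; apply: hr.
  rewrite -(subrK y (rnd _ _)) -addrA; apply: le_lt_trans (ler_normD _ _) _.
  have := rnd_near y (mesh_gt0 n); move: hn yr; clear; lra.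
have int x : G x -> [/\ {for x, continuous (flim v_)},
    forall i : 'I_N, is_derive x (ebase i) (flim v_) (flim (dquot i v_) x) /\ {for x, continuous (flim (dquot i v_))},
    forall i j : 'I_N, is_derive x (ebase j) (flim (dquot i v_)) (flim (dquot j (dquot i v_)) x) /\
      {for x, continuous (flim (dquot j (dquot i v_)))} &
    \sum_i flim (dquot i (dquot i v_)) x = - (Ulim l_ * flim v_ x + Ulim c_)].
  move=> /loc[r r0 hr].
  apply: (disc_limit N0 r0 ltr01 l00 vr l01 c01 hr).
  by rewrite subrr normr0 mulr_gt0.
exists (flim v_), (fun i => flim (dquot i v_)), (fun i j => flim (dquot j (dquot i v_))), (Ulim l_), (Ulim c_).
split; split.
- move=> x; have [/int[]//|nG] := pselect (G x).
  apply: cont_eps => e e0; rewrite (v0 x nG).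
  have [cl|/out[r r0 hr]] := pselect (closure G x); last first.
    by exists r => // y /hr /v0 ->; rewrite subr0 normr0.
  have bx : bdry G x by rewrite bdry_open.
  have eK : 0 < e / K by rewrite divr_gt0.
  have /cvgrPdist_lt/(_ (e / K) eK)/nbhs_ballP[d /= d0 hd] := cr x.
  exists d => // y yd; rewrite subr0; have /andP[vy _] := ub y; rewrite ger0_norm //.
  apply: le_lt_trans (vrho y) _; rewrite mulrC -ltr_pdivlMr //.
  have := hd y; rewrite -ball_normE /= [`|x - y|]distrC => /(_ yd).
  by rewrite (rb _ bx) sub0r normrN.
- exact: ub.
- exact: v0.
- by move=> x /int[].
- apply/andP; split.
    by apply: (Uf_le (Uf_cst 0) lcvg); apply: nearW => n; have /andP[] := l01 n.
  by apply: (Uf_le lcvg (Uf_cst l0)); apply: nearW => n; have /andP[] := l01 n.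
- by apply: (Uf_le (Uf_cst 0) ccvg); apply: nearW => n; have /andP[] := c01 n.
(* Eventually [c_ n] differs from 1, so some node [x_ n] has value at least 1/2. The barrier keeps
   the limit of the nodes inside [G], and the uniform Lipschitz bound carries the value over to that
   limit. *)
- move=> cz; rewrite cz in ccvg.
  have /choice[x_ hx] : forall n, exists x, c_ n = 1 \/ [/\ G x, rnd (mesh n) x = x & 1 / 2 <= v_ n x].
    by move=> n; have [_ [_ _ [->|[x hx]]]] := hA n; [exists 0; left | exists x; right].
  have hx' : \forall n \near Uf, [/\ G (x_ n), rnd (mesh n) (x_ n) = x_ n & 1 / 2 <= v_ n (x_ n)].
    have /cvgrPdist_lt/(_ 1 ltr01) := ccvg; apply: filterS => n.
    by have [-> |//] := hx n; rewrite sub0r normrN normr1 ltxx.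
  have [xs hxs] : exists l : 'rV[R]_N, x_ @ Uf --> l.
    by apply: (@Uf_bounded_rV _ _ _ M); apply: filterS hx' => n [/hM].
  have Gxs : G xs.
    have cl : closure G xs by apply: (closure_Uf hxs); apply: filterS hx' => n [].
    apply: contrapT => nG; have bx : bdry G xs by rewrite bdry_open.
    have : 1 / 2 <= K * (`|rho xs| + 0).
      apply: (Uf_le (Uf_cst (1 / 2)) (rcvg _ _ hxs)).
      apply: filterS (filterI barr hx') => n [hb [Gx xE hv]].
      exact: le_trans hv (hb _ Gx xE).
    by rewrite (rb _ bx) normr0 addr0 mulr0; clear; lra.
  exists xs => //; have [r r0 hr] := loc xs Gxs.
  pose m : R := r * (l0 * 1 + 1) + (2 * N%:R + 2) * 1 / r.
  have m0 : 0 <= m.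
    rewrite /m !mulr1 addr_ge0 //; first by rewrite mulr_ge0 ?addr_ge0 // ltW.
    by rewrite divr_ge0 ?addr_ge0 ?mulr_ge0 // ltW.
  have r2 : 0 < r / 2 by rewrite divr_gt0.
  have r6 : 0 < 6 * r by rewrite mulr_gt0.
  have : 1 / 2 <= flim v_ xs + 0.
    have z1 : (fun n => m * (N%:R * (`|x_ n - xs| + mesh n))) @ Uf --> m * (N%:R * (0 + 0)).
      apply: cvgM; first exact: cvg_cst.
      apply: cvgM; first exact: cvg_cst.
      apply: cvgD; last exact: Uf_inv.
      rewrite -(normr0 'rV[R]_N) -(subrr xs); apply: cvg_norm.
      by apply: cvgB => //; exact: cvg_cst.
    rewrite addr0 mulr0 mulr0 in z1.
    have z2 : (fun n => v_ n xs + m * (N%:R * (`|x_ n - xs| + mesh n))) @ Uf --> flim v_ xs + 0.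
      exact: cvgD (vcvg xs) z1.
    apply: (Uf_le (Uf_cst (1 / 2)) z2).
    have /cvgrPdist_lt/(_ _ r6) hxr := hxs.
    apply: filterS (filterI hr (filterI (mesh_lt r2) (filterI hxr hx'))) => n [hn [h2 [hxn [_ _ hv]]]].
    have h2' : 2 * mesh n <= r by move: h2; clear; lra.
    have hd i : forall x, `|x - xs| <= 6 * r -> `|dquot1 (mesh n) i (v_ n) x| <= m.
      move=> x xr; have xr' : `|x - xs| <= 8 * r - 2 * r by move: xr; clear; lra.
      by have [] := disc_step i N0 (mesh_gt0 n) h2' ltr01 (l01 n) (c01 n) hn xr'.
    rewrite distrC in hxn.
    have := @coord_total_err R N (v_ n) (fun=> 0) xs _ (fun s => m * (`|s| + mesh n)) _ (x_ n - xs) hxn.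
    rewrite big1 => [|i _]; last by rewrite mulr0.
    rewrite addrCA subrr addr0 subr0 => T; apply: le_trans hv _.
    have {}T : `|v_ n (x_ n) - v_ n xs| <= m * (N%:R * (`|x_ n - xs| + mesh n)).
      apply: le_trans (T _) _.
        move=> y i s y1 y2; rewrite mulr0 subr0.
        exact: (disc_lip_abs (mesh_gt0 n) m0 (vr n) (hd i) (ltW y1) (ltW y2)).
      rewrite -mulr_sumr ler_wpM2l // big_split /= sumr_const card_ord mulr_natl mulrnDl lerD2r.
      by rewrite -mulr_natl; exact: sum_norm_le.
    by have := le_trans (ler_norm _) T; clear; lra.
  by rewrite addr0; clear; lra.
(* With a positive limit, [c_ n <= mesh n] fails eventually, which leaves [l_ n = l0]. *)
- move=> cp; have c2 : 0 < Ulim c_ / 2 by rewrite divr_gt0.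
  have /cvgrPdist_lt/(_ _ c2) hc := ccvg.
  apply: Ulim_eq; apply: cvg_near_cst; apply: filterS (filterI hc (mesh_lt c2)) => n [h1 h2].
  have [_ [_ [//|h3] _]] := hA n.
  by move: h1; rewrite ltr_norml => /andP[_ h1]; move: h1 h2 h3 cp; clear; lra.
Qed.

End LimitFunction.

(** * Strong maximum principle and connected components *)

Section StrongMax.
Context {R : realType} {N : nat}.
Implicit Types (x y z : 'rV[R]_N) (i j : 'I_N).

Lemma C3T_pow (f : 'rV[R]_N -> R) g H q : C3T f g H ->
  C3T (fun x => f x ^+ q.+2) (fun i x => q.+2%:R * f x ^+ q.+1 * g i x)
      (fun i x => q.+2%:R * (q.+1%:R * f x ^+ q * g i x ^+ 2 + f x ^+ q.+1 * H i x)).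
Proof.
move=> h; elim: q => [|q IH].
  by apply: C3T_ext (C3T_M h h) _ _ _ => [x|i x|i x]; rewrite ?expr0 ?expr1; ring.
apply: C3T_ext (C3T_M h IH) _ _ _ => [x|i x|i x]; first by rewrite -exprS.
  by rewrite -[q.+3%:R]natr1 ![f x ^+ _.+2]exprS; ring.
by rewrite -[q.+3%:R]natr1 -[q.+2%:R]natr1 ![f x ^+ _.+2]exprS ![f x ^+ _.+1]exprS; ring.
Qed.

(* Comparison on the ball with the barrier [eps (r^2 - |x - z|^2)^q], which is
   subharmonic away from the centre once [q] is large. *)
Lemma strong_max (v : 'rV[R]_N -> R) z (r : R) : (0 < N)%N -> continuous v -> 0 < r ->
  (forall x, 0 <= v x) ->
  (forall x, sqn (x - z) < r ^+ 2 -> exists g H,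
     (forall i : 'I_N, jet2 (fun s => v (x + s *: ebase i)) (g i) (H i)) /\ \sum_i H i <= 0) ->
  0 < v z -> forall x, sqn (x - z) < r ^+ 2 -> 0 < v x.
Proof.
move=> N0 cv r0 v0 hv vz x xr.
have n0 : 0 < N%:R :> R by rewrite ltr0n.
have r20 : 0 < r ^+ 2 by rewrite exprn_gt0.
have csz : continuous (fun y => sqn (y - z)).
  by have [] := C3T_sqn z.
have [s2 [s20 sm]] : exists s2 : R, 0 < s2 /\ forall y, sqn (y - z) < s2 -> v z / 2 < v y.
  have vz2 : 0 < v z / 2 by rewrite divr_gt0.
  have /cvgrPdist_lt/(_ _ vz2)/nbhs_ballP[d /= d0 hd] := cv z.
  exists (d ^+ 2); split; first by rewrite exprn_gt0.
  move=> y yd; have yz : `|z - y| < d.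
    rewrite distrC; apply: le_lt_trans (norm_le_enorm _) _.
    by rewrite -(gtr0_norm d0) -sqrtr_sqr ltr_sqrt // exprn_gt0.
  by have := hd y; rewrite -ball_normE /= => /(_ yz); rewrite ltr_norml => /andP[_]; clear; lra.
(* Ensures [4 (q + 1) s2 > 2 N r^2], so that the Laplacian of [w] is positive at interior points
   with [sqn (y - z) >= s2]. *)
pose q := Num.truncn (N%:R * r ^+ 2 / (2 * s2)).
have hq : N%:R * r ^+ 2 < 2 * s2 * q.+1%:R.
  have := truncnS_gt (N%:R * r ^+ 2 / (2 * s2)); rewrite -/q ltr_pdivrMr ?mulr_gt0 //.
  by rewrite [2 * s2 * _]mulrC.
clearbody q.
pose f y := r ^+ 2 - sqn (y - z).
have hf : C3T f (fun i y => - 2 * (y 0 i - z 0 i)) (fun _ _ => - 2).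
  apply: C3T_ext (C3T_lin (r ^+ 2) (-1) (C3T_cst 1) (C3T_sqn z)) _ _ _ => [y|i y|i y]; rewrite /f; ring.
have hw := C3T_pow q hf.
set w := (fun _ => _) in hw; set Hw := (X in C3T _ _ X) in hw.
have w_pos y : sqn (y - z) < s2 -> sqn (y - z) < r ^+ 2 -> w y <= (r ^+ 2) ^+ q.+2.
  move=> _ h; rewrite /w ler_pXn2r ?nnegrE ?(ltW r20) // /f ?subr_ge0 ?(ltW h) //.
  by rewrite gerBl sqn_ge0.
pose W : R := (r ^+ 2) ^+ q.+2.
have W0 : 0 < W by rewrite exprn_gt0.
pose eps := v z / 2 / W.
have eps0 : 0 < eps by rewrite !divr_gt0.
pose phi y := v y - eps * w y.
have cphi : continuous phi by apply: contB => //; apply: contZ; have [] := hw.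
pose A y := sqn (y - z) <= r ^+ 2.
have Az : A z by rewrite /A subrr (_ : sqn 0 = 0) ?ltW // /sqn big1 // => i _; rewrite mxE expr0n.
have [y Ay ymin] : exists2 y, A y & forall y', A y' -> - phi y' <= - phi y.
  apply: (@usc_max R 'rV[R]_N A (fun y => - phi y)); first by exists z.
  move=> yn hyn; have [y hy] : exists l : 'rV[R]_N, yn @ Uf --> l.
    apply: (@Uf_bounded_rV _ _ _ (`|z| + r)); apply: nearW => n.
    have -> : yn n = z + (yn n - z) by rewrite addrC subrK.
    apply: le_trans (ler_normD _ _) _; rewrite lerD2l; apply: le_trans (norm_le_enorm _) _.
    by rewrite -(gtr0_norm r0) -sqrtr_sqr ler_sqrt ?(ltW r20) //; exact: hyn.
  exists y.
    have h1 : (fun n => sqn (yn n - z)) @ Uf --> sqn (y - z) by exact: (cvg_comp _ _ hy (csz y)).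
    have h2 : (fun _ : nat => r ^+ 2) @ Uf --> r ^+ 2 by exact: cvg_cst.
    by apply: (ler_cvg_to h1 h2); apply: nearW.
  move=> e e0; have h1 : (fun n => phi (yn n)) @ Uf --> phi y by exact: (cvg_comp _ _ hy (cphi y)).
  have /cvgrPdist_lt/(_ e e0) := h1; apply: filterS => n.
  by rewrite ltr_norml => /andP[_]; clear; lra.
have phimin : 0 <= phi y.
  rewrite leNgt; apply/negP => phi0.
  have yr : sqn (y - z) < r ^+ 2.
    rewrite lt_neqAle [X in _ && X](Ay : _ <= _) andbT; apply/eqP => E.
    by move: phi0; rewrite /phi /w /f E subrr expr0n /= mulr0 subr0 ltNge v0.
  have ys : s2 <= sqn (y - z).
    rewrite leNgt; apply/negP => h; have h1 := sm _ h; have h2 := w_pos _ h yr.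
    have : eps * w y <= v z / 2.
      rewrite (_ : eps * w y = v z / 2 * (w y / W)); last by rewrite /eps; ring.
      have h3 : w y / W <= 1 by rewrite ler_pdivrMr // mul1r.
      by apply: ler_piMr => //; rewrite divr_ge0 // ltW.
    by move: phi0 h1; rewrite /phi; clear; lra.
  have f0 : 0 < f y by rewrite subr_gt0.
  have fr : f y <= r ^+ 2 by rewrite gerBl sqn_ge0.
  have [g [H [hH sH]]] := hv y yr.
  have Hle i : eps * Hw i y - H i <= 0.
    have j1 := jet2B (jet2Z eps (C3T_jet2 y i hw)) (hH i).
    have [d d0 hd] : exists2 d : R, 0 < d & forall s, `|s| < d -> A (y + s *: ebase i).
      have [|d d0 hd] := @line_in R N [set u | sqn (u - z) < r ^+ 2] y (ebase i) _ yr.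
        exact: (open_comp (fun u _ => csz u) (@open_lt _ (r ^+ 2))).
      by exists d => // s /hd /ltW.
    have hm s : `|s| < d -> eps * w (y + s *: ebase i) - v (y + s *: ebase i) <=
        eps * w (y + 0 *: ebase i) - v (y + 0 *: ebase i).
      by move=> /hd /ymin; rewrite /phi scale0r addr0; clear; lra.
    by have [] := jet2_max d0 j1 hm.
  have : \sum_i (eps * Hw i y - H i) <= 0 by apply: sumr_le0 => i _.
  rewrite sumrB -mulr_sumr leNgt => /negP; apply.
  suff : 0 < \sum_i Hw i y by move=> h; rewrite subr_gt0; apply: le_lt_trans sH _; rewrite mulr_gt0.
  have -> : \sum_i Hw i y = q.+2%:R * f y ^+ q * (q.+1%:R * 4 * sqn (y - z) - 2 * N%:R * f y).
    have -> : 2 * N%:R * f y = \sum_(i < N) 2 * f y by rewrite sumr_const card_ord -mulr_natl; ring.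
    rewrite /sqn mulr_sumr -sumrB mulr_sumr; apply: eq_bigr => i _.
    by rewrite /Hw !mxE [f y ^+ q.+1]exprS; ring.
  rewrite !mulr_gt0 ?exprn_gt0 // subr_gt0.
  apply: le_lt_trans (_ : 2 * N%:R * r ^+ 2 < _).
    by rewrite ler_pM2l // mulr_gt0.
  have : 2 * s2 * q.+1%:R <= 2 * sqn (y - z) * q.+1%:R by rewrite ler_pM2r // ler_pM2l.
  by move: hq; clear; lra.
have Ax : A x by exact: ltW.
have := ymin x Ax; rewrite lerN2 => /(le_trans phimin); rewrite /phi subr_ge0; apply: lt_le_trans.
by rewrite mulr_gt0 // exprn_gt0 // subr_gt0.
Qed.

End StrongMax.

Section Components.
Context {R : realType} {N : nat}.
Implicit Types (x y z u : 'rV[R]_N) (Omega P : set 'rV[R]_N).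

Lemma le_dilate (r : R) : 0 < r -> r <= (N%:R + 1) * r.
Proof. by move=> r0; rewrite mulrDl mul1r lerDr mulr_ge0 // ltW. Qed.

(** The factor [N + 1] leaves room for a Euclidean ball between the two cubes, as required by a
    strong maximum principle stated on balls. *)
Definition cube_stable Omega P := forall z y (r : R), 0 < r ->
  (forall u, `|u - z| < (N%:R + 1) * r -> Omega u) -> `|y - z| < r -> P z -> P y.

(* The connected component of [x] in [Omega], defined impredicatively. *)
Definition component Omega x : set 'rV[R]_N := [set y | forall P, cube_stable Omega P -> P x -> P y].

Lemma comp_refl Omega x : component Omega x x. Proof. by move=> P. Qed.

Lemma comp_fwd Omega x : cube_stable Omega (component Omega x).
Proof. by move=> z y r r0 hz yz cz P fP Px; apply: (fP z y r r0 hz yz); exact: cz. Qed.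

Lemma comp_sub Omega x : Omega x -> component Omega x `<=` Omega.
Proof.
move=> Ox y; apply=> // z u r r0 hz uz _; apply: hz; apply: lt_le_trans uz _.
exact: le_dilate.
Qed.

(** The segment from [x] to [y] stays at a positive distance from the sides of the cube and is
    covered by steps short enough for stability. *)
Lemma cube_stable_chain Omega P z (rr : R) x y : cube_stable Omega P -> (forall u, `|u - z| < rr -> Omega u) ->
  `|x - z| < rr -> `|y - z| < rr -> P x -> P y.
Proof.
move=> fP hz xz yz Px.
pose m := Num.max `|x - z| `|y - z|.
have mr : m < rr by rewrite gt_max xz.
pose D := (m + rr) / 2.
have xm : `|x - z| <= m by rewrite le_max lexx.
have ym : `|y - z| <= m by rewrite le_max lexx orbT.
have mD : m < D by rewrite /D; move: mr; clear; lra.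
have Dr : D < rr by rewrite /D; move: mr; clear; lra.
clearbody D m.
have N1 : 0 < N%:R + 1 :> R by rewrite ltr_wpDl.
pose r := (rr - D) / (N%:R + 1).
have r0 : 0 < r by rewrite divr_gt0 // subr_gt0.
have rE : (N%:R + 1) * r = rr - D by rewrite mulrC divfK ?gt_eqF.
pose n := Num.truncn (`|y - x| / r).
have hn : `|y - x| < n.+1%:R * r by have := truncnS_gt (`|y - x| / r); rewrite ltr_pdivrMr.
clearbody n r.
pose p k := x + (k%:R / n.+1%:R) *: (y - x).
have pD k : (k <= n.+1)%N -> `|p k - z| < D.
  move=> kn; apply: (@segment_norm _ _ x (y - x) z (k%:R / n.+1%:R) 1).
  - by rewrite mulr1 divr_ge0.
  - by rewrite normr1 ger0_norm ?divr_ge0 // ler_pdivrMr // mul1r ler_nat.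
  - exact: le_lt_trans mD.
  - by rewrite scale1r [x + _]addrC subrK; exact: le_lt_trans mD.
have H k : (k <= n.+1)%N -> P (p k).
  elim: k => [|k IH] kn; first by rewrite /p mul0r scale0r addr0.
  apply: (fP (p k) _ r r0) (IH (ltnW kn)).
    move=> u hu; apply: hz; rewrite -(subrK (p k) u) -addrA.
    apply: le_lt_trans (ler_normD _ _) _; have := pD k (ltnW kn).
    by move: hu; rewrite rE; clear; lra.
  rewrite (_ : p k.+1 - p k = n.+1%:R^-1 *: (y - x)); last first.
    by rewrite /p opprD addrACA subrr add0r -scalerBl -natr1 mulrDl mul1r addrAC subrr add0r.
  by rewrite normrZ gtr0_norm ?invr_gt0 // mulrC ltr_pdivrMr // mulrC.
by have := H n.+1 (leqnn _); rewrite /p divff ?pnatr_eq0 // scale1r [x + _]addrC subrK.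
Qed.

Lemma comp_trans Omega x y : component Omega x y -> component Omega y `<=` component Omega x.
Proof. by move=> cxy u cyu P fP Px; apply: cyu => //; apply: cxy. Qed.

(** The definition is instantiated with the points whose component contains [x]; [cube_stable_chain]
    provides the way back to the centre of a cube. *)
Lemma comp_sym Omega x y : component Omega x y -> component Omega y x.
Proof.
move=> cxy; apply: (cxy [set u | component Omega u x]); last exact: comp_refl.
move=> z u r r0 hz uz /= czx; apply: (comp_trans _ czx).
have z1 : `|z - z| < (N%:R + 1) * r by rewrite subrr normr0 mulr_gt0 // ltr_wpDl.
have u1 : `|u - z| < (N%:R + 1) * r by apply: lt_le_trans uz _; exact: le_dilate.
by apply: (cube_stable_chain (@comp_fwd Omega u) hz u1 z1); exact: comp_refl.
Qed.

Lemma comp_eq Omega x y : component Omega x y -> component Omega y = component Omega x.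
Proof. by move=> cxy; apply/seteqP; split; apply: comp_trans => //; exact: comp_sym. Qed.

Lemma comp_ball Omega x y : open Omega -> Omega x -> component Omega x y ->
  exists2 r : R, 0 < r & forall u, `|u - y| < r -> component Omega x u.
Proof.
move=> oO Ox cy; have [r r0 hr] := open_ball oO (comp_sub Ox cy).
exists r => // u uy; apply: (cube_stable_chain (@comp_fwd Omega x) hr _ uy cy).
by rewrite subrr normr0.
Qed.

Lemma comp_open Omega x : open Omega -> Omega x -> open (component Omega x).
Proof.
move=> oO Ox; rewrite openE => y /(comp_ball oO Ox)[r r0 hr].
by apply/nbhs_ballP; exists r => // u; rewrite -ball_normE /= distrC => /hr.
Qed.

Lemma comp_bdry Omega x : open Omega -> Omega x -> bdry (component Omega x) `<=` bdry Omega.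
Proof.
move=> oO Ox y; rewrite !bdry_open //; last exact: comp_open.
move=> [cl nc]; split; first exact: (closure_subset (comp_sub Ox)) cl.
move=> Oy; have [r r0 hr] := open_ball oO Oy; apply: nc.
have [|u [cu /= uy]] := cl [set u | `|u - y| < r].
  by apply/nbhs_ballP; exists r => // u; rewrite -ball_normE /= distrC.
have y1 : `|y - y| < r by rewrite subrr normr0.
exact: (cube_stable_chain (@comp_fwd Omega x) hr uy y1 cu).
Qed.

(** By [strong_max], positivity is a stable property in the sense of [cube_stable], so it spreads
    over the component from one point. *)
Lemma comp_pos Omega x (v : 'rV[R]_N -> R) : (0 < N)%N -> open Omega -> Omega x -> continuous v ->
  (forall y, 0 <= v y) -> (forall y, ~ component Omega x y -> v y = 0) ->
  (forall y, component Omega x y -> exists g H,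
     (forall i : 'I_N, jet2 (fun s => v (y + s *: ebase i)) (g i) (H i)) /\ \sum_i H i <= 0) ->
  (exists2 y, component Omega x y & 0 < v y) -> forall y, component Omega x y -> 0 < v y.
Proof.
move=> N0 oO Ox cv v0 vout hv [y0 cy0 vy0] y.
rewrite -(comp_eq cy0) => cy; apply: (cy [set u | 0 < v u]) => // z u r r0 hz uz /= vz.
have cz : component Omega x z by apply: contrapT => /vout E; rewrite E ltxx in vz.
have nr0 : 0 < (N%:R + 1) * r by rewrite mulr_gt0 // ltr_wpDl.
apply: (strong_max N0 cv nr0 v0 _ vz).
  move=> t ht; apply: hv; apply: (cube_stable_chain (@comp_fwd Omega x) hz _ _ cz).
    by rewrite subrr normr0.
  apply: le_lt_trans (norm_le_enorm _) _.
  by rewrite -(gtr0_norm nr0) -sqrtr_sqr ltr_sqrt // exprn_gt0.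
apply: le_lt_trans (sqn_le (lexx `|u - z|)) _.
apply: le_lt_trans (_ : N%:R * r ^+ 2 < _).
  by rewrite ler_wpM2l // ler_pXn2r ?nnegrE ?normr_ge0 ?(ltW r0) // ltW.
rewrite exprMn ltr_pM2r ?exprn_gt0 //.
have := sqr_ge0 (N%:R : R); have : 0 <= N%:R :> R by []; clear; lra.
Qed.

End Components.

(** * Positive supersolution on the whole domain *)

Section Supersolution.
Context {R : realType} {N : nat}.
Implicit Types (x y z u : 'rV[R]_N) (Omega P : set 'rV[R]_N) (v : 'rV[R]_N -> R).

Lemma near_ball_sub (Q : 'rV[R]_N -> Prop) y u (r : R) : `|u - y| < r ->
  (forall t, `|t - y| < r -> Q t) -> \forall t \near u, Q t.
Proof.
move=> uy h; apply/nbhs_ballP; exists (r - `|u - y|); rewrite /= ?subr_gt0 // => t.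
rewrite -ball_normE /= distrC => tu; apply: h; rewrite -(subrK u t) -addrA.
by apply: le_lt_trans (ler_normD _ _) _; move: tu; clear; lra.
Qed.

Lemma near_cont (f g : 'rV[R]_N -> R) y : (\forall t \near y, f t = g t) ->
  {for y, continuous f} -> {for y, continuous g}.
Proof.
move=> /nbhs_ballP[d1 /= d10 h1] c; apply: cont_eps => e e0.
have /cvgrPdist_lt/(_ e e0)/nbhs_ballP[d2 /= d20 h2] := c.
exists (Num.min d1 d2) => [|t]; first by rewrite lt_min d10.
rewrite lt_min distrC => /andP[t1 t2]; rewrite -h1 -?ball_normE //= -h1 -?ball_normE //=.
  by rewrite distrC; apply: h2; rewrite -ball_normE.
by rewrite subrr normr0.
Qed.

Lemma local_partial v y (D1 : 'I_N -> 'rV[R]_N -> R) (D2 : 'I_N -> 'I_N -> 'rV[R]_N -> R) (r : R) :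
  0 < r -> (forall u i, `|u - y| < r -> is_derive u (ebase i) v (D1 i u)) ->
  (forall u i j, `|u - y| < r -> is_derive u (ebase j) (D1 i) (D2 i j u)) ->
  (forall i, {for y, continuous (D1 i)}) -> (forall i j, {for y, continuous (D2 i j)}) ->
  forall i j, [/\ derivable v y (ebase i), {for y, continuous (partial i v)},
    derivable (partial i v) y (ebase j), {for y, continuous (partial j (partial i v))} &
    partial j (partial i v) y = D2 i j y].
Proof.
move=> r0 h1 h2 c1 c2 i j.
have yy : `|y - y| < r by rewrite subrr normr0.
have p1 u : `|u - y| < r -> D1 i u = partial i v u.
  by move=> uy; have ? := h1 u i uy; rewrite /partial derive_val.
have i2 u : `|u - y| < r -> is_derive u (ebase j) (partial i v) (D2 i j u).
  by move=> uy; apply: (near_eq_is_derive _ (h2 u i j uy)); exact: near_ball_sub uy p1.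
have p2 u : `|u - y| < r -> D2 i j u = partial j (partial i v) u.
  by move=> uy; have ? := i2 u uy; rewrite [RHS]/partial derive_val.
split.
- by have ? := h1 y i yy; exact: ex_derive.
- exact: near_cont (near_ball_sub yy p1) (c1 i).
- by have ? := i2 y yy; exact: ex_derive.
- exact: near_cont (near_ball_sub yy p2) (c2 i j).
- by rewrite p2.
Qed.

(** The limit of the discrete problem on one component serves as [psi] there; the point is to show
    that its parameter [mu] is the full target value. *)
Lemma comp_super Omega (l1 : R) rho g H x : (0 < N)%N -> open Omega -> bounded_set Omega ->
  dfun Omega rho g H -> (forall m, dirichlet_eigenvalue Omega m -> l1 <= m) -> Omega x ->
  exists psi : 'rV[R]_N -> R, [/\ continuous psi, forall y, component Omega x y -> 0 < psi y <= 1 &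
    forall y, component Omega x y -> exists g H, (forall i, jet2 (fun s => psi (y + s *: ebase i)) (g i) (H i)) /\
      Num.max 0 l1 * psi y <= - \sum_i H i].
Proof.
move=> N0 oO bO [h3 rpos rb [c c0 [dl dl0 hc]]] hl1 Ox.
pose G := component Omega x; have GO : G `<=` Omega by exact: comp_sub.
have oG : open G by exact: comp_open.
have dG : dfun G rho g H.
  split=> //; first by move=> y /GO /rpos.
  - by move=> y /(comp_bdry oO Ox) /rb.
  - by exists c => //; exists dl => // y /GO /hc.
have /bounded_setP[M hM] := bO.
have GM y : G y -> `|y| <= M by move=> /GO /hM.
have G0 : G !=set0 by exists x; exact: comp_refl.
have l00 : 0 <= Num.max 0 l1 by rewrite le_max lexx.
have [v [D1 [D2 [mu [k [[cv v01 vout hv] [/andP[mu0 mul] k0 kz kp]]]]]]] := limit_fun N0 oG G0 GM dG l00.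
have vge y : 0 <= v y by have /andP[] := v01 y.
have loc y : G y -> exists r : R, [/\ 0 < r, forall u i, `|u - y| < r -> is_derive u (ebase i) v (D1 i u) &
    forall u i j, `|u - y| < r -> is_derive u (ebase j) (D1 i) (D2 i j u)].
  move=> Gy; have [r r0 hr] := comp_ball oO Ox Gy; exists r; split=> // u i.
    by move=> /hr /hv [h _ _]; exact: (h i).1.
  by move=> j /hr /hv [_ h _]; exact: (h i j).1.
have jet y : G y -> (forall i, jet2 (fun s => v (y + s *: ebase i)) (D1 i y) (D2 i i y)).
  move=> Gy i; have [r r0 hr] := comp_ball oO Ox Gy.
  have := @C2_jet2 R N v D1 D2 y r (ebase i) r0.
  rewrite sum_ebase_l (eq_bigr (fun j => ebase i 0 j * D2 j i y)); last first.
    move=> j _; rewrite -(sum_ebase_l i (fun j' => D2 j j' y)) mulr_sumr.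
    by apply: eq_bigr => j' _; rewrite mulrA.
  rewrite sum_ebase_l; apply.
  - by move=> u j /hr /hv [h _ _]; exact: (h j).1.
  - by move=> u j /hr /hv [h _ _]; exact: (h j).2.
  - by move=> u j j' /hr /hv [_ h _]; exact: (h j j').1.
  - by move=> j j'; have [_ h _] := hv y Gy; exact: (h j j').2.
(* For [k > 0] the function cannot vanish identically, since zero does not satisfy
   [- Lap v = mu v + k]. *)
have ex0 : exists2 y, G y & 0 < v y.
  have [/kz//|kn0] := eqVneq k 0.
  have kp' : 0 < k by rewrite lt_neqAle eq_sym kn0.
  apply: contrapT => nex.
  have vz y : v y = 0.
    have [Gy|/vout//] := pselect (G y).
    apply/eqP; rewrite eq_le vge andbT leNgt; apply/negP => vy.
    by apply: nex; exists y.
  have [_ _ hs] := hv x (@comp_refl _ _ _ _).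
  have : 0 <= \sum_i D2 i i x.
    apply: sumr_ge0 => i _.
    have j1 := jet2Z (-1) (jet x (@comp_refl _ _ _ _) i).
    have hm s : `|s| < 1 -> -1 * v (x + s *: ebase i) <= -1 * v (x + 0 *: ebase i) by rewrite !vz.
    have [_] := jet2_max ltr01 j1 hm; rewrite mulN1r oppr_le0; exact.
  by rewrite hs vz mulr0 add0r oppr_ge0 leNgt kp'.
have vpos y : G y -> 0 < v y.
  apply: (comp_pos N0 oO Ox cv vge vout _ ex0) => u Gu.
  exists (D1 ^~ u), (fun i => D2 i i u); split; first exact: jet.
  have [_ _ ->] := hv u Gu; rewrite oppr_le0 addr_ge0 // mulr_ge0 //.
(* If [k = 0], then [v], extended by zero to the other components, is a Dirichlet eigenfunction on
   all of [Omega], and the minimality of [l1] applies. *)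
have muE : mu = Num.max 0 l1.
  have [k_0|kn0] := eqVneq k 0; last by apply: kp; rewrite lt_neqAle eq_sym kn0.
  apply/eqP; rewrite eq_le mul ge_max mu0 /=; apply: hl1; exists v.
  have hloc y : Omega y -> exists D1' D2', [/\ forall i j : 'I_N,
      [/\ derivable v y (ebase i), {for y, continuous (partial i v)},
      derivable (partial i v) y (ebase j), {for y, continuous (partial j (partial i v))} &
      partial j (partial i v) y = D2' i j y], forall i : 'I_N, is_derive y (ebase i) v (D1' i y)
      & \sum_i D2' i i y = - (mu * v y)].
    move=> Oy; have [Gy|nGy] := pselect (G y).
      have [r [r0 a1 a2]] := loc y Gy; have [b1 b2 b3] := hv y Gy.
      exists D1, D2; split.
      - by apply: (local_partial r0 a1 a2) => [i|i j]; [exact: (b1 i).2 | exact: (b2 i j).2].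
      - by move=> i; exact: (b1 i).1.
      - by rewrite b3 k_0 addr0.
    have [r r0 hr] := comp_ball oO Oy (@comp_refl _ _ Omega y).
    have nG u : `|u - y| < r -> v u = 0.
      move=> /hr cu; apply: vout => Gu; apply: nGy.
      by rewrite /G -(comp_eq Gu); exact: comp_sym.
    have d0 (f : 'rV[R]_N -> R) u i : (\forall t \near u, 0 = f t) -> is_derive u (ebase i) f 0.
      by move=> h; apply: (near_eq_is_derive h); exact: is_derive_cst.
    have a1 u (i : 'I_N) : `|u - y| < r -> is_derive u (ebase i) v 0.
      by move=> uy; apply: d0; apply: near_ball_sub uy _ => t /nG ->.
    exists (fun _ _ => 0), (fun _ _ _ => 0); split.
    - apply: (@local_partial v y (fun _ _ => 0) (fun _ _ _ => 0) r r0 a1).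
      + by move=> i; exact: (@contC R 'rV[R]_N 0 y).
      + by move=> i j; exact: (@contC R 'rV[R]_N 0 y).
    - by move=> i; apply: a1; rewrite subrr normr0.
    - by rewrite big1 // vout // mulr0 oppr0.
  split.
  - split; first exact: continuous_subspaceT.
    move=> i; split; first by move=> y /hloc [? [? [h _ _]]]; have [] := h i i.
    split; first by apply: continuous_in_subspaceT => y /set_mem /hloc [? [? [h _ _]]]; have [] := h i i.
    move=> j; split; first by move=> y /hloc [? [? [h _ _]]]; have [] := h i j.
    by split=> //; apply: continuous_in_subspaceT => y /set_mem /hloc [? [? [h _ _]]]; have [] := h i j.
  - split; first exact: continuous_subspaceT.
    by move=> y; rewrite bdry_open // => -[_ nO]; apply: vout => /GO.
  - by exists x => //; rewrite gt_eqF // vpos //; exact: comp_refl.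
  - move=> y /hloc [D1' [D2' [h _ hs]]]; rewrite /laplacian.
    rewrite (eq_bigr (fun i => D2' i i y)) ?hs ?opprK // => i _.
    by have [] := h i i.
exists v; split=> //; first by move=> y Gy; rewrite vpos //; have /andP[] := v01 y.
move=> y Gy; exists (D1 ^~ y), (fun i => D2 i i y); split; first exact: jet.
by have [_ _ ->] := hv y Gy; rewrite opprK -muE lerDl.
Qed.

(** The choice is indexed by the component as a set, not by a point of it, so that nearby points
    share the same function and local regularity is inherited. *)
Lemma psi_super_ex Omega (l1 : R) rho g H : (0 < N)%N -> open Omega -> bounded_set Omega ->
  dfun Omega rho g H -> (forall m, dirichlet_eigenvalue Omega m -> l1 <= m) ->
  exists psi, psi_super Omega (Num.max 0 l1) psi.
Proof.
move=> N0 oO bO dO hl.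
have /choice[F hF] : forall G : set 'rV[R]_N, exists psi : 'rV[R]_N -> R,
    (exists2 x, Omega x & G = component Omega x) ->
    [/\ continuous psi, forall y, G y -> 0 < psi y <= 1 &
    forall y, G y -> exists g H, (forall i, jet2 (fun s => psi (y + s *: ebase i)) (g i) (H i)) /\
      Num.max 0 l1 * psi y <= - \sum_i H i].
  move=> G; have [[x Ox ->]|nex] := pselect (exists2 x, Omega x & G = component Omega x).
    by have [psi hpsi] := comp_super N0 oO bO dO hl Ox; exists psi.
  by exists (fun=> 0) => /nex.
have FO x : Omega x -> exists2 x', Omega x' & component Omega x = component Omega x' by exists x.
exists (fun y => F (component Omega y) y); split.
- move=> x xn Ox hx; have [cF _ _] := hF _ (FO x Ox).
  have h1 : (fun n => F (component Omega x) (xn n)) @ Uf --> F (component Omega x) x.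
    exact: (cvg_comp _ _ hx (cF x)).
  apply: cvg_trans h1; apply: near_eq_cvg.
  have := open_cvg_near (comp_open oO Ox) (@comp_refl _ _ Omega x) hx.
  by apply: filterS => n cn; rewrite (comp_eq cn).
- by move=> x Ox; have [_ h _] := hF _ (FO x Ox); apply: h; exact: comp_refl.
- move=> x Ox; have [_ _ h] := hF _ (FO x Ox).
  have [g' [H' [hj hs]]] := h x (@comp_refl _ _ _ _).
  exists g', H'; split=> // i.
  have [r r0 hr] := line_in (ebase i) (comp_open oO Ox) (@comp_refl _ _ Omega x).
  by apply: jet2_near r0 _ (hj i) => s /hr cs; rewrite (comp_eq cs).
Qed.

End Supersolution.

Theorem theorem1p2 (R : realType) (N : nat) (hN : (0 < N)%N)
    (Omega : set 'rV[R]_N)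
    (hopen : open Omega) (hbounded : bounded_set Omega)
    (hC3 : C3_boundary Omega)
    (lambda1 : R) (hlambda1 : first_dirichlet_eigenvalue Omega lambda1)
    (p a : R) (hp : 1 < p <= 2) (ha : a != 0)
    (u0 : 'rV[R]_N -> R) (hu0 : C0_closure Omega u0) :
  exists2 K : R, 0 < K &
    forall u : R -> 'rV[R]_N -> R,
      classical_solution +oo%E Omega a p u0 u ->
      forall t : R, 0 < t ->
        (Linfty_norm Omega (u t) <= (K * expR (- (t * lambda1)))%:E)%E /\
        (Linfty_norm Omega (fun x => euclid_norm (grad (u t) x)) <=
           (K * (1 + t `^ (- 2^-1)) * expR (- (t * lambda1)))%:E)%E.
Proof.
have [rho [g [H dO]]] := dfun_ex hopen hbounded hC3.
have [psi hpsi] := psi_super_ex hN hopen hbounded dO (proj2 hlambda1).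
(* The maximum with 0 supplies a nonnegative rate without determining the sign of [lambda1]; decay
   at this rate implies decay at [lambda1]. *)
have l0 : 0 <= Num.max 0 lambda1 by rewrite le_max lexx.
have ll : lambda1 <= Num.max 0 lambda1 by rewrite le_max lexx orbT.
exact: (@decay_of_super R N Omega lambda1 _ p a u0 rho g H psi hN hopen hbounded hp hu0 dO hpsi l0 ll).
Qed.
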